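(* Let $f\in\mathbb R(z)$ be a rational map of degree $d\ge2$ and let $\mathcal J_{\mathbb R}(f)=\mathcal J(f)\cap\hat{\mathbb R}$. The non-wandering set of the dynamical system $f\restriction_{\mathcal J_{\mathbb R}(f)}:\mathcal J_{\mathbb R}(f)\to\mathcal J_{\mathbb R}(f)$ is either the whole circle $\hat{\mathbb R}$ or the union of finitely many intervals and a totally disconnected subsystem. Moreover, this system has a closed subsystem (possibly empty) of the same topological entropy in which preperiodic points of $f$ are dense.
   Context: $\hat{\mathbb R}=\mathbb R\cup\{\infty\}$; $\mathcal J(f)$ is the Julia set of $f$. A subsystem is a forward-invariant subset with the restricted dynamics. *)

(* Defs.v *)
From HB Require Import structures.
From mathcomp Require Import all_boot all_order all_algebra.
From mathcomp Require Import all_classical all_reals all_analysis.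
From mathcomp Require Import complex.

Set Implicit Arguments.
Unset Strict Implicit.
Unset Printing Implicit Defensive.

Import Order.TTheory GRing.Theory Num.Theory.
Local Open Scope classical_set_scope.
Local Open Scope ring_scope.

(* Riemann sphere  C^ = option R[i]  (None = infinity) and the real    *)
(* circle  R^ = option R  (None = infinity), with the chordal metric.  *)

Definition sphere (R : realType) := option R[i].
Definition rcircle (R : realType) := option R.

Definition abs2c (R : realType) (z : R[i]) : R :=
  complex.Re z ^+ 2 + complex.Im z ^+ 2.

Definition chordal (R : realType) (z w : sphere R) : R :=
  match z, w with
  | Some a, Some b =>
      2 * Num.sqrt (abs2c (a - b)) / Num.sqrt ((1 + abs2c a) * (1 + abs2c b))
  | Some a, None | None, Some a => 2 / Num.sqrt (1 + abs2c a)
  | None, None => 0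
  end.

Definition embR (R : realType) (x : rcircle R) : sphere R :=
  match x with Some a => Some (a%:C)%C | None => None end.

Definition chordR (R : realType) (x y : rcircle R) : R := chordal (embR x) (embR y).

(* Rational maps with real coefficients f = p / q, p q : {poly R}     *)
(* coprime; its degree is max(deg p, deg q).                          *)

Definition rdeg (R : realType) (p q : {poly R}) : nat :=
  maxn (size p).-1 (size q).-1.

Definition ratC (R : realType) (p q : {poly R}) (z : sphere R) : sphere R :=
  match z with
  | Some a =>
      let qa := (map_poly (real_complex R) q).[a] in
      if qa == 0 then None else Some ((map_poly (real_complex R) p).[a] / qa)
  | None =>
      let d := rdeg p q in
      if q`_d == 0 then None else Some ((p`_d / q`_d)%:C)%C
  end.

Definition ratR (R : realType) (p q : {poly R}) (x : rcircle R) : rcircle R :=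
  match x with
  | Some a => if q.[a] == 0 then None else Some (p.[a] / q.[a])
  | None =>
      let d := rdeg p q in
      if q`_d == 0 then None else Some (p`_d / q`_d)
  end.

Definition normal_on (R : realType) (F : nat -> sphere R -> sphere R)
    (U : set (sphere R)) : Prop :=
  forall m : nat -> nat,
    exists (phi : nat -> nat) (g : sphere R -> sphere R),
      (forall k, (phi k < phi k.+1)%N) /\
      forall w, U w -> exists r : R, 0 < r /\
        forall e : R, 0 < e -> exists N : nat, forall k : nat, (N <= k)%N ->
          forall v, U v -> chordal w v < r ->
            chordal (F (m (phi k)) v) (g v) < e.

Definition Fatou (R : realType) (f : sphere R -> sphere R) : set (sphere R) :=
  [set z | exists delta : R, 0 < delta /\
             normal_on (fun n => iter n f) [set w | chordal z w < delta]].

Definition Julia (R : realType) (f : sphere R -> sphere R) : set (sphere R) :=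
  ~` Fatou f.

Definition JuliaR (R : realType) (p q : {poly R}) : set (rcircle R) :=
  [set x | Julia (ratC p q) (embR x)].

Definition openR (R : realType) (U : set (rcircle R)) : Prop :=
  forall x, U x -> exists e : R, 0 < e /\ forall y, chordR x y < e -> U y.

Definition closedR (R : realType) (Y : set (rcircle R)) : Prop :=
  forall x, (forall e : R, 0 < e -> exists y, Y y /\ chordR x y < e) -> Y x.

Definition closureR (R : realType) (Y : set (rcircle R)) : set (rcircle R) :=
  [set x | forall e : R, 0 < e -> exists y, Y y /\ chordR x y < e].

Definition connectedR (R : realType) (S : set (rcircle R)) : Prop :=
  forall U V, openR U -> openR V -> S `<=` U `|` V -> S `&` U `&` V = set0 ->
    S `&` U = set0 \/ S `&` V = set0.

Definition totally_disconnectedR (R : realType) (K : set (rcircle R)) : Prop :=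
  forall C, C `<=` K -> connectedR C -> forall x y, C x -> C y -> x = y.

Definition real_interval (R : realType) (S : set R) : Prop :=
  forall x y z : R, x <= y -> y <= z -> S x -> S z -> S y.

Definition circle_interval (R : realType) (I : set (rcircle R)) : Prop :=
  (~ I None /\ real_interval [set x | I (Some x)]) \/
  (I None /\ real_interval [set x | ~ I (Some x)]).

Definition nd_interval (R : realType) (I : set (rcircle R)) : Prop :=
  circle_interval I /\ exists x y, x <> y /\ I x /\ I y.

Definition subsystem (R : realType) (X : set (rcircle R))
    (g : rcircle R -> rcircle R) (Y : set (rcircle R)) : Prop :=
  Y `<=` X /\ forall y, Y y -> Y (g y).

Definition nonwandering (R : realType) (X : set (rcircle R))
    (g : rcircle R -> rcircle R) : set (rcircle R) :=
  [set x | X x /\ forall e : R, 0 < e ->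
     exists n : nat, (0 < n)%N /\
       exists y, X y /\ chordR x y < e /\ chordR x (iter n g y) < e].

Definition preperiodic (R : realType) (g : rcircle R -> rcircle R)
    (x : rcircle R) : Prop :=
  exists m n : nat, (0 < n)%N /\ iter (m + n) g x = iter m g x.

Definition separated (R : realType) (g : rcircle R -> rcircle R)
    (Y : set (rcircle R)) (n : nat) (e : R) (E : seq (rcircle R)) : Prop :=
  uniq E /\ (forall x, x \in E -> Y x) /\
  forall x y, x \in E -> y \in E -> x <> y ->
    exists k : nat, (k < n)%N /\ e < chordR (iter k g x) (iter k g y).

Local Open Scope ereal_scope.

Definition sep_rate (R : realType) (g : rcircle R -> rcircle R)
    (Y : set (rcircle R)) (n : nat) (e : R) : \bar R :=
  ereal_sup [set ((ln (Num.max 1 (size E)%:R) / n%:R)%R)%:E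
            | E in separated g Y n e].

(* topological entropy of g on Y (Bowen):
   lim_{e -> 0} limsup_n (1/n) log s(n,e)  (= sup over e > 0) *)
Definition top_entropy (R : realType) (g : rcircle R -> rcircle R)
    (Y : set (rcircle R)) : \bar R :=
  ereal_sup [set limn_esup (fun n => sep_rate g Y n e) | e in [set e : R | (0 < e)%R]].

(* Main.v *)
(** The nonwandering set. Write Omega for the nonwandering set of the restriction of f to
    the real Julia set. By recurrence every nondegenerate component I of Omega
    is periodic. If the cycle of I contained neither infinity, nor a pole, nor a
    critical point, then some even iterate of f would map the real interval I
    into itself preserving the order; since Omega is nonwandering on arcs even
    along multiples of a given period, that iterate would be the identity on I,
    hence near some complex point, and the iterates of f would be normal there.
    So the nondegenerate components form finitely many cycles, and a point of
    Omega outside them can never enter their interior.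

    Entropy. Let Y be the closure of the preperiodic points of the real Julia
    set; we bound the entropy of f on the whole circle by that of Y. Code
    orbits of g = f^k by a finite partition into points and intervals on which
    g is monotone. The image of an interval covers every letter that it
    meets except at most two (partial transitions), and after a full transition
    the past is forgotten. Hence the number of words grows at rate at most the
    maximum of (log 2) / k and of the growth rates of full returns to a single
    letter; N full returns form a horseshoe with N - 2 branches. A word of a
    horseshoe yields an expanding branch, whose leftmost fixed point is not
    Lyapunov stable, hence is a periodic point of the Julia set; distinct words
    give separated points, so the horseshoe is seen by Y. *)

(* Membership in the Julia set is decided by two facts. Fatou points are Lyapunov stable, so
   instability seen on the circle alone puts a real point into the Julia set. A complex disc on
   which some iterate is the identity is Fatou, because only finitely many maps occur there among
   the iterates. Infinity and the poles obstruct arguments on real intervals. Continuity is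
   therefore settled on the sphere, in homogeneous coordinates. Afterwards infinity, the poles and
   the zeros of the Wronskian [p' q - p q'] serve as cut points, so that everything between two cuts
   happens in the chart [Some]. The partition for the entropy is not Markov. The power [k] makes
   partial transitions harmless below a prescribed rate [lam > 0]; at the end [lam] is the entropy
   of [Y] plus an arbitrary positive number. *)
Require Import Defs.
From HB Require Import structures.
From mathcomp Require Import all_boot all_order all_algebra.
From mathcomp Require Import all_classical all_reals all_analysis.
From mathcomp Require Import complex polyrcf ring lra.

Set Implicit Arguments.
Unset Strict Implicit.
Unset Printing Implicit Defensive.

Import Order.TTheory GRing.Theory Num.Theory.
Import numFieldNormedType.Exports.
Local Open Scope classical_set_scope.
Local Open Scope ring_scope.

(** * Chordal metric *)

Section Chordal.
Variable R : realType.
Implicit Types (z w v : sphere R) (a b : R[i]).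

Lemma abs2c_ge0 a : 0 <= abs2c a.
Proof. by rewrite /abs2c addr_ge0 ?sqr_ge0. Qed.

Lemma abs2cD1_gt0 a : 0 < 1 + abs2c a.
Proof. by rewrite ltr_wpDr ?abs2c_ge0. Qed.

(** Stereographic projection onto the unit sphere of R^3, where [chordal] becomes the Euclidean
    distance; the triangle inequality is inherited from there. *)
Definition stereo z : R * R * R :=
  match z with
  | Some a => (2 * complex.Re a / (1 + abs2c a), 2 * complex.Im a / (1 + abs2c a),
               (abs2c a - 1) / (1 + abs2c a))
  | None => (0, 0, 1)
  end.

Definition sqdist (u v : R * R * R) : R :=
  (u.1.1 - v.1.1) ^+ 2 + (u.1.2 - v.1.2) ^+ 2 + (u.2 - v.2) ^+ 2.

Lemma chordal_stereo z w : chordal z w = Num.sqrt (sqdist (stereo z) (stereo w)).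
Proof.
have key (x y : R) : 0 <= x -> x ^+ 2 = y -> x = Num.sqrt y.
  by move=> x0 <-; rewrite sqrtr_sqr ger0_norm.
case: z w => [a|] [b|]; rewrite /sqdist /=.
- have A := abs2cD1_gt0 a; have B := abs2cD1_gt0 b.
  apply: key; first by rewrite divr_ge0 ?mulr_ge0 ?sqrtr_ge0.
  rewrite !exprMn exprVn !sqr_sqrtr ?abs2c_ge0 ?mulr_ge0 ?ltW//.
  move: A B; case: a b => [a1 a2] [b1 b2]; rewrite /abs2c /= => A B.
  by field; rewrite !gt_eqF.
- have A := abs2cD1_gt0 a.
  apply: key; first by rewrite divr_ge0 ?sqrtr_ge0.
  rewrite !exprMn exprVn !sqr_sqrtr ?ltW//.
  move: A; case: a => [a1 a2]; rewrite /abs2c /= => A.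
  by field; rewrite !gt_eqF.
- have A := abs2cD1_gt0 b.
  apply: key; first by rewrite divr_ge0 ?sqrtr_ge0.
  rewrite !exprMn exprVn !sqr_sqrtr ?ltW//.
  move: A; case: b => [a1 a2]; rewrite /abs2c /= => A.
  by field; rewrite !gt_eqF.
- by rewrite !subrr expr0n /= !addr0 sqrtr0.
Qed.

Lemma sqdist_triangle (u v w : R * R * R) :
  Num.sqrt (sqdist u w) <= Num.sqrt (sqdist u v) + Num.sqrt (sqdist v w).
Proof.
have ge0 x y : 0 <= sqdist x y by rewrite /sqdist !addr_ge0 ?sqr_ge0.
rewrite -[leRHS]ger0_norm ?addr_ge0 ?sqrtr_ge0// -sqrtr_sqr.
apply: ler_wsqrtr; rewrite sqrrD !sqr_sqrtr// -sqrtrM//.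
move: u v w ge0 => [[u1 u2] u3] [[v1 v2] v3] [[w1 w2] w3] ge0.
set S := Num.sqrt _.
set ip := (u1 - v1) * (v1 - w1) + (u2 - v2) * (v2 - w2) + (u3 - v3) * (v3 - w3).
suff : ip <= S.
  rewrite /sqdist /= -mulr_natr /ip => h.
  rewrite -subr_ge0.
  rewrite [X in 0 <= X](_ : _ = 2 * (S - ip)) ?mulr_ge0 ?subr_ge0//.
  by rewrite /ip; ring.
apply: le_trans (ler_norm _) _; rewrite -sqrtr_sqr; apply: ler_wsqrtr.
rewrite -subr_ge0 /sqdist /ip /=.
set a1 := u1 - v1; set a2 := u2 - v2; set a3 := u3 - v3.
set b1 := v1 - w1; set b2 := v2 - w2; set b3 := v3 - w3.
(* Lagrange's identity: the defect in the Cauchy-Schwarz inequality is the squared norm of the cross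
   product. *)
rewrite [X in 0 <= X](_ : _ = (a1 * b2 - a2 * b1) ^+ 2 + (a1 * b3 - a3 * b1) ^+ 2
  + (a2 * b3 - a3 * b2) ^+ 2); last by ring.
by rewrite !addr_ge0 ?sqr_ge0.
Qed.

Lemma chordal_triangle v z w : chordal z w <= chordal z v + chordal v w.
Proof. by rewrite !chordal_stereo sqdist_triangle. Qed.

Lemma chordalC z w : chordal z w = chordal w z.
Proof.
by rewrite !chordal_stereo /sqdist; congr (Num.sqrt (_ + _ + _)); rewrite -sqrrN opprB.
Qed.

Lemma chordal_ge0 z w : 0 <= chordal z w.
Proof. by rewrite chordal_stereo sqrtr_ge0. Qed.

Lemma chordalxx z : chordal z z = 0.
Proof. by rewrite chordal_stereo /sqdist !subrr expr0n /= !addr0 sqrtr0. Qed.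

Lemma chordal_eq0 z w : chordal z w = 0 -> z = w.
Proof.
have pos (a : R[i]) : 0 < Num.sqrt (1 + abs2c a) by rewrite sqrtr_gt0 abs2cD1_gt0.
case: z w => [a|] [b|] //=; last 2 first.
- by move/eqP; rewrite mulf_eq0 invr_eq0 pnatr_eq0/= gt_eqF.
- by move/eqP; rewrite mulf_eq0 invr_eq0 pnatr_eq0/= gt_eqF.
move/eqP; rewrite !mulf_eq0 invr_eq0 pnatr_eq0/= [X in _ || X]gt_eqF; last first.
  by rewrite sqrtr_gt0 mulr_gt0 ?abs2cD1_gt0.
rewrite orbF sqrtr_eq0 /abs2c.
case: a b => [a1 a2] [b1 b2] /= h.
have h1 := sqr_ge0 (a1 - b1); have h2 := sqr_ge0 (a2 - b2).
have /eqP : (a1 - b1) ^+ 2 = 0 by lra.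
have /eqP : (a2 - b2) ^+ 2 = 0 by lra.
by rewrite !expf_eq0 /= !subr_eq0 => /eqP -> /eqP ->.
Qed.

Definition ccont_at (f : sphere R -> sphere R) z := forall e : R, 0 < e ->
  exists d : R, 0 < d /\ forall w, chordal z w < d -> chordal (f z) (f w) < e.

Lemma ccont_iter f n z : (forall y, ccont_at f y) -> ccont_at (iter n f) z.
Proof.
move=> fc; elim: n => [|n IH] e e0; first by exists e.
have [d1 [d10 h1]] := fc (iter n f z) _ e0.
have [d2 [d20 h2]] := IH _ d10.
by exists d2; split=> // w zw; rewrite !iterS; apply/h1/h2.
Qed.

End Chordal.

(** * Normality and stability *)

Lemma subseq_of_infinitely_often (P : nat -> Prop) :
  (forall N, exists k, (N <= k)%N /\ P k) ->
  exists phi : nat -> nat, (forall k, (phi k < phi k.+1)%N) /\ forall k, P (phi k).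
Proof.
move=> /choice[s sP].
exists (fix phi k := if k is k'.+1 then s (phi k').+1 else s 0).
by split=> [k|[|k]]; [exact: (sP _).1|exact: (sP _).2|exact: (sP _).2].
Qed.

Lemma leq_subseq (phi : nat -> nat) :
  (forall k, (phi k < phi k.+1)%N) -> forall k, (k <= phi k)%N.
Proof. by move=> h; elim=> // k IH; apply: leq_ltn_trans IH (h k). Qed.

Section JuliaSet.
Variable R : realType.
Variable f : sphere R -> sphere R.
Hypothesis f_cont : forall z, ccont_at f z.

Lemma normal_onS (F : nat -> sphere R -> sphere R) (U V : set (sphere R)) :
  V `<=` U -> normal_on F U -> normal_on F V.
Proof.
move=> VU nF m; have [phi [g [phiS H]]] := nF m.
exists phi, g; split=> // w /VU /H[r [r0 {}H]].
exists r; split=> // e /H[N {}H]; exists N => k Nk v /VU; exact: H.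
Qed.

Lemma Fatou_nbhs z : Fatou f z ->
  exists d : R, 0 < d /\ forall w, chordal z w < d -> Fatou f w.
Proof.
move=> [d [d0 nd]]; exists d; split=> // w zw.
exists (d - chordal z w); rewrite subr_gt0; split=> //.
apply: normal_onS nd => v /=; have := chordal_triangle w z v; lra.
Qed.

(** Iterate [m] at [z] is iterate [m - 1] at [f z], so normality pulls back along [f]. Time 0 has no
    predecessor: if it recurs infinitely often, the identity is the limit along those indices;
    otherwise all times are positive from some [K] on. *)
Lemma Fatou_preimage z : Fatou f (f z) -> Fatou f z.
Proof.
move=> [d [d0 nd]]; have [d' [d'0 fd]] := f_cont z d0.
exists d'; split=> // m.
have [io|/existsNP[K nio]] := pselect (forall N, exists k, (N <= k)%N /\ m k = 0%N).
  have [phi [phiS m0]] := subseq_of_infinitely_often io.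
  exists phi, id; split=> // w _; exists 1; split=> // e e0.
  by exists 0%N => k _ v _ _; rewrite m0 chordalxx.
have mK k : (0 < m (k + K))%N.
  rewrite lt0n; apply/eqP => h; apply: nio; exists (k + K)%N.
  by rewrite leq_addl.
have [phi [g [phiS H]]] := nd (fun k => (m (k + K)%N).-1).
exists (fun k => phi k + K)%N, (g \o f); split.
  by move=> k; rewrite ltn_add2r.
move=> w /fd /H[r [r0 {}H]]; have [r' [r'0 fr]] := f_cont w r0.
exists r'; split=> // e /H[N {}H]; exists N => k Nk v zv wv.
have := H k Nk (f v) (fd _ zv) (fr _ wv).
by rewrite -iterSr prednK.
Qed.

(** If stability fails, points tending to [z] separate from [z] at suitable times. Along a normal
    subsequence both orbits are close to the values of one limit [g]. As [normal_on] does not say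
    that [g] is continuous, the fixed iterate of index [phi N], which is continuous, takes its
    place. *)
Lemma Fatou_stable z : Fatou f z -> forall e : R, 0 < e ->
  exists d : R, 0 < d /\
    forall w, chordal z w < d -> forall n, chordal (iter n f z) (iter n f w) < e.
Proof.
move=> [d0 [d0p nd]] e e0; apply: contrapT => /forallNP ns.
have : forall j : nat, exists wn : sphere R * nat,
    chordal z wn.1 < j.+1%:R^-1 /\ e <= chordal (iter wn.2 f z) (iter wn.2 f wn.1).
  move=> j; apply: contrapT => /forallNP h; apply: (ns j.+1%:R^-1).
  split; first by rewrite invr_gt0.
  move=> w zw n; rewrite ltNge; apply/negP => le; exact: (h (w, n)).
move=> /choice[wn wnP].
have [phi [g [phiS H]]] := nd (fun j => (wn j).2).
(* Five gaps lead from [A] to [B] below: through [g z], [C], [D] and the value of [g] at the nearby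
   point. *)
have e4 : 0 < e / 5 by lra.
have [|r [r0 /(_ _ e4)[N {}H]]] := H z; first by rewrite /= chordalxx.
have [d [dp cd]] := ccont_iter (wn (phi N)).2 z f_cont e4.
pose m := Num.min d (Num.min r d0).
have m0 : 0 < m by rewrite !lt_min dp r0.
pose j := maxn N (Num.bound m^-1).
have jN : (N <= j)%N by rewrite leq_maxl.
have [zw le] := wnP (phi j).
have wm : chordal z (wn (phi j)).1 < m.
  apply: lt_le_trans zw _.
  rewrite invf_ple ?posrE//; apply: le_trans (ltW (archi_boundP _)) _.
    by rewrite invr_ge0 ltW.
  rewrite ler_nat; apply: leq_trans (leq_maxr N _) _.
  by apply: leq_trans (leq_subseq phiS j) _.
move: wm; rewrite !lt_min => /and3P[wd wr wd0].
have h1 := H j jN z; rewrite /= chordalxx in h1; move/(_ d0p r0): h1 => h1.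
have h2 := H j jN _ wd0 wr.
have h3 := H N (leqnn N) z; rewrite /= chordalxx in h3; move/(_ d0p r0): h3 => h3.
have h4 := H N (leqnn N) _ wd0 wr.
have h5 := cd _ wd.
move: le h1 h2 h3 h4 h5.
set A := iter _ f z; set B := iter _ f _; set C := iter _ f z; set D := iter _ f _.
move=> le h1 h2 h3 h4 h5.
have t1 := chordal_triangle (g z) A B.
have t2 := chordal_triangle C (g z) B.
have t3 := chordal_triangle D C B.
have t4 := chordal_triangle (g (wn (phi j)).1) D B.
have s2 := chordalC B (g (wn (phi j)).1); have s3 := chordalC C (g z).
lra.
Qed.

End JuliaSet.

(** * Continuity of rational maps on the sphere *)

Section RationalMapContinuity.
Variable R : realType.
Implicit Types (a b u v : R[i]) (P Q : {poly R[i]}).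

Definition cabs a : R := Num.sqrt (abs2c a).

Lemma cabs_ge0 a : 0 <= cabs a.
Proof. exact: sqrtr_ge0. Qed.

Lemma cabs_normc a : cabs a = Normc.normc a.
Proof. by case: a. Qed.

Lemma cabsM a b : cabs (a * b) = cabs a * cabs b.
Proof. by rewrite !cabs_normc Normc.normcM. Qed.

Lemma cabsD a b : cabs (a + b) <= cabs a + cabs b.
Proof. by rewrite !cabs_normc; exact: le_normcD. Qed.

Lemma cabsN a : cabs (- a) = cabs a.
Proof. by rewrite !cabs_normc; exact: normcN. Qed.

Lemma cabs0 : cabs 0 = 0.
Proof. by rewrite cabs_normc Normc.normc0. Qed.

Lemma cabs_eq0 a : cabs a = 0 -> a = 0.
Proof. by rewrite cabs_normc; apply: Normc.eq0_normc. Qed.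

Lemma cabs_gt0 a : a != 0 -> 0 < cabs a.
Proof.
by move=> a0; rewrite lt0r cabs_ge0 andbT; apply: contra_neq a0; exact: cabs_eq0.
Qed.

Lemma cabsV a : cabs a^-1 = (cabs a)^-1.
Proof. by rewrite !cabs_normc Normc.normcV. Qed.

Lemma cabsC (x : R) : cabs (x%:C)%C = `|x|.
Proof. by rewrite /cabs /abs2c /= expr0n addr0 sqrtr_sqr. Qed.

Lemma abs2c_cabs a : abs2c a = cabs a ^+ 2.
Proof. by rewrite sqr_sqrtr ?abs2c_ge0. Qed.

Lemma horner_cabs_bounded P (r : R) :
  exists M : R, 0 < M /\ forall b, cabs b <= r -> cabs P.[b] <= M.
Proof.
elim/poly_ind: P => [|P c [M [M0 IH]]].
  by exists 1; split=> // b _; rewrite horner0 cabs0.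
have r0 : 0 <= Num.max r 0 by rewrite le_max lexx orbT.
have := cabs_ge0 c; have := mulr_ge0 (ltW M0) r0 => h1 h2.
exists (M * Num.max r 0 + cabs c + 1); split; first by lra.
move=> b br; rewrite hornerMXaddC; apply: le_trans (cabsD _ _) _.
rewrite cabsM.
have : cabs P.[b] * cabs b <= M * Num.max r 0.
  by apply: ler_pM; rewrite ?cabs_ge0 ?IH // le_max br.
lra.
Qed.

Lemma horner_cabs_continuous P a (e : R) : 0 < e ->
  exists d : R, 0 < d /\ forall b, cabs (b - a) < d -> cabs (P.[b] - P.[a]) < e.
Proof.
move=> e0; have /factor_theorem[Q PQ] : root (P - P.[a]%:P) a.
  by rewrite /root !hornerE subrr.
have [M [M0 Mb]] := horner_cabs_bounded Q (cabs a + 1).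
exists (Num.min 1 (e / M)); split; first by rewrite lt_min ltr01 divr_gt0.
move=> b; rewrite lt_min => /andP[b1 b2].
have -> : P.[b] - P.[a] = Q.[b] * (b - a).
  by have := congr1 (horner^~ b) PQ; rewrite !hornerE.
rewrite cabsM; apply: le_lt_trans (_ : M * cabs (b - a) < _).
  apply: ler_wpM2r; rewrite ?cabs_ge0 // Mb//.
  by have := cabsD (b - a) a; rewrite subrK; lra.
by rewrite mulrC -ltr_pdivlMr.
Qed.

(* The point [u : v] of the projective line. *)
Definition proj_pt u v : sphere R := if v == 0 then None else Some (u / v).

Lemma proj_ptM c u v : c != 0 -> proj_pt (u * c) (v * c) = proj_pt u v.
Proof.
move=> c0; rewrite /proj_pt mulf_eq0 (negPf c0) orbF; case: eqP => // /eqP v0.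
by congr Some; rewrite -mulf_div divff ?mulr1.
Qed.

Lemma abs2cM a b : abs2c (a * b) = abs2c a * abs2c b.
Proof. by rewrite !abs2c_cabs cabsM exprMn. Qed.

Lemma abs2cV a : abs2c a^-1 = (abs2c a)^-1.
Proof. by rewrite !abs2c_cabs cabsV exprVn. Qed.

Lemma abs2c_gt0 a : a != 0 -> 0 < abs2c a.
Proof. by move=> /cabs_gt0 h; rewrite abs2c_cabs exprn_gt0. Qed.

Lemma abs2c0 : abs2c (0 : R[i]) = 0.
Proof. by rewrite abs2c_cabs cabs0 expr0n. Qed.

Lemma abs2c_pair_gt0 u v : (u != 0) || (v != 0) -> 0 < abs2c u + abs2c v.
Proof.
by case/orP => /abs2c_gt0 h; [apply: ltr_wpDr|apply: ltr_wpDl]; rewrite ?abs2c_ge0.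
Qed.

(** In homogeneous coordinates the chordal distance is a cross product over norms, with no
    distinction between finite points and infinity. Continuity at poles and at infinity thus becomes
    an estimate on polynomials. *)
Lemma chordal_proj_pt u v u' v' :
  (u != 0) || (v != 0) -> (u' != 0) || (v' != 0) ->
  chordal (proj_pt u v) (proj_pt u' v') =
  2 * cabs (u * v' - u' * v) /
    Num.sqrt ((abs2c u + abs2c v) * (abs2c u' + abs2c v')).
Proof.
have sq (x y : R) : 0 <= x -> 0 < y -> Num.sqrt x / Num.sqrt y = Num.sqrt (x / y).
  by move=> x0 y0; rewrite sqrtrM// sqrtrV// ltW.
have h2 : (2 : R) = Num.sqrt 4 by rewrite (_ : 4 = 2 ^+ 2) ?sqrtr_sqr ?ger0_norm//; ring.
move=> uv uv'; have S := abs2c_pair_gt0 uv; have S' := abs2c_pair_gt0 uv'.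
rewrite /proj_pt; case: (eqVneq v 0) uv S => [-> |v0] uv S;
  case: (eqVneq v' 0) uv' S' => [-> |v'0] uv' S' /=.
- by rewrite !mulr0 subrr cabs0 mulr0 mul0r.
- rewrite orbF in uv; rewrite mulr0 subr0.
  have ua := abs2c_gt0 uv; have va := abs2c_gt0 v'0.
  rewrite abs2c0 addr0 /cabs -mulrA !sq ?abs2c_ge0 ?mulr_gt0//.
  rewrite [in LHS]h2 sq// ?abs2cD1_gt0// h2 -sqrtrM//.
  rewrite !abs2cM abs2cV; congr Num.sqrt.
  by field; rewrite !gt_eqF// addrC.
- rewrite orbF in uv'; rewrite mulr0 sub0r cabsN.
  have ua := abs2c_gt0 uv'; have va := abs2c_gt0 v0.
  rewrite abs2c0 addr0 /cabs -mulrA !sq ?abs2c_ge0 ?mulr_gt0//.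
  rewrite [in LHS]h2 sq// ?abs2cD1_gt0// h2 -sqrtrM//.
  rewrite !abs2cM abs2cV; congr Num.sqrt.
  by field; rewrite !gt_eqF// addrC.
- have va := abs2c_gt0 v0; have va' := abs2c_gt0 v'0.
  have -> : u / v - u' / v' = (u * v' - u' * v) / (v * v') by field; rewrite v0 v'0.
  rewrite -!mulrA !sq ?mulr_gt0 ?abs2cD1_gt0 ?abs2c_ge0//.
  rewrite !abs2cM !abs2cV abs2cM; congr (_ * Num.sqrt _).
  by field; rewrite ?mulf_neq0 !gt_eqF// addrC.
Qed.

(** The numerator of the homogeneous formula is, up to sign, the value at [b] of [P.[a] *: Q - Q.[a]
    *: P], which vanishes at [a]; the denominator stays away from 0 because [P] and [Q] do not both
    vanish at [a]. *)
Lemma proj_pt_continuous P Q a : (P.[a] != 0) || (Q.[a] != 0) ->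
  forall e : R, 0 < e -> exists d : R, 0 < d /\ forall b, cabs (b - a) < d ->
    chordal (proj_pt P.[a] Q.[a]) (proj_pt P.[b] Q.[b]) < e.
Proof.
move=> PQ0 e e0.
have lower (T : {poly R[i]}) : T.[a] != 0 -> exists c d : R, [/\ 0 < c, 0 < d &
    forall b, cabs (b - a) < d -> c <= abs2c T.[b]].
  move=> T0; have t0 := cabs_gt0 T0; have t2 : 0 < cabs T.[a] / 2 by lra.
  have [d [d0 h]] := horner_cabs_continuous T a t2.
  exists ((cabs T.[a] / 2) ^+ 2), d; split=> //; first by rewrite exprn_gt0.
  move=> b /h {}h; rewrite abs2c_cabs ler_pXn2r ?nnegrE ?cabs_ge0 ?ltW//.
  have := cabsD (T.[a] - T.[b]) T.[b]; rewrite subrK.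
  have := cabsN (T.[a] - T.[b]); rewrite opprB; lra.
have [c [d1 [c0 d10 low]]] : exists c d : R, [/\ 0 < c, 0 < d &
    forall b, cabs (b - a) < d -> c <= abs2c P.[b] + abs2c Q.[b]].
  case/orP: PQ0 => /lower[c [d [c0 d0 h]]]; exists c, d; split=> // b /h;
  by [have := abs2c_ge0 Q.[b]; lra|have := abs2c_ge0 P.[b]; lra].
set S := abs2c P.[a] + abs2c Q.[a].
have S0 : 0 < S by apply: abs2c_pair_gt0.
have k0 : 0 < Num.sqrt (S * c) by rewrite sqrtr_gt0 mulr_gt0.
have k1 : 0 < e * Num.sqrt (S * c) / 2 by rewrite divr_gt0 ?mulr_gt0.
have [d2 [d20 num]] := horner_cabs_continuous (P.[a] *: Q - Q.[a] *: P) a k1.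
exists (Num.min d1 d2); split; first by rewrite lt_min d10.
move=> b; rewrite lt_min => /andP[/low {}low /num {}num].
have Sb0 : 0 < abs2c P.[b] + abs2c Q.[b] by lra.
rewrite chordal_proj_pt//; last first.
  apply: contraTT Sb0; rewrite negb_or !negbK => /andP[/eqP -> /eqP ->].
  by rewrite abs2c0 addr0 ltxx.
rewrite ltr_pdivrMr ?sqrtr_gt0 ?mulr_gt0//.
apply: lt_le_trans (_ : e * Num.sqrt (S * c) <= _); last first.
  by rewrite ler_pM2l// ler_wsqrtr// ler_pM2l.
move: num; rewrite !hornerE [Q.[a] * P.[a]]mulrC subrr subr0 => num.
rewrite [P.[b] * _]mulrC; lra.
Qed.

Lemma chordal_near_Some a (d : R) : 0 < d -> exists r : R, 0 < r /\
  forall w, chordal (Some a) w < r -> exists b, w = Some b /\ cabs (b - a) < d.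
Proof.
move=> d0; set m := (Num.sqrt (1 + abs2c a))^-1.
have m0 : 0 < m by rewrite invr_gt0 sqrtr_gt0 abs2cD1_gt0.
exists (Num.min m (d * m ^+ 2)); split.
  by rewrite lt_min m0 mulr_gt0// exprn_gt0.
case=> [b|]; last first.
  by rewrite /= -/m lt_min => /andP[h _]; lra.
rewrite lt_min => /andP[h1 h2]; exists b; split=> //.
have h3 := chordal_triangle (Some b) (Some a) None.
set n := (Num.sqrt (1 + abs2c b))^-1.
have n0 : 0 < n by rewrite invr_gt0 sqrtr_gt0 abs2cD1_gt0.
have {h1 h3} nm : m < 2 * n by move: h3; rewrite /= -/m -/n => h3; move: h1; rewrite /=; lra.
move: h2; rewrite /= sqrtrM ?ltW ?abs2cD1_gt0// invfM -/m -/n.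
rewrite -/(cabs _) -cabsN opprB => h2.
have c0 := cabs_ge0 (b - a).
have : cabs (b - a) * (m * m) <= 2 * cabs (b - a) * (m * n).
  rewrite [leRHS](_ : _ = cabs (b - a) * (m * (2 * n))); last by ring.
  by rewrite ler_wpM2l// ler_pM2l// ltW.
move=> h; have := le_lt_trans h h2.
by rewrite -expr2 ltr_pM2r// exprn_gt0.
Qed.

Lemma chordal_near_None (d : R) : 0 < d -> exists r : R, 0 < r /\
  forall w, chordal None w < r ->
    w = None \/ exists b, [/\ w = Some b, b != 0 & cabs b^-1 < d].
Proof.
move=> d0; exists (Num.min d 1); split; first by rewrite lt_min d0 ltr01.
case=> [b|] /=; last by left.
set r := Num.min d 1; have r0 : 0 < r by rewrite lt_min d0 ltr01.
have r1 : r <= 1 by rewrite ge_min lexx orbT.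
rewrite ltr_pdivrMr ?sqrtr_gt0 ?abs2cD1_gt0// => h; right; exists b.
have : (2 / r) ^+ 2 < 1 + cabs b ^+ 2.
  rewrite -abs2c_cabs -[ltRHS]sqr_sqrtr ?ltW ?abs2cD1_gt0//.
  rewrite ltr_pXn2r ?nnegrE ?sqrtr_ge0 ?divr_ge0 ?ltW//.
  by rewrite ltr_pdivrMr// mulrC.
rewrite exprMn => {}h.
have i1 : 1 <= r^-1 by rewrite invf_ge1.
have i2 : 1 <= r^-1 ^+ 2 by rewrite exprn_ege1.
have : r^-1 ^+ 2 < cabs b ^+ 2 by lra.
rewrite ltr_pXn2r ?nnegrE ?cabs_ge0 ?invr_ge0 ?ltW// => {}h.
have b0 : 0 < cabs b by lra.
split=> //; first by apply: contraTneq b0 => ->; rewrite cabs0 ltxx.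
rewrite cabsV invf_plt ?posrE//; apply: le_lt_trans h.
by rewrite lef_pV2 ?posrE// ge_min lexx.
Qed.

Variables p q : {poly R}.
Hypothesis pq_coprime : coprimep p q.
Hypothesis pq_degree : (0 < rdeg p q)%N.

Let pC := map_poly (real_complex R) p.
Let qC := map_poly (real_complex R) q.

Lemma ratC_Some a : ratC p q (Some a) = proj_pt pC.[a] qC.[a].
Proof. by []. Qed.

Lemma ratC_None :
  ratC p q None = proj_pt (p`_(rdeg p q))%:C%C (q`_(rdeg p q))%:C%C.
Proof.
rewrite /ratC /proj_pt (fmorph_eq0 (real_complex R)).
by case: eqP => // _; rewrite fmorph_div.
Qed.

Lemma coprime_horner_neq0 a : (pC.[a] != 0) || (qC.[a] != 0).
Proof.
case: eqP => //= /eqP pa; apply: (coprimep_root (p := pC)) => //.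
by rewrite coprimep_map.
Qed.

Lemma lead_pair_neq0 : (p`_(rdeg p q) != 0) || (q`_(rdeg p q) != 0).
Proof.
have lead (s : {poly R}) : (0 < (size s).-1)%N -> s`_(size s).-1 != 0.
  by move=> h; rewrite -lead_coefE lead_coef_eq0 -size_poly_gt0 (leq_trans h)// leq_pred.
move: pq_degree; rewrite /rdeg; case: (leqP (size p).-1) => h /lead -> //.
by rewrite orbT.
Qed.

Lemma size_le_rdeg : (size p <= (rdeg p q).+1)%N /\ (size q <= (rdeg p q).+1)%N.
Proof.
by rewrite /rdeg; split; apply: leq_trans (leqSpred _) _; rewrite ltnS ?leq_maxl ?leq_maxr.
Qed.

(** The polynomial read in the chart [1 / z] at infinity. Reversing [p] and [q] at the common degree
    [rdeg p q] extracts the same power of [b] from both, which cancels in [proj_pt]. *)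
Definition rev_poly (d : nat) P : {poly R[i]} := \poly_(i < d.+1) P`_(d - i).

Lemma rev_poly_horner d P b : (size P <= d.+1)%N -> b != 0 ->
  P.[b] = (rev_poly d P).[b^-1] * b ^+ d.
Proof.
move=> sP b0; rewrite horner_poly (horner_coef_wide _ sP) (reindex_inj rev_ord_inj)/=.
rewrite mulr_suml; apply: eq_bigr => i _.
rewrite subSS -mulrA; congr (_ * _); rewrite exprVn.
have E : b ^+ d = b ^+ i * b ^+ (d - i) by rewrite -exprD subnKC// -ltnS.
by rewrite E mulrA mulVf ?expf_neq0// mul1r.
Qed.

Lemma rev_poly_horner0 d P : (rev_poly d P).[0] = P`_d.
Proof. by rewrite horner_coef0 coef_poly /= subn0. Qed.

Theorem ratC_continuous z : ccont_at (ratC p q) z.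
Proof.
move=> e e0; have [sp sq] := size_le_rdeg; case: z => [a|].
  have [d [d0 h]] := proj_pt_continuous (coprime_horner_neq0 a) e0.
  have [r [r0 near]] := chordal_near_Some a d0.
  exists r; split=> // w /near[b [-> /h]]; by rewrite !ratC_Some.
pose P := rev_poly (rdeg p q) pC; pose Q := rev_poly (rdeg p q) qC.
have E : ratC p q None = proj_pt P.[0] Q.[0].
  by rewrite ratC_None /P /Q !rev_poly_horner0 !coef_map.
have PQ0 : (P.[0] != 0) || (Q.[0] != 0).
  by rewrite /P /Q !rev_poly_horner0 !coef_map !fmorph_eq0 lead_pair_neq0.
have [d [d0 h]] := proj_pt_continuous PQ0 e0.
have [r [r0 near]] := chordal_near_None d0.
exists r; split=> // w /near[-> |[b [-> b0 bd]]]; first by rewrite chordalxx.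
have := h b^-1; rewrite subr0 => /(_ bd).
rewrite E ratC_Some (rev_poly_horner (d := rdeg p q) _ b0) ?size_map_poly//.
rewrite (rev_poly_horner (d := rdeg p q) (P := qC) _ b0) ?size_map_poly//.
by rewrite proj_ptM// expf_neq0.
Qed.

Lemma ratC_embR x : ratC p q (embR x) = embR (ratR p q x).
Proof.
case: x => [x|] /=; last by case: ifP.
rewrite !horner_map fmorph_eq0; case: eqP => // _.
by rewrite -fmorph_div.
Qed.

Lemma iter_ratC_embR n x : iter n (ratC p q) (embR x) = embR (iter n (ratR p q) x).
Proof. by elim: n => //= n ->; rewrite ratC_embR. Qed.

End RationalMapContinuity.

(** * The real circle *)

Lemma finite_roots (R : realType) (s : {poly R}) : s != 0 ->
  exists Z : seq R, forall x, s.[x] = 0 -> x \in Z.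
Proof.
move=> s0; exists (rootsR s) => x sx.
by have /(_ x) := roots_on_rootsR s0; rewrite in_itv /= => <-; rewrite /root sx eqxx.
Qed.

Lemma poly_no_root_sign (R : realType) (s : {poly R}) (x y : R) :
  (forall t, x <= t <= y -> s.[t] != 0) ->
  (forall t, x <= t <= y -> 0 < s.[t]) \/ (forall t, x <= t <= y -> s.[t] < 0).
Proof.
move=> h; have [xy|yx] := leP x y; last by left=> t; lra.
have xx : x <= x <= y by rewrite lexx.
have key t : x <= t <= y -> 0 < s.[x] * s.[t].
  move=> /[dup] tI /andP[xt ty]; rewrite ltNge; apply/negP => /(polyrcf.poly_ivt xt)[r].
  rewrite in_itv /= => /andP[xr rt] /rootP.
  by apply/eqP/h; rewrite xr (le_trans rt).
have [|] := ltrP 0 s.[x] => sx; [left|right] => t tI; have := key t tI.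
  by rewrite pmulr_rgt0.
have {}sx : s.[x] < 0 by rewrite lt_neqAle sx h.
by rewrite nmulr_rgt0.
Qed.

Section Circle.
Variable R : realType.
Implicit Types (x y z : rcircle R) (a b c s t : R).

Lemma chordR_triangle y x z : chordR x z <= chordR x y + chordR y z.
Proof. exact: chordal_triangle. Qed.

Lemma chordRC x y : chordR x y = chordR y x.
Proof. exact: chordalC. Qed.

Lemma chordR_ge0 x y : 0 <= chordR x y.
Proof. exact: chordal_ge0. Qed.

Lemma chordRxx x : chordR x x = 0.
Proof. exact: chordalxx. Qed.

Lemma embR_inj : injective (@embR R).
Proof. by case=> [x|] [y|] //= [->]. Qed.

Lemma chordR_eq0 x y : chordR x y = 0 -> x = y.
Proof. by move/chordal_eq0/embR_inj. Qed.

Lemma chordR_gt0 x y : x <> y -> 0 < chordR x y.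
Proof. by move=> xy; rewrite lt0r chordR_ge0 andbT; apply/eqP => /chordR_eq0. Qed.

Lemma chordR_le a b : chordR (Some a) (Some b) <= 2 * `|a - b|.
Proof.
rewrite /chordR /= -rmorphB -/(cabs _) cabsC ler_pdivrMr ?sqrtr_gt0 ?mulr_gt0 ?abs2cD1_gt0//.
rewrite ler_peMr ?mulr_ge0 ?normr_ge0// -[leLHS]sqrtr1 ler_wsqrtr//.
by rewrite mulr_ege1 // lerDl abs2c_ge0.
Qed.

Lemma chordR_None a : 0 < `|a| -> chordR (Some a) None <= 2 / `|a|.
Proof.
move=> a0; rewrite /chordR /= /abs2c /= expr0n addr0 ler_pM2l// lef_pV2 ?posrE//.
  by rewrite -sqrtr_sqr ler_wsqrtr// ler_wpDl.
by rewrite sqrtr_gt0 ltr_wpDr ?sqr_ge0.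
Qed.

Lemma chordR_near_Some a (d : R) : 0 < d -> exists r : R, 0 < r /\
  forall y, chordR (Some a) y < r -> exists b, y = Some b /\ `|b - a| < d.
Proof.
move=> d0; have [r [r0 h]] := chordal_near_Some (a%:C)%C d0.
exists r; split=> // -[b|] /h[c [//= [<-]]].
by rewrite -rmorphB cabsC; exists b.
Qed.

Lemma chordR_near_None (M : R) : exists r : R, 0 < r /\
  forall b, chordR None (Some b) < r -> M < `|b|.
Proof.
have d0 : 0 < (Num.max M 1)^-1 by rewrite invr_gt0 lt_max ltr01 orbT.
have [r [r0 h]] := chordal_near_None d0.
exists r; split=> // b /h[//|[c [[<-]]]] b0.
have nb : 0 < `|b| by rewrite normr_gt0; apply: contra_neq b0 => ->.
rewrite cabsV cabsC ltf_pV2 ?posrE//; first by rewrite gt_max => /andP[].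
by rewrite lt_max ltr01 orbT.
Qed.

(** A grid of mesh [h = e / 2] on a segment [[- K h, K h]] so long that what lies outside is within
    [e / 2] of infinity. A segment avoiding the grid lies in one mesh or in one tail; the mesh makes
    up for the factor 2 in [chordR_le]. *)
Lemma chordR_net (e : R) : 0 < e -> exists Z : seq R, forall s t, s <= t ->
  (forall d, d \in Z -> ~~ (s <= d <= t)) -> chordR (Some s) (Some t) <= e.
Proof.
move=> e0; pose h := e / 2; have h0 : 0 < h by rewrite divr_gt0.
pose K := (Num.bound (4 / e / h)).+1.
have K1 : 4 / e < K%:R * h.
  rewrite -ltr_pdivrMr//; apply: lt_trans (archi_boundP _) _.
    by rewrite !divr_ge0 ?ltW.
  by rewrite ltr_nat.
have KK : 0 < K%:R * h by rewrite mulr_gt0 ?ltr0n.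
pose Z := [seq i%:R * h - K%:R * h | i <- iota 0 (2 * K).+1].
have memZ i : (i <= 2 * K)%N -> i%:R * h - K%:R * h \in Z.
  by move=> iK; apply/mapP; exists i; rewrite // mem_iota.
have far a : K%:R * h < `|a| -> chordR (Some a) None <= e / 2.
  move=> aK; have a0 : 0 < `|a| by lra.
  apply: le_trans (chordR_None a0) _.
  rewrite ler_pdivrMr//; have : 4 / e < `|a| by lra.
  by rewrite ltr_pdivrMr//; lra.
have far2 a b : K%:R * h < `|a| -> K%:R * h < `|b| -> chordR (Some a) (Some b) <= e.
  move=> /far ha /far hb; have := chordR_triangle None (Some a) (Some b).
  by rewrite (chordRC None); lra.
exists Z => s t st sep.
have := sep _ (memZ 0%N isT); rewrite mul0r sub0r => sep0.
have := sep _ (memZ (2 * K)%N (leqnn _)).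
have -> : (2 * K)%:R * h - K%:R * h = K%:R * h by rewrite natrM; ring.
move=> sepK.
have [tK|tK] := ltrP t (- (K%:R * h)); first by apply: far2; rewrite ler0_norm; lra.
have [sK|sK] := ltrP (K%:R * h) s; first by apply: far2; rewrite ger0_norm; lra.
have s1 : - (K%:R * h) < s by move: sep0; rewrite tK andbT -ltNge.
have t1 : t < K%:R * h by move: sepK; rewrite sK /= -ltNge.
pose u := (s + K%:R * h) / h.
have u0 : 0 <= u by rewrite divr_ge0 ?ltW//; lra.
have /andP[iu ui] := Num.Theory.truncn_itv u0.
set i := Num.truncn u in iu ui.
have i2 : (i.+1 <= 2 * K)%N.
  have : i%:R < (2 * K)%:R :> R; last by rewrite ltr_nat.
  by apply: le_lt_trans iu _; rewrite /u ltr_pdivrMr// natrM; lra.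
have := sep _ (memZ _ i2).
have si : s < i.+1%:R * h - K%:R * h by move: ui; rewrite /u ltr_pdivrMr//; lra.
have is' : i%:R * h - K%:R * h <= s by move: iu; rewrite /u ler_pdivlMr//; lra.
rewrite (ltW si) /= -ltNge => ti.
apply: le_trans (chordR_le _ _) _; rewrite distrC ger0_norm; last by lra.
move: ti; rewrite -natr1 mulrDl mul1r /h; rewrite /h in is'; lra.
Qed.

Definition rcont (g : rcircle R -> rcircle R) := forall x (e : R), 0 < e ->
  exists d : R, 0 < d /\ forall y, chordR x y < d -> chordR (g x) (g y) < e.

Lemma rcont_iter g n : rcont g -> rcont (iter n g).
Proof.
move=> gc x; elim: n => [|n IH] e e0; first by exists e.
have [d1 [d10 h1]] := gc (iter n g x) _ e0.
have [d2 [d20 h2]] := IH _ d10.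
by exists d2; split=> // w zw; rewrite !iterS; apply/h1/h2.
Qed.

Definition betw c a b := (a <= c <= b) || (b <= c <= a).

(* [g] carries the segment [[s, t]] homeomorphically, through the chart
   [Some], onto a segment; continuity is only recorded as the intermediate
   value property. *)
Definition mono_on (g : rcircle R -> rcircle R) s t (phi : R -> R) :=
  [/\ forall u, s <= u <= t -> g (Some u) = Some (phi u),
      (forall u v, s <= u -> u < v -> v <= t -> phi u < phi v) \/
      (forall u v, s <= u -> u < v -> v <= t -> phi v < phi u) &
      forall u v c, s <= u -> u <= v -> v <= t -> betw c (phi u) (phi v) ->
        exists w, u <= w <= v /\ phi w = c].

Lemma mono_onS g s t s' t' phi : s <= s' -> t' <= t -> mono_on g s t phi ->
  mono_on g s' t' phi.
Proof.
move=> ss tt [h1 h2 h3]; split.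
- by move=> u /andP[a b]; apply: h1; rewrite (le_trans ss a) (le_trans b tt).
- by case: h2 => h2; [left|right] => u v su uv vt; apply: h2 => //; lra.
- by move=> u v c su uv vt; apply: h3 => //; lra.
Qed.

Lemma mono_on_id s t : mono_on id s t id.
Proof.
split=> //; first by left.
move=> u v c su uv vt; rewrite /betw => h; exists c; split=> //.
by case/orP: h => /andP[]; lra.
Qed.

Lemma mono_on_range g s t phi u : mono_on g s t phi -> s <= u <= t ->
  Num.min (phi s) (phi t) <= phi u <= Num.max (phi s) (phi t).
Proof.
move=> [_ M _] /andP[su ut]; rewrite le_max ge_min.
have /predU1P[<-|{}su] : (s == u) || (s < u) by rewrite -le_eqVlt.
  by rewrite !lexx ?orbT.
have /predU1P[->|{}ut] : (u == t) || (u < t) by rewrite -le_eqVlt.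
  by rewrite !lexx ?orbT.
by case: M => M; rewrite (ltW (M s u _ _ _)) ?(ltW (M u t _ _ _)) ?orbT// ltW.
Qed.

Lemma mono_on_comp g h s t phi psi a b :
  mono_on g s t phi -> mono_on h a b psi ->
  (forall u, s <= u <= t -> a <= phi u <= b) ->
  mono_on (h \o g) s t (psi \o phi).
Proof.
move=> [g1 g2 g3] [h1 h2 h3] ab; split=> /=.
- by move=> u ust; rewrite g1// h1// ab.
- have aphi u : s <= u -> u <= t -> a <= phi u <= b by move=> *; apply: ab; apply/andP.
  case: g2 => g2; case: h2 => h2; [left|right|right|left] => u v su uv vt;
    have := g2 _ _ su uv vt; have := aphi u; have := aphi v; move=> hv hu huv;
    by apply: h2 => //; lra.
- move=> u v c su uv vt hc.
  have aphi w : s <= w -> w <= t -> a <= phi w <= b by move=> *; apply: ab; apply/andP.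
  have hu := aphi u su (le_trans uv vt); have hv := aphi v (le_trans su uv) vt.
  have [le|/ltW le] := leP (phi u) (phi v).
    have [d [/andP[d1 d2] d3]] := h3 _ _ c (proj1 (andP hu)) le (proj2 (andP hv)) hc.
    have [|w [w1 w2]] := g3 u v d su uv vt; first by rewrite /betw d1 d2.
    by exists w; rewrite w2.
  have hc' : betw c (psi (phi v)) (psi (phi u)) by rewrite /betw orbC.
  have [d [/andP[d1 d2] d3]] := h3 _ _ c (proj1 (andP hv)) le (proj2 (andP hu)) hc'.
  have [|w [w1 w2]] := g3 u v d su uv vt; first by rewrite /betw d1 d2 orbT.
  by exists w; rewrite w2.
Qed.

End Circle.

(** * Rational maps on the circle *)

Section RealRationalMap.
Variable R : realType.
Variables p q : {poly R}.
Hypothesis pq_coprime : coprimep p q.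
Hypothesis pq_degree : (0 < rdeg p q)%N.

Let f := ratR p q.

Lemma rdeg_eq0 : (size p <= 1)%N -> (size q <= 1)%N -> False.
Proof.
move: pq_degree; rewrite /rdeg leq_max => /orP[]; rewrite -subn1 subn_gt0 ltnNge.
  by move=> /negP h /h.
by move=> /negP h _ /h.
Qed.

Lemma denom_neq0 : q != 0.
Proof.
apply/negP => /eqP q0; move: pq_coprime; rewrite q0 coprimep0 => h.
by apply: rdeg_eq0; rewrite ?q0 ?size_poly0 ?(eqp_size h) ?size_poly1.
Qed.

(** Otherwise [q] divides [p], hence is constant by coprimality, and then [p] is constant too,
    against the positive degree. *)
Lemma fiber_poly_neq0 (c : R) : p - c *: q != 0.
Proof.
apply/negP; rewrite subr_eq0 => /eqP E.
have sq : (size q <= 1)%N.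
  have qp : q %| p by rewrite E -mul_polyC dvdp_mull.
  by move: pq_coprime; rewrite coprimep_sym /coprimep (eqp_size (dvdp_gcd_idl qp)) => /eqP ->.
by apply: rdeg_eq0 => //; rewrite E (leq_trans (size_scale_leq _ _)).
Qed.

Lemma finite_fiber (c : R) : exists Z : seq R, forall x, f (Some x) = Some c -> x \in Z.
Proof.
have [Z HZ] := finite_roots (fiber_poly_neq0 c); exists Z => x /=.
case: eqP => // /eqP qx [pc]; apply: HZ.
by rewrite !hornerE -pc; field.
Qed.

Lemma finite_fibers (D : seq R) : exists Z : seq R, forall x c,
  c \in D -> f (Some x) = Some c -> x \in Z.
Proof.
elim: D => [|c D [Z HZ]]; first by exists nil.
have [Z' HZ'] := finite_fiber c; exists (Z' ++ Z) => x d.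
rewrite inE mem_cat => /predU1P[-> /HZ' ->//|dD e].
by rewrite (HZ _ _ dD e) orbT.
Qed.

Definition wronskian : {poly R} := p^`() * q - p * q^`().

(** If [p' q = p q'], coprimality makes each of [p] and [q] divide its own derivative, which for
    reasons of degree forces both to be constant. *)
Lemma wronskian_neq0 : wronskian != 0.
Proof.
have dv (u v : {poly R}) : coprimep u v -> u^`() * v = u * v^`() -> (size u <= 1)%N.
  move=> cuv e; have : u %| u^`() by rewrite -(Gauss_dvdpl _ cuv) e dvdp_mulr.
  rewrite leqNgt => ud; apply/negP => su; move: ud.
  have u'0 : u^`() != 0 by rewrite -size_poly_gt0 polyorder.size_deriv -subn1 subn_gt0.
  move=> /(dvdp_leq u'0); rewrite polyorder.size_deriv.
  by case: (size u) su => [|n] //=; rewrite ltnn.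
apply/negP; rewrite subr_eq0 => /eqP E; apply: rdeg_eq0; first exact: dv E.
by apply: (dv q p); rewrite 1?coprimep_sym// mulrC -E mulrC.
Qed.

(** The derivative of [p / q] is the Wronskian over [q ^ 2], so strict monotonicity follows from the
    mean value theorem. *)
Lemma ratR_mono_on_sign (x y : R) :
  (forall t, x <= t <= y -> q.[t] != 0) ->
  (forall t, x <= t <= y -> wronskian.[t] != 0) ->
  mono_on f x y (fun t => p.[t] / q.[t]).
Proof.
move=> q0 w0; split.
- by move=> t /q0 h; rewrite /f /= (negPf h).
- have mvt u v : x <= u -> u < v -> v <= y -> exists c, [/\ x <= c <= y, 0 < q.[c] ^- 2 * (v - u) &
      p.[v] / q.[v] - p.[u] / q.[u] = wronskian.[c] * (q.[c] ^- 2 * (v - u))].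
    move=> xu uv vy.
    have dr t : x <= t <= y ->
        is_derive t (1 : R) (fun t => p.[t] / q.[t]) (wronskian.[t] * q.[t] ^- 2).
      move=> /q0 qt.
      have := is_deriveM (is_derive_poly p t) (is_deriveV qt (is_derive_poly q t)).
      move/trigger_derive; apply; rewrite /wronskian !hornerE /=.
      by rewrite /GRing.scale /=; field.
    have [|||c] := @MVT R (fun t => p.[t] / q.[t]) (fun t => wronskian.[t] * q.[t] ^- 2) u v => //.
    + by move=> t; rewrite in_itv /= => /andP[ut tv]; apply: dr; lra.
    + apply: continuous_in_subspaceT => t; rewrite inE /= in_itv /= => /andP[ut tv].
      apply/differentiable_continuous/derivable1_diffP.
      by have /dr[] : x <= t <= y by lra.
    rewrite in_itv /= => /andP[uc cv] e; exists c.
    have cI : x <= c <= y by lra.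
    split=> //; last by rewrite e mulrA.
    by rewrite mulr_gt0 ?subr_gt0// invr_gt0 exprn_even_gt0 //= q0.
  have [ws|ws] := poly_no_root_sign w0; [left|right] => u v xu uv vy;
    have [c [cI pos e]] := mvt u v xu uv vy; rewrite -subr_gt0.
    by rewrite e mulr_gt0// ws.
  by rewrite -opprB e oppr_gt0 nmulr_rlt0// ws.
- move=> u v c xu uv vy h.
  have qs : 0 < q.[u] * q.[v].
    by have [qs|qs] := poly_no_root_sign q0; [rewrite mulr_gt0|rewrite nmulr_rgt0] => //; apply: qs; lra.
  have qu : q.[u] != 0 by apply: q0; lra.
  have qv : q.[v] != 0 by apply: q0; lra.
  (* The intermediate value theorem is applied to the polynomial [p - c *: q], whose sign is that of
     [p / q - c] up to the constant sign of [q]. *)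
  have : (p - c *: q).[u] * (p - c *: q).[v] <= 0.
    rewrite !hornerE.
    rewrite [X in X <= 0](_ : _ = (q.[u] * q.[v]) * ((p.[u] / q.[u] - c) * (p.[v] / q.[v] - c))); last by field; rewrite qu qv.
    rewrite pmulr_rle0//; case/orP: h => /andP[h1 h2].
      by rewrite mulr_le0_ge0 ?subr_le0 ?subr_ge0.
    by rewrite mulr_ge0_le0 ?subr_le0 ?subr_ge0.
  case/(polyrcf.poly_ivt uv) => w; rewrite in_itv /= => wI /rootP e.
  exists w; split=> //; have qw : q.[w] != 0 by apply: q0; lra.
  by move: e; rewrite !hornerE => /eqP; rewrite subr_eq0 => /eqP ->; rewrite mulfK.
Qed.

Lemma ratR_mono_on : exists Z : seq R, forall x y,
  (forall d, d \in Z -> ~~ (x <= d <= y)) -> mono_on f x y (fun t => p.[t] / q.[t]).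
Proof.
have [Z1 H1] := finite_roots denom_neq0; have [Z2 H2] := finite_roots wronskian_neq0.
exists (Z1 ++ Z2) => x y h; apply: ratR_mono_on_sign => t tI; apply/negP => /eqP e;
  have := h t; rewrite mem_cat ?(H1 _ e) ?(H2 _ e) ?orbT => /(_ isT); by rewrite tI.
Qed.

(** The cuts for [k + 1] are [Z], the cuts for one step of [f], and the real preimages of the cuts
    [D] for [k]; then [f] sends a segment without cuts to a segment that avoids [D]. All [r <= k]
    are treated at once because the times between multiples of [k] have to be controlled as well. *)
Lemma iter_mono_partition (k : nat) (Z : seq R) : exists D : seq R, forall x y, x <= y ->
  (forall d, d \in D -> ~~ (x <= d <= y)) -> forall r, (r <= k)%N ->
  exists phi, mono_on (iter r f) x y phi /\
    forall d, d \in Z -> ~~ betw d (phi x) (phi y).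
Proof.
have sub (A : seq R) (a b a' b' : R) : a <= a' -> b' <= b ->
    (forall d, d \in A -> ~~ (a <= d <= b)) -> forall d, d \in A -> ~~ (a' <= d <= b').
  move=> aa bb h d /h; apply: contra => /andP[h1 h2].
  by rewrite (le_trans aa h1) (le_trans h2 bb).
elim: k => [|k [D HD]].
  exists Z => x y xy h r; rewrite leqn0 => /eqP ->; exists id; split; first exact: mono_on_id.
  move=> d /h; apply: contra => /orP[|] // /andP[h1 h2].
  by rewrite (le_trans xy h1) (le_trans h2 xy).
have [Z1 H1] := ratR_mono_on; have [Z2 H2] := finite_fibers D.
exists (Z ++ (Z1 ++ Z2)) => x y xy h [|r] rk.
  exists id; split; first exact: mono_on_id.
  move=> d dZ; have := h d; rewrite mem_cat dZ => /(_ isT); apply: contra => /orP[|] // /andP[h1 h2].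
  by rewrite (le_trans xy h1) (le_trans h2 xy).
have /H1 M : forall d, d \in Z1 -> ~~ (x <= d <= y).
  by move=> d dZ; apply: h; rewrite !mem_cat dZ orbT.
set g := fun t => p.[t] / q.[t] in M.
have [M1 M2 M3] := M.
have avoid d : d \in D -> ~~ betw d (g x) (g y).
  move=> dD; apply/negP => /(M3 _ _ _ (lexx x) xy (lexx y))[w [wI e]].
  have := h w; rewrite !mem_cat (H2 w d dD) ?orbT; last by rewrite M1// e.
  by move=> /(_ isT); rewrite wI.
have [|||phi [P1 P2]] := HD (Num.min (g x) (g y)) (Num.max (g x) (g y)) _ _ r; first by rewrite ge_min le_max lexx.
- move=> d /avoid; apply: contra; rewrite /betw.
  by case: (leP (g x) (g y)) => _ h'; rewrite h' ?orbT.
- exact: rk.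
exists (phi \o g); split.
  have -> : iter r.+1 f = iter r f \o f by apply/funext => z; rewrite iterSr.
  by apply: (mono_on_comp M P1) => t; exact: (mono_on_range M).
move=> d /P2; apply: contra; rewrite /betw /=; case: (leP (g x) (g y)) => // _.
by rewrite orbC.
Qed.

Lemma rcont_ratR : rcont f.
Proof.
move=> x e e0; have [d [d0 h]] := ratC_continuous pq_coprime pq_degree (embR x) e0.
by exists d; split=> // y /h; rewrite !ratC_embR.
Qed.

Lemma closedR_JuliaR : closedR (JuliaR p q).
Proof.
move=> x xJ F; have [d [d0 h]] := Fatou_nbhs F.
by have [y [yJ xy]] := xJ d d0; apply: yJ; apply: h.
Qed.

Lemma JuliaR_forward x : JuliaR p q x -> JuliaR p q (f x).
Proof.
move=> xJ F; apply: xJ; rewrite -ratC_embR in F.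
by apply: (Fatou_preimage (fun z => ratC_continuous pq_coprime pq_degree z)).
Qed.

(* Instability on the circle alone suffices. *)
Lemma JuliaR_unstable x (e : R) : 0 < e ->
  (forall d : R, 0 < d -> exists y, chordR x y < d /\
     exists n, e <= chordR (iter n f x) (iter n f y)) -> JuliaR p q x.
Proof.
move=> e0 unst F.
have [d [d0 h]] := Fatou_stable (fun z => ratC_continuous pq_coprime pq_degree z) F e0.
have [y [xy [n le]]] := unst d d0.
by have := h (embR y) xy n; rewrite !iter_ratC_embR ltNge => /negP; apply.
Qed.

End RealRationalMap.

(** * Counting words by full transitions *)

Section CodingTree.
Variables (T : eqType) (A : finType) (g : T -> T) (code : T -> A).
Implicit Types (J : set T) (S : seq A) (b c : A).

Definition cell b : set T := [set x | code x = b].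

Definition step J b : set T := [set y | (exists2 x, J x & g x = y) /\ code y = b].

(* The transition from [J] to [b] is full when the image of [J] covers the
   whole cell, so that the memory of the past of the orbit is lost. *)
Definition full J b : Prop := cell b `<=` step J b.

Definition allowed S J b : bool := `[< step J b !=set0 /\ (full J b -> b \in S) >].

(* Number of admissible words of length [n] from state [J], when full
   transitions are only allowed to letters of [S]. *)
Fixpoint nwords S n J : nat :=
  if n is n'.+1 then (\sum_(b | allowed S J b) nwords S n' (step J b))%N else 1%N.

(* Number of words of length [n.+1] from [J] ending with a full transition to [c]. *)
Fixpoint nfull c n J : nat :=
  if n is n'.+1 then (\sum_(b | `[< step J b !=set0 >]) nfull c n' (step J b))%N
  else `[< cell c !=set0 /\ full J c >].

Lemma step_full J b : full J b -> step J b = cell b.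
Proof. by move=> h; apply/seteqP; split=> [y []|]. Qed.

Lemma allowed_cons c S J b : b != c -> allowed (c :: S) J b = allowed S J b.
Proof. by move=> bc; rewrite /allowed inE (negPf bc). Qed.

Lemma allowed_cons_self c S J : allowed (c :: S) J c = `[< step J c !=set0 >].
Proof. by apply/asboolP/asboolP => [[]//|h]; split=> // _; rewrite inE eqxx. Qed.

Lemma allowed_nonempty S J b : allowed S J b -> `[< step J b !=set0 >].
Proof. by move/asboolP => [h _]; apply/asboolP. Qed.

Lemma sum_allowed_cons c S J (F : A -> nat) :
  (\sum_(b | allowed (c :: S) J b) F b <=
   \sum_(b | allowed S J b) F b + (`[< cell c !=set0 /\ full J c >] : nat) * F c)%N.
Proof.
rewrite (bigID (pred1 c)) /= [X in (_ <= X + _)%N](bigID (pred1 c)) /=.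
have -> : (\sum_(b | allowed (c :: S) J b && (b != c)) F b =
           \sum_(b | allowed S J b && (b != c)) F b)%N.
  apply: eq_bigl => b; case: (eqVneq b c) => [->|bc]; first by rewrite !andbF.
  by rewrite allowed_cons.
rewrite [X in (_ <= X)%N]addnAC leq_add2r.
have E S' : (\sum_(b | allowed S' J b && (b == c)) F b = allowed S' J c * F c)%N.
  case al: (allowed S' J c).
    rewrite (eq_bigl (pred1 c)) ?big_pred1_eq ?mul1n// => b /=.
    by case: eqP => [->|]; rewrite ?al ?andbF.
  by rewrite big_pred0 ?mul0n// => b; case: eqP => [->|]; rewrite ?al ?andbF.
rewrite !E -mulnDl leq_mul2r; apply/orP; right.
rewrite allowed_cons_self /allowed.
case: asboolP => // ne; case: asboolP => //= nal; case: asboolP => //= nfl.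
by case: nal; split=> // fl; case: nfl; split=> //; rewrite -(step_full fl).
Qed.

(** Cut a word at its last full transition to [c]: what precedes is counted by [nfull], and what
    follows starts afresh from [cell c] with full transitions into [S] only. *)
Lemma nwords_last_hit c S n J : (nwords (c :: S) n J <= nwords S n J +
  \sum_(i < n) nfull c i J * nwords S (n - i.+1) (cell c))%N.
Proof.
elim: n J => [|n IH] J; first by rewrite big_ord0.
rewrite [nwords (c :: S) n.+1 J]/=.
apply: leq_trans (leq_sum _ (fun b _ => IH (step J b))) _.
rewrite big_split /= exchange_big /=.
apply: leq_trans (leq_add (sum_allowed_cons _ _ _ _) (leqnn _)) _.
rewrite -addnA leq_add2l big_ord_recl /= subn1 /=; apply: leq_add.
  by case: asboolP => //= -[_ fl]; rewrite !mul1n (step_full fl).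
apply: leq_sum => i _; rewrite /bump /= add1n subSS -big_distrl /= leq_mul2r.
apply/orP; right; rewrite big_mkcond [X in (_ <= X)%N]big_mkcond /=.
by apply: leq_sum => b _; case: ifP => // /allowed_nonempty ->.
Qed.

(** Cut instead at the first full transition to [c], so that what precedes is a word for [S]. This
    reduces an arbitrary state to [cell c], where [nwords_last_hit] involves only returns from [c]
    to [c]. *)
Lemma nwords_first_hit c S n J : (nwords (c :: S) n J <= nwords S n J +
  \sum_(j < n) nwords S j J * nwords (c :: S) (n - j.+1) (cell c))%N.
Proof.
elim: n J => [|n IH] J; first by rewrite big_ord0.
rewrite [nwords (c :: S) n.+1 J]/=.
apply: leq_trans (sum_allowed_cons _ _ _ _) _.
apply: leq_trans (leq_add (leq_sum _ (fun b _ => IH (step J b))) (leqnn _)) _.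
rewrite big_split /= exchange_big /= -addnA leq_add2l.
rewrite big_ord_recl /= mul1n subn1 /= addnC; apply: leq_add.
  by case: asboolP => //= -[_ fl]; rewrite mul1n (step_full fl).
by apply: leq_sum => i _; rewrite /bump /= add1n subSS -big_distrl.
Qed.

Variable state : set T -> Prop.
Hypothesis state_cell : forall b, state (cell b).
Hypothesis state_step : forall J b, state J -> state (step J b).
Hypothesis few_partial : forall J b1 b2 b3, state J -> b1 != b2 -> b1 != b3 -> b2 != b3 ->
  allowed [::] J b1 -> allowed [::] J b2 -> allowed [::] J b3 -> False.

(** With every full transition forbidden, a state has at most two successors. *)
Lemma nwords_nil n J : state J -> (nwords [::] n J <= 2 ^ n)%N.
Proof.
elim: n J => // n IH J sJ; rewrite /=.
apply: leq_trans (leq_sum _ (fun b _ => IH (step J b) (state_step b sJ))) _.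
rewrite sum_nat_const expnS leq_mul2r; apply/orP; right.
rewrite leqNgt; apply/negP => /card_gt2P[b1 [b2 [b3]]].
move=> [[h1 h2 h3] [n12 n23 n31]].
by apply: (few_partial sJ (b1 := b1) (b2 := b2) (b3 := b3)) => //; rewrite eq_sym.
Qed.

Section Growth.
Variable (R : realType) (rho : R).
Hypothesis rho_ge2 : 2 <= rho.
Hypothesis nfull_le : forall c i, (nfull c i (cell c))%:R <= 3 * rho ^+ i.+1.

(** The last hit bounds the count from [cell c] with factor [Q (1 + 3 M)]; the first hit then gives
    [Q + M (1 + 3 M) Q ^ 2] from any state, which is at most [4 (M + 1) ^ 2 Q ^ 2]. The common bound
    [M] on lengths keeps the factor fixed while shorter words enter the sums. *)
Lemma nwords_growth_cons (M : nat) (Q : R) c S : 1 <= Q ->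
  (forall n J, (n <= M)%N -> state J -> (nwords S n J)%:R <= Q * rho ^+ n) ->
  forall n J, (n <= M)%N -> state J ->
    (nwords (c :: S) n J)%:R <= (4 * M.+1%:R ^+ 2) * Q ^+ 2 * rho ^+ n.
Proof.
move=> Q1 HS; have rho2 := rho_ge2; have rho0 : 0 <= rho by lra.
have Q0 : 0 <= Q by lra.
have M0 : 0 <= M%:R :> R by rewrite ler0n.
have nM n : (n <= M)%N -> n%:R <= M%:R :> R by rewrite ler_nat.
have Hc n : (n <= M)%N -> (nwords (c :: S) n (cell c))%:R <= Q * (1 + 3 * M%:R) * rho ^+ n.
  move=> nle; have := nwords_last_hit c S n (cell c).
  rewrite -(ler_nat R) natrD => /le_trans; apply.
  rewrite natr_sum mulrDr mulr1 mulrDl; apply: lerD; first exact: HS.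
  apply: le_trans (_ : \sum_(i < n) (3 * Q * rho ^+ n) <= _); last first.
    rewrite sumr_const card_ord -[_ *+ n]mulr_natl.
    rewrite [X in _ <= X](_ : _ = M%:R * (3 * Q * rho ^+ n)); last by ring.
    by apply: ler_wpM2r; rewrite ?mulr_ge0 ?exprn_ge0// nM.
  apply: ler_sum => i _; rewrite natrM.
  have -> : 3 * Q * rho ^+ n = (3 * rho ^+ i.+1) * (Q * rho ^+ (n - i.+1)).
    rewrite [RHS](_ : _ = 3 * Q * (rho ^+ i.+1 * rho ^+ (n - i.+1))); last by ring.
    by rewrite -exprD subnKC.
  by apply: ler_pM; rewrite ?ler0n// HS// (leq_trans (leq_subr _ _)).
move=> n J nle sJ; have := nwords_first_hit c S n J.
rewrite -(ler_nat R) natrD => /le_trans; apply.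
apply: le_trans (_ : Q * rho ^+ n + M%:R * (Q * (Q * (1 + 3 * M%:R)) * rho ^+ n) <= _); last first.
  rewrite [X in X <= _](_ : _ = (Q + M%:R * (1 + 3 * M%:R) * Q ^+ 2) * rho ^+ n); last by ring.
  apply: ler_wpM2r; first by rewrite exprn_ge0.
  have QQ : Q <= Q ^+ 2 by rewrite expr2 ler_peMl.
  apply: le_trans (_ : Q ^+ 2 + M%:R * (1 + 3 * M%:R) * Q ^+ 2 <= _); first by rewrite lerD2r.
  rewrite -[X in X + _]mul1r -mulrDl; apply: ler_wpM2r; first exact: exprn_ge0.
  by rewrite -natr1; nra.
apply: lerD; first exact: HS.
rewrite natr_sum.
apply: le_trans (_ : \sum_(i < n) (Q * (Q * (1 + 3 * M%:R)) * rho ^+ n) <= _); last first.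
  rewrite sumr_const card_ord -[_ *+ n]mulr_natl; apply: ler_wpM2r; last exact: nM.
  by rewrite !mulr_ge0 ?exprn_ge0//; lra.
apply: ler_sum => i _; rewrite natrM.
apply: le_trans (_ : (Q * rho ^+ i) * (Q * (1 + 3 * M%:R) * rho ^+ (n - i.+1)) <= _).
  apply: ler_pM; rewrite ?ler0n//; first by apply: HS => //; apply: ltnW; apply: leq_trans nle.
  by apply: Hc; rewrite (leq_trans (leq_subr _ _)).
rewrite [X in X <= _](_ : _ = Q * (Q * (1 + 3 * M%:R)) * (rho ^+ i * rho ^+ (n - i.+1))); last by ring.
apply: ler_wpM2l; first by rewrite !mulr_ge0//; lra.
rewrite -exprD; apply: ler_weXn2l; first lra.
by apply: leq_trans (leqnSn _) _; rewrite -addSn subnKC.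
Qed.

(** A new letter squares the factor and multiplies it once by [4 (M + 1) ^ 2], so [a] becomes
    [2 a + 1]. It is chosen before [M] and [n], hence the factor is polynomial in the length. *)
Lemma nwords_growth S : exists a : nat, forall M n J, (n <= M)%N -> state J ->
  (nwords S n J)%:R <= (4 * M.+1%:R ^+ 2) ^+ a * rho ^+ n.
Proof.
elim: S => [|c S [a IH]].
  exists 0%N => M n J _ sJ; rewrite expr0 mul1r.
  apply: le_trans (_ : (2 ^ n)%:R <= _); first by rewrite ler_nat nwords_nil.
  by rewrite natrX; have rho2 := rho_ge2; apply: lerXn2r; rewrite ?nnegrE//; lra.
exists (a * 2).+1 => M n J nM sJ.
have B1 : 1 <= 4 * M.+1%:R ^+ 2 :> R.
  have : 1 <= M.+1%:R ^+ 2 :> R by rewrite exprn_ege1// ler1n.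
  lra.
have := @nwords_growth_cons M ((4 * M.+1%:R ^+ 2) ^+ a) c S (exprn_ege1 _ B1) (IH M) n J nM sJ.
by rewrite -exprM [_ ^+ (a * 2).+1]exprS.
Qed.

End Growth.

(** The letter at time 0 is left out: it is already recorded by the state from which the word
    starts. *)
Definition itinerary n (x : T) : seq A := [seq code (iter i g x) | i <- iota 1 n].

Lemma itineraryS n x : itinerary n.+1 x = code (g x) :: itinerary n (g x).
Proof.
rewrite /itinerary /= -(addn1 1) iotaDl -map_comp; congr (_ :: _).
by apply: eq_map => i /=; rewrite -iterSr.
Qed.

Lemma size_le_nwords n J (E : seq T) : (forall x, x \in E -> J x) ->
  uniq (map (itinerary n) E) -> (size E <= nwords (enum A) n J)%N.
Proof.
elim: n J E => [|n IH] J E EJ u.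
  by case: E EJ u => [|x [|y E]] //=.
have -> : size E = (\sum_(b : A) count (fun x => code (g x) == b) E)%N.
  elim: {EJ u} E => [|x E IHE] /=; first by rewrite big1.
  rewrite big_split /= -IHE -add1n; congr (_ + _)%N.
  by rewrite (bigD1 (code (g x))) //= eqxx big1 // => b; rewrite eq_sym => /negPf ->.
rewrite /= [X in (_ <= X)%N]big_mkcond /=; apply: leq_sum => b _.
set Eb := [seq x <- E | code (g x) == b].
rewrite -size_filter -/Eb.
have stepE y : y \in map g Eb -> step J b y.
  by case/mapP => x; rewrite mem_filter => /andP[/eqP xb xE] ->; split=> //; exists x => //; exact: EJ.
case: ifPn => al; last first.
  rewrite leqn0 size_eq0; apply/eqP; case EE: Eb => [//|x Eb'].
  move: al; rewrite /allowed => /asboolP; case; split.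
    by exists (g x); apply: stepE; rewrite EE mem_head.
  by rewrite mem_enum.
rewrite -(size_map g); apply: IH => //.
rewrite -map_comp; apply/(map_uniq (f := cons b)); rewrite -map_comp.
have -> : map (cons b \o (itinerary n \o g)) Eb = map (itinerary n.+1) Eb.
  apply/eq_in_map => x; rewrite mem_filter => /andP[/eqP xb _] /=.
  by rewrite itineraryS xb.
apply: subseq_uniq u; apply: map_subseq; exact: filter_subseq.
Qed.

(** Because the last transition of such a word is full, its end point can be prescribed anywhere in
    [cell c] by pulling back along the same word. This turns returns to [c] into branches onto the
    whole cell. *)
Lemma full_words_points c n J : exists E : seq T, [/\ size E = nfull c n J,
  forall x, x \in E -> J x, uniq (map (itinerary n.+1) E) &
  forall x z, x \in E -> code z = c ->
    exists y, [/\ J y, itinerary n.+1 y = itinerary n.+1 x & iter n.+1 g y = z]].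
Proof.
elim: n J => [|n IH] J.
  rewrite /nfull; case: asboolP => [[[z zc] fl]|_]; last by exists nil.
  have [[x Jx gx] _] := fl z zc.
  exists [:: x]; split=> //; first by move=> y; rewrite inE => /eqP ->.
  move=> x' z'; rewrite inE => /eqP -> z'c; have [[y Jy gy] _] := fl z' z'c.
  by exists y; split=> //; rewrite /itinerary /= gy gx z'c zc.
(* The words are collected along a list [bs] of first letters; different first letters keep the
   itineraries distinct. *)
suff key (bs : seq A) : uniq bs -> exists E : seq T,
    [/\ size E = (\sum_(b <- bs | `[< step J b !=set0 >]) nfull c n (step J b))%N,
     forall x, x \in E -> J x /\ code (g x) \in bs,
     uniq (map (itinerary n.+2) E) &
     forall x z, x \in E -> code z = c -> exists y,
       [/\ J y, itinerary n.+2 y = itinerary n.+2 x & iter n.+2 g y = z]].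
  have [E [E1 E2 E3 E4]] := key _ (enum_uniq A).
  by exists E; split=> //; [rewrite E1 big_enum_cond|move=> x /E2[]].
elim: bs => [|b bs IHb] /=; first by move=> _; exists nil; split=> //; rewrite big_nil.
move=> /andP[bbs /IHb[E [E1 E2 E3 E4]]].
case: (pselect (step J b !=set0)) => [ne|ne]; last first.
  exists E; split=> //; first by rewrite big_cons asboolF.
  by move=> x /E2[? ?]; rewrite inE; split=> //; apply/orP; right.
have [Eb [F1 F2 F3 F4]] := IH (step J b).
have /choice[s sP] : forall y, exists x, y \in Eb -> J x /\ g x = y.
  move=> y; case yE: (y \in Eb); last by exists y.
  by have [[x Jx gx] _] := F2 y yE; exists x.
have sb y : y \in Eb -> itinerary n.+2 (s y) = b :: itinerary n.+1 y.
  by move=> yE; rewrite itineraryS (sP y yE).2; have [_ ->] := F2 y yE.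
have mapE : map (itinerary n.+2) (map s Eb) = map (cons b) (map (itinerary n.+1) Eb).
  by rewrite -!map_comp; apply/eq_in_map => y yE /=; rewrite sb.
exists (map s Eb ++ E); split.
- by rewrite size_cat size_map F1 E1 big_cons asboolT.
- move=> x; rewrite mem_cat => /orP[/mapP[y yE ->]|/E2[? ?]].
    have [Js gs] := sP y yE; split=> //; rewrite gs.
    by have [_ ->] := F2 y yE; rewrite mem_head.
  by rewrite inE; split=> //; apply/orP; right.
- rewrite map_cat cat_uniq E3 mapE map_inj_uniq ?F3 ?andbT /=; last by move=> u v [].
  apply/hasPn => w /mapP[x /E2[_ xbs] ->].
  apply/negP => /mapP[w' _]; rewrite itineraryS => -[e _].
  by rewrite e (negPf bbs) in xbs.
- move=> x z; rewrite mem_cat => /orP[/mapP[y yE ->]|xE] zc; last exact: E4.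
  have [y' [[[x' Jx' gx'] cy'] iy' gy']] := F4 y z yE zc.
  exists x'; split=> //; last by rewrite -[LHS]/(iter n.+2 g x') iterSr gx'.
  by rewrite itineraryS gx' cy' iy' sb.
Qed.

End CodingTree.

(** * Coding of the circle *)

(** The segments lie strictly inside [(u, v)], so a branch onto [[u, v]] moves the end points of its
    segment and has its fixed points in the interior. *)
Definition horseshoe (R : realType) (f : rcircle R -> rcircle R) (T : nat) (u v : R)
    (N : nat) (K : 'I_N -> R * R) : Prop :=
  u < v /\
  (forall i, [/\ u < (K i).1, (K i).1 < (K i).2, (K i).2 < v &
     exists phi, mono_on (iter T f) (K i).1 (K i).2 phi /\
       (phi (K i).1 = u /\ phi (K i).2 = v \/ phi (K i).1 = v /\ phi (K i).2 = u)]) /\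
  (forall i j, i != j -> (K i).2 < (K j).1 \/ (K j).2 < (K i).1).

Lemma uniq_map_inj (T T' : eqType) (f : T -> T') (s : seq T) x y :
  uniq (map f s) -> x \in s -> y \in s -> f x = f y -> x = y.
Proof.
elim: s => //= z s IH /andP[fz us]; rewrite !inE => /predU1P[->|xs] /predU1P[->|ys] e //.
- by rewrite e map_f in fz.
- by rewrite -e map_f in fz.
- exact: IH.
Qed.

Section CircleCoding.
Variables (R : realType) (D : seq R).

Definition letter := option ('I_(size D).+1 * 'I_(size D).+1).

(** Comparing the strict with the weak count tells a point of [D] from the gaps beside it: the cells
    are infinity, the points of [D] and the open gaps. *)
Definition rcode (x : rcircle R) : letter :=
  if x is Some t then
    Some (inord (count (fun d => d < t) D), inord (count (fun d => d <= t) D))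
  else None.

Lemma rcode_eq (s t : R) : rcode (Some s) = rcode (Some t) <->
  count (fun d => d < s) D = count (fun d => d < t) D /\
  count (fun d => d <= s) D = count (fun d => d <= t) D.
Proof.
split=> [[/(congr1 val) e1 /(congr1 val) e2]|[e1 e2]]; last by rewrite /rcode e1 e2.
by move: e1 e2; rewrite /= !inordK ?ltnS ?count_size.
Qed.

Lemma rcode_between (s w t : R) : s <= w -> w <= t ->
  rcode (Some s) = rcode (Some t) -> rcode (Some w) = rcode (Some s).
Proof.
move=> sw wt /rcode_eq[e1 e2]; apply/rcode_eq; split; apply/eqP; rewrite eqn_leq.
  rewrite {1}e1 !sub_count // => d /=; first by move=> h; apply: lt_le_trans h _.
  by move=> h; apply: lt_le_trans h _.
rewrite {1}e2 !sub_count // => d /=; first by move=> h; apply: le_trans h _.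
by move=> h; apply: le_trans h _.
Qed.

Lemma count_lt_strict (T : eqType) (a b : pred T) (E : seq T) x :
  x \in E -> subpred a b -> ~~ a x -> b x -> (count a E < count b E)%N.
Proof.
move=> xE ab nax bx; elim: E xE => //= y E IH; rewrite inE => /predU1P[<-|/IH h].
  by rewrite (negPf nax) bx add0n add1n ltnS sub_count.
rewrite -addnS; apply: leq_add => //.
by case ay: (a y) => //; rewrite (ab _ ay).
Qed.

Lemma rcode_avoid (s t : R) : s < t -> rcode (Some s) = rcode (Some t) ->
  forall d, d \in D -> ~~ (s <= d <= t).
Proof.
move=> st /rcode_eq[e1 e2] d dD; apply/negP => /andP[sd dt].
have [sd'|sd'] := ltP s d.
  have := @count_lt_strict _ (fun d => d <= s) (fun d => d <= t) D d dD.
  rewrite e2 ltnn => h; have : false by apply: h => //=; [move=> c; lra|rewrite -ltNge].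
  by [].
have := @count_lt_strict _ (fun d => d < s) (fun d => d < t) D d dD.
rewrite e1 ltnn => h; have : false by apply: h => /=; [move=> c; lra|rewrite -leNgt|lra].
by [].
Qed.

Variables (f : rcircle R -> rcircle R) (k : nat) (Z : seq R).
Hypothesis partition : forall x y : R, x <= y ->
  (forall d, d \in D -> ~~ (x <= d <= y)) -> forall r, (r <= k)%N ->
  exists phi, mono_on (iter r f) x y phi /\ forall d, d \in Z -> ~~ betw d (phi x) (phi y).

Let g := iter k f.

Lemma rcode_mono_on (s t : R) : s < t -> rcode (Some s) = rcode (Some t) ->
  exists phi, mono_on g s t phi.
Proof.
move=> st e; have [phi [h _]] := partition (ltW st) (rcode_avoid st e) (leqnn k).
by exists phi.
Qed.

(** Invariant of the coding: a state stays in one cell, where [g] is monotone, and is convex in the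
    chart, so that its image has no gaps. *)
Definition state (J : set (rcircle R)) : Prop :=
  (forall x y, J x -> J y -> rcode x = rcode y) /\
  (forall s w t : R, s <= w -> w <= t -> J (Some s) -> J (Some t) -> J (Some w)).

Lemma state_cell b : state (cell rcode b).
Proof.
split=> [x y /= -> ->//|s w t sw wt /= <- e].
exact: rcode_between sw wt (esym e).
Qed.

Lemma state_ivt J x y (a b c : R) : state J -> J x -> J y -> g x = Some a -> g y = Some b ->
  a <= c -> c <= b -> exists2 w, J w & g w = Some c.
Proof.
move=> [Jc Jv] Jx Jy gx gy ac cb.
have [xy|/eqP xy] := eqVneq x y.
  exists x => //; move: gx; rewrite xy gy => -[e]; congr Some; lra.
have := Jc x y Jx Jy; case: x y Jx Jy xy gx gy => [s|] [t|] // Js Jt st gs gt e.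
have key (s' t' : R) : s' < t' -> J (Some s') -> J (Some t') ->
    rcode (Some s') = rcode (Some t') -> (g (Some s') = Some a /\ g (Some t') = Some b \/
    g (Some s') = Some b /\ g (Some t') = Some a) -> exists2 w, J w & g w = Some c.
  move=> lt Js' Jt' /(rcode_mono_on lt)[phi [h1 _ h3]] ends.
  have le := ltW lt.
  have ps : g (Some s') = Some (phi s') by rewrite h1// lexx.
  have pt : g (Some t') = Some (phi t') by rewrite h1// lexx andbT.
  have [w [/andP[sw wt] pw]] : exists w, s' <= w <= t' /\ phi w = c.
    apply: h3; rewrite ?lexx // /betw; move: ends; rewrite ps pt => -[] [[->] [->]].
      by rewrite ac cb.
    by rewrite ac cb orbT.
  by exists (Some w); [exact: Jv Js' Jt'|rewrite h1 ?sw// pw].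
have [lt|lt|eq] := ltgtP s t; last by case: st; rewrite eq.
- by apply: (key s t) => //; left.
- by apply: (key t s) => //; right.
Qed.

Lemma state_step J b : state J -> state (step g rcode J b).
Proof.
move=> sJ; split=> [x y [_ ->] [_ ->]//|s w t sw wt [[x Jx gx] cs] [[y Jy gy] ct]].
split; first by have [z Jz gz] := state_ivt sJ Jx Jy gx gy sw wt; exists z.
by rewrite (rcode_between sw wt) ?cs ?ct.
Qed.

Lemma state_image_Some J x y : state J -> J x -> J y -> g x <> g y -> exists a, g x = Some a.
Proof.
move=> [Jc Jv] Jx Jy; have := Jc x y Jx Jy.
case: x y Jx Jy => [s|] [t|] // Js Jt e ne.
have [lt|lt|eq] := ltgtP s t; last by case: ne; rewrite eq.
- have [phi [h1 _ _]] := rcode_mono_on lt e; exists (phi s).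
  by rewrite h1// lexx ltW.
- have [phi [h1 _ _]] := rcode_mono_on lt (esym e); exists (phi s).
  by rewrite h1// lexx ltW.
Qed.

(** Of three letters met by the image, the middle one has its whole cell between two attained
    values, since cells are intervals, and [state_ivt] covers that cell. The six cases are the
    possible orders of the values. *)
Lemma state_few_partial J (b1 b2 b3 : letter) : state J ->
  b1 != b2 -> b1 != b3 -> b2 != b3 ->
  allowed g rcode [::] J b1 -> allowed g rcode [::] J b2 -> allowed g rcode [::] J b3 -> False.
Proof.
move=> sJ.
have mid (c1 c2 c3 : letter) x1 x3 (t1 t2 t3 : R) : t1 < t2 -> t2 < t3 -> c1 != c2 -> c3 != c2 ->
    J x1 -> g x1 = Some t1 -> rcode (Some t1) = c1 -> rcode (Some t2) = c2 ->
    J x3 -> g x3 = Some t3 -> rcode (Some t3) = c3 -> ~ full g rcode J c2 -> False.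
  move=> t12 t23 /eqP n12 /eqP n32 J1 g1 r1 r2 J3 g3 r3; apply => z zc.
  split=> //; case: z zc => [t|] /= tc; last by rewrite -r2 in tc.
  apply: (state_ivt sJ J1 J3 g1 g3).
    rewrite leNgt; apply/negP => lt; apply: n12; rewrite -r1 -tc.
    by apply: (rcode_between (ltW lt) (ltW t12)); rewrite r2.
  rewrite leNgt; apply/negP => lt; apply: n32; rewrite -r2 -r3.
  by apply: (rcode_between (ltW t23) (ltW lt)); rewrite r2.
move=> n12 n13 n23 /asboolP[[y1 [[x1 J1 g1] r1]] p1] /asboolP[[y2 [[x2 J2 g2] r2]] p2]
  /asboolP[[y3 [[x3 J3 g3] r3]] p3].
have d12 : y1 <> y2 by move=> e; move: n12; rewrite -r1 -r2 e eqxx.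
have d13 : y1 <> y3 by move=> e; move: n13; rewrite -r1 -r3 e eqxx.
have d23 : y2 <> y3 by move=> e; move: n23; rewrite -r2 -r3 e eqxx.
have [t1 e1] : exists a, g x1 = Some a by apply: (state_image_Some sJ J1 J2); rewrite g1 g2.
have [t2 e2] : exists a, g x2 = Some a.
  by apply: (state_image_Some sJ J2 J1); rewrite g1 g2; exact/nesym.
have [t3 e3] : exists a, g x3 = Some a.
  by apply: (state_image_Some sJ J3 J1); rewrite g1 g3; exact/nesym.
rewrite -g1 e1 in r1 d12 d13; rewrite -g2 e2 in r2 d12 d23; rewrite -g3 e3 in r3 d13 d23.
have f1 : ~ full g rcode J b1 by move=> /p1.
have f2 : ~ full g rcode J b2 by move=> /p2.
have f3 : ~ full g rcode J b3 by move=> /p3.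
have n21 : b2 != b1 by rewrite eq_sym.
have n31 : b3 != b1 by rewrite eq_sym.
have n32 : b3 != b2 by rewrite eq_sym.
have [l12|l12|E] := ltgtP t1 t2; last by case: d12; rewrite E.
- have [l23|l23|E] := ltgtP t2 t3; last by case: d23; rewrite E.
    exact: mid l12 l23 n12 n32 J1 e1 r1 r2 J3 e3 r3 f2.
  have [l13|l13|E] := ltgtP t1 t3; last by case: d13; rewrite E.
    exact: mid l13 l23 n13 n23 J1 e1 r1 r3 J2 e2 r2 f3.
  exact: mid l13 l12 n31 n21 J3 e3 r3 r1 J2 e2 r2 f1.
- have [l13|l13|E] := ltgtP t1 t3; last by case: d13; rewrite E.
    exact: mid l12 l13 n21 n31 J2 e2 r2 r1 J3 e3 r3 f1.
  have [l23|l23|E] := ltgtP t2 t3; last by case: d23; rewrite E.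
    exact: mid l23 l13 n23 n13 J2 e2 r2 r3 J1 e1 r1 f3.
  exact: mid l23 l12 n32 n12 J3 e3 r3 r2 J1 e1 r1 f2.
Qed.

(** If both ends lie in one cell, [g] is monotone in between, and by hypothesis the image segment
    again has both ends in one cell. The starting cell accounts for one step by itself, hence [n]
    letters control [n + 1] iterates. *)
Lemma itinerary_interval n (s t : R) : s < t -> rcode (Some s) = rcode (Some t) ->
  itinerary g rcode n (Some s) = itinerary g rcode n (Some t) ->
  (exists phi, mono_on (iter n.+1 g) s t phi) /\
  forall w, s <= w -> w <= t -> itinerary g rcode n (Some w) = itinerary g rcode n (Some s).
Proof.
elim: n s t => [|n IH] s t st e.
  move=> _; split=> //; exact: rcode_mono_on e.
have [phi M] := rcode_mono_on st e; have [h1 h2 h3] := M.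
have le := ltW st.
have gE w : s <= w -> w <= t -> g (Some w) = Some (phi w) by move=> a b; rewrite h1// a.
rewrite !itineraryS !gE// => E.
have c1 : rcode (Some (phi s)) = rcode (Some (phi t)) := congr1 (head (rcode None)) E.
have {E} c2 : itinerary g rcode n (Some (phi s)) = itinerary g rcode n (Some (phi t)) :=
  congr1 behead E.
have compE : iter n.+2 g = iter n.+1 g \o g by apply/funext => z; rewrite iterSr.
have it w : s <= w -> w <= t -> itinerary g rcode n.+1 (Some w) =
    rcode (Some (phi w)) :: itinerary g rcode n (Some (phi w)).
  by move=> a b; rewrite itineraryS gE.
case: h2 => mo.
- have lt : phi s < phi t by apply: mo.
  have [[psi P] I] := IH _ _ lt c1 c2.
  have into w : s <= w <= t -> phi s <= phi w <= phi t.
    move=> /andP[]; rewrite le_eqVlt => /predU1P[<-|sw]; first by move=> _; rewrite lexx ltW.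
    rewrite le_eqVlt => /predU1P[->|wt]; first by rewrite lexx ltW.
    by rewrite !ltW// mo// ltW.
  split; first by exists (psi \o phi); rewrite compE; exact: mono_on_comp M P into.
  move=> w sw wt; have /andP[a b] : phi s <= phi w <= phi t by apply: into; rewrite sw.
  rewrite !it ?lexx// I//; congr (_ :: _). exact: rcode_between a b c1.
- have lt : phi t < phi s by apply: mo.
  have [[psi P] I] := IH _ _ lt (esym c1) (esym c2).
  have into w : s <= w <= t -> phi t <= phi w <= phi s.
    move=> /andP[]; rewrite le_eqVlt => /predU1P[<-|sw]; first by move=> _; rewrite lexx ltW.
    rewrite le_eqVlt => /predU1P[->|wt]; first by rewrite lexx ltW.
    by rewrite !ltW// mo// ltW.
  split; first by exists (psi \o phi); rewrite compE; exact: mono_on_comp M P into.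
  move=> w sw wt; have /andP[a b] : phi t <= phi w <= phi s by apply: into; rewrite sw.
  rewrite !it ?lexx// I// c2; congr (_ :: _); rewrite c1.
  exact: rcode_between a b (esym c1).
Qed.

Lemma itinerary_between n (s w t : R) : s <= w -> w <= t ->
  rcode (Some s) = rcode (Some t) ->
  itinerary g rcode n (Some s) = itinerary g rcode n (Some t) ->
  itinerary g rcode n (Some w) = itinerary g rcode n (Some s).
Proof.
move=> sw wt; have [st|st] := ltP s t.
  by move=> c e; have [_] := itinerary_interval st c e; apply.
by have -> : w = s by lra.
Qed.

(** Points of the cell with a common itinerary form an interval, and the intervals of different
    words are ordered like their sample points. With [u] and [v] taken from the two extreme words,
    the [N - 2] other intervals lie strictly in between, and each contains preimages of both [u] and
    [v]. *)
Lemma nfull_horseshoe (c : letter) (i : nat) :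
  let N := nfull g rcode c i (cell rcode c) in (2 < N)%N ->
  exists u v K, @horseshoe R f (k * i.+1) u v (N - 2) K.
Proof.
move=> N N2.
have [E [E1 E2 E3 E4]] := full_words_points g rcode c i (cell rcode c).
rewrite -/N in E1.
have uE : uniq E := map_uniq E3.
have [F EF] : exists F : seq R, E = map Some F.
  (* The cell of infinity is a single point, too small for more than two words. *)
  have : None \notin E.
    apply/negP => NE; have cN : c = None by rewrite -(E2 _ NE).
    have : (size E <= size [:: None : rcircle R])%N.
      apply: uniq_leq_size => // x /E2; rewrite cN inE.
      by case: x.
    by rewrite E1 /= leqNgt (ltnW N2).
  elim: (E) => [|[x|] s IHs]; [by exists nil| |by rewrite mem_head].
  by rewrite inE negb_or => /andP[_ /IHs[F ->]]; exists (x :: F).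
have Fc x : x \in F -> rcode (Some x) = c by move=> xF; apply: E2; rewrite EF map_f.
pose F' := sort <=%R F.
have FF' x : x \in F' = (x \in F) by rewrite mem_sort.
have srt : sorted <%R F' by rewrite sort_lt_sorted; move: uE; rewrite EF map_inj_uniq// => a b [].
have sF : size F' = N by rewrite size_sort -E1 EF size_map.
pose X j := nth 0 F' j.
have XF j : (j < N)%N -> X j \in F by move=> jN; rewrite -FF' mem_nth// sF.
have Xlt j l : (j < l)%N -> (l < N)%N -> X j < X l.
  by move=> jl lN; rewrite lt_sorted_ltn_nth// inE sF// (ltn_trans jl).
have Xit j l : (j < N)%N -> (l < N)%N -> j != l ->
    itinerary g rcode i.+1 (Some (X j)) <> itinerary g rcode i.+1 (Some (X l)).
  move=> jN lN jl e; have : X j = X l.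
    apply: (uniq_map_inj (f := itinerary g rcode i.+1 \o Some) (s := F)) => //; try exact: XF.
    by rewrite map_comp -EF.
  by case: (ltngtP j l) jl => // h _ e'; [have := Xlt _ _ h lN|have := Xlt _ _ h jN];
     rewrite e' ltxx.
have N0 : (0 < N)%N by apply: leq_trans N2.
have Nm : (N.-1 < N)%N by rewrite prednK.
pose cl j x := rcode (Some x) = c /\
  itinerary g rcode i.+1 (Some x) = itinerary g rcode i.+1 (Some (X j)).
have clX j : (j < N)%N -> cl j (X j) by move=> jN; split=> //; apply: Fc; exact: XF.
have clv j x w y : cl j x -> cl j y -> x <= w -> w <= y -> cl j w.
  move=> [cx ix] [cy iy] xw wy; split; first by rewrite (rcode_between xw wy)// cx cy.
  by rewrite (itinerary_between xw wy)// ?cx ?cy// ix iy.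
have cld j l x y : (j < l)%N -> (l < N)%N -> cl j x -> cl l y -> x < y.
  move=> jl lN cx cy; have jN := ltn_trans jl lN; rewrite ltNge; apply/negP => yx.
  have n1 : itinerary g rcode i.+1 (Some (X j)) <> itinerary g rcode i.+1 (Some (X l)).
    by apply: Xit; rewrite // neq_ltn jl.
  have := Xlt j l jl lN => lt.
  have [h|h] := leP (X l) x.
    have [_ e] := clv j (X j) (X l) x (clX j jN) cx (ltW lt) h.
    by apply: n1; rewrite -e.
  have [_ e] := clv l y x (X l) cy (clX l lN) yx (ltW h).
  by apply: n1; rewrite -e; case: cx => _ ->.
pose u := X 0; pose v := X N.-1.
have cu : rcode (Some u) = c by apply/Fc/XF.
have cv : rcode (Some v) = c by apply/Fc/XF.
have onto j z : (j < N)%N -> rcode (Some z) = c -> exists x, cl j x /\ iter i.+1 g (Some x) = Some z.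
  move=> jN zc; have [|y [yc yi gy]] := E4 (Some (X j)) (Some z) _ zc.
    by rewrite EF map_f// XF.
  case: y yc yi gy => [y|] yc yi gy; first by exists y.
  by move: yc; rewrite /cell /= -zc.
have uv : u < v by apply: Xlt; rewrite // -ltnS prednK// ltnW.
have Kex (j : 'I_(N - 2)) : exists I : R * R, [/\ u < I.1, I.1 < I.2, I.2 < v,
    cl j.+1 I.1 /\ cl j.+1 I.2 & exists phi, mono_on (iter (k * i.+1) f) I.1 I.2 phi /\
       (phi I.1 = u /\ phi I.2 = v \/ phi I.1 = v /\ phi I.2 = u)].
  have jN : (j.+1 < N.-1)%N by rewrite -ltnS prednK//; have := ltn_ord j; rewrite ltn_subRL add2n.
  have jN' := ltn_trans jN Nm.
  have [a [ca ga]] := onto j.+1 u jN' cu; have [b [cb gb]] := onto j.+1 v jN' cv.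
  have fE : iter (k * i.+1) f = iter i.+1 g.
    by apply/funext => z; rewrite /g mulnC iterM.
  have ab : a <> b by move=> e; move: gb; rewrite -e ga => -[] e'; move: uv; rewrite e' ltxx.
  have bounds x : cl j.+1 x -> u < x /\ x < v.
    move=> cx; split; first exact: (cld 0%N j.+1) (clX 0%N N0) cx.
    exact: (cld j.+1 N.-1) cx (clX _ Nm).
  have [ua av] := bounds a ca; have [ub bv] := bounds b cb.
  have mono x y : x < y -> cl j.+1 x -> cl j.+1 y -> exists phi, mono_on (iter (k * i.+1) f) x y phi.
    move=> xy [cx ix] [cy iy]; rewrite fE.
    have e0 : itinerary g rcode i.+1 (Some x) = itinerary g rcode i.+1 (Some y) by rewrite ix iy.
    (* The last letter is dropped, as [itinerary_interval] yields one iterate more than there are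
       letters. *)
    have e1 : itinerary g rcode i (Some x) = itinerary g rcode i (Some y).
      have tk w : itinerary g rcode i w = take i (itinerary g rcode i.+1 w).
        by rewrite /itinerary -map_take take_iota (minn_idPl (leqnSn i)).
      by rewrite !tk e0.
    by have [|//] := itinerary_interval xy _ e1; rewrite cx cy.
  have ends x y phi : x < y -> mono_on (iter (k * i.+1) f) x y phi ->
      Some (phi x) = iter i.+1 g (Some x) /\ Some (phi y) = iter i.+1 g (Some y).
    by move=> xy [h _ _]; rewrite -fE !h ?lexx ?ltW.
  case: (ltgtP a b) => [lt|lt|//].
    have [phi M] := mono _ _ lt ca cb; have [] := ends _ _ _ lt M.
    rewrite ga gb => -[e1] [e2].
    by exists (a, b); split=> //; exists phi; split=> //; left.
  have [phi M] := mono _ _ lt cb ca; have [] := ends _ _ _ lt M.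
  rewrite ga gb => -[e1] [e2].
  by exists (b, a); split=> //; exists phi; split=> //; right.
have /choice[K HK] := Kex.
exists u, v, K; split=> //; split.
  by move=> j; have [] := HK j.
move=> j l jl; have [_ _ _ [a1 b1] _] := HK j; have [_ _ _ [a2 b2] _] := HK l.
have lN (m : 'I_(N - 2)) : (m.+1 < N)%N.
  by have := ltn_ord m; rewrite ltn_subRL add2n => /ltnW.
have [h|h|/val_inj h] := ltngtP j l; last by rewrite h eqxx in jl.
  by left; apply: (cld j.+1 l.+1).
by right; apply: (cld l.+1 j.+1).
Qed.

End CircleCoding.

(** * Entropy of horseshoes *)

Lemma limn_esup_ge (R : realType) (w : nat -> \bar R) (l : \bar R) :
  (forall n, exists k, (n <= k)%N /\ (l <= w k)%E) -> (l <= limn_esup w)%E.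
Proof.
move=> h; rewrite limn_esup_lim (cvg_lim _ (@cvg_esups_inf R w))//.
apply: le_ereal_inf_tmp => _ [n _ <-]; have [k [nk lk]] := h n.
by apply: le_trans lk _; apply: ereal_sup_ubound; exists k.
Qed.

Lemma limn_esup_le (R : realType) (w : nat -> \bar R) (l : \bar R) (n : nat) :
  (forall k, (n <= k)%N -> (w k <= l)%E) -> (limn_esup w <= l)%E.
Proof.
move=> h; rewrite limn_esup_lim (cvg_lim _ (@cvg_esups_inf R w))//.
apply: (@le_trans _ _ (esups w n)); first by apply: ereal_inf_lbound; exists n.
by apply: ge_ereal_sup => _ [k nk <-]; exact: h.
Qed.

Lemma chordR_lower (R : realType) (u v eta : R) : 0 < eta -> exists d : R, 0 < d /\
  forall s t, u <= s <= v -> u <= t <= v -> eta <= `|s - t| -> d < chordR (Some s) (Some t).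
Proof.
move=> eta0; pose M := Num.max `|u| `|v|.
have M0 : 0 <= M by rewrite le_max normr_ge0.
have bd s : u <= s <= v -> s ^+ 2 <= M ^+ 2.
  move=> /andP[us sv]; rewrite -[leLHS]ger0_norm ?sqr_ge0// normrX.
  rewrite ler_pXn2r ?nnegrE ?normr_ge0// ler_norml; apply/andP; split.
    rewrite lerNl le_max; apply/orP; left.
    by apply: le_trans (_ : - u <= _); [lra|rewrite -normrN ler_norm].
  by rewrite le_max; apply/orP; right; apply: le_trans sv (ler_norm _).
exists (eta / (1 + M ^+ 2)); split; first by rewrite divr_gt0// ltr_wpDr ?sqr_ge0.
move=> s t sI tI st; rewrite /chordR /= -rmorphB -/(cabs _) cabsC /abs2c /= expr0n /= !addr0.
have pos (x : R) : 0 < 1 + x ^+ 2 by rewrite ltr_wpDr ?sqr_ge0.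
set S := Num.sqrt _; have S0 : 0 < S by rewrite sqrtr_gt0 mulr_gt0.
have SM : S <= 1 + M ^+ 2.
  rewrite -[leRHS](ger0_norm (ltW (pos M))) -sqrtr_sqr /S; apply: ler_wsqrtr; rewrite expr2.
  by apply: ler_pM; rewrite ?(ltW (pos _))// lerD2l bd.
have A : 0 < 2 * `|s - t| by lra.
apply: lt_le_trans (_ : 2 * `|s - t| / (1 + M ^+ 2) <= _).
  by rewrite ltr_pM2r ?invr_gt0//; lra.
by rewrite ler_pM2l// lef_pV2 ?posrE.
Qed.

Section HorseshoeEntropy.
Variable R : realType.
Variables p q : {poly R}.
Hypothesis pq_coprime : coprimep p q.
Hypothesis pq_degree : (0 < rdeg p q)%N.

Let f := ratR p q.

(* Both endpoints move outwards under [phi], so the leftmost fixed point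
   repels the points on its left. *)
Lemma expanding_periodic_Julia (m : nat) (u v l r : R) phi :
  u < l -> l < r -> r < v -> mono_on (iter m f) l r phi -> phi l = u -> phi r = v ->
  exists x, [/\ l <= x <= r, iter m f (Some x) = Some x & JuliaR p q (Some x)].
Proof.
move=> ul lr rv [h1 h2 h3] pl pr.
have inc a b : l <= a -> a < b -> b <= r -> phi a < phi b.
  case: h2 => h2; first exact: h2.
  move=> _ _ _; have := h2 l r (lexx l) lr (lexx r); rewrite pl pr; lra.
(* As [phi l = u < l] and [phi r = v > r], the infimum of [S] is the leftmost fixed point; every
   point of [[l, x)] moves to the left. *)
pose S := [set t | l <= t <= r /\ t <= phi t].
have Sr : S r by split; [rewrite lexx ltW|rewrite pr ltW].
have Sinf : has_inf S by split; [exists r|exists l => t [/andP[]]].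
pose x := inf S.
have xlb t : S t -> x <= t by move=> St; apply: ge_inf => //; case: Sinf.
have lx0 : l <= x by apply: lb_le_inf => [|t [/andP[]]//]; exists r.
have xr : x <= r by exact: xlb.
have lr' := ltW lr.
have px : phi x = x.
  apply/eqP; rewrite eq_le; apply/andP; split; rewrite leNgt; apply/negP => lt.
    have lx : l < x.
      by rewrite lt_neqAle lx0 andbT; apply: contraTneq lt => <-; rewrite pl -leNgt ltW.
    have [|w [/andP[lw wx] pw]] := h3 l x x (lexx l) lx0 xr.
      by rewrite /betw pl; apply/orP; left; lra.
    have wx' : w < x.
      by rewrite lt_neqAle wx andbT; apply: contraTneq lt => e; rewrite -{2}e pw ltxx.
    have : x <= w by apply: xlb; split; [lra|rewrite pw].
    lra.
  have [|w [/andP[xw wr] pw]] := h3 x r x lx0 xr (lexx r).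
    by rewrite /betw pr; apply/orP; left; lra.
  have wx' : x < w.
    by rewrite lt_neqAle xw andbT; apply: contraTneq lt => e; rewrite {1}e pw ltxx.
  have [t St tw] := inf_adherent (eps := w - x) (ltac:(lra)) Sinf.
  rewrite -/x in tw; have xt := xlb t St; case: St => /andP[lt' tr] tp.
  have := inc t w lt' (ltac:(lra)) wr; lra.
have lx : l < x.
  by rewrite lt_neqAle lx0 andbT; apply/eqP => e; move: px; rewrite -e pl; lra.
have below t : l <= t -> t < x -> phi t < t.
  move=> lt tx; rewrite ltNge; apply/negP => le.
  have : x <= t by apply: xlb; split=> //; apply/andP; split; lra.
  by lra.
have fx : iter m f (Some x) = Some x by rewrite h1 ?lx0// px.
exists x; split=> //; first by rewrite lx0.
have xl0 : 0 < x - l by lra.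
have [e [e0 near]] := chordR_near_Some x xl0.
apply: (JuliaR_unstable pq_coprime pq_degree e0) => d d0.
pose y := Num.max ((l + x) / 2) (x - d / 4).
have yx : y < x by rewrite gt_max; apply/andP; split; lra.
have ly : l < y by rewrite lt_max; apply/orP; left; lra.
have yd : x - d / 4 <= y by rewrite le_max lexx orbT.
exists (Some y); split.
  by apply: le_lt_trans (chordR_le _ _) _; rewrite ger0_norm; lra.
apply: contrapT => /forallNP nle.
have close n : chordR (iter n f (Some x)) (iter n f (Some y)) < e.
  by rewrite ltNge; apply/negP; exact: nle.
have fxi i : iter (i * m) f (Some x) = Some x.
  by elim: i => // i IH; rewrite mulSn iterD IH.
(* As long as the orbit of [y] stays within [e] of [x] it cannot leave [(l, x)], so [phi] can be
   applied again. *)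
have orb i : exists yi, [/\ iter (i * m) f (Some y) = Some yi, l < yi & yi < x].
  elim: i => [|i [yi [e1 lyi yix]]]; first by exists y.
  have E : iter (i.+1 * m) f (Some y) = Some (phi yi) by rewrite mulSn iterD e1 h1//; lra.
  exists (phi yi); have lt := below yi (ltW lyi) yix.
  have := close (i.+1 * m)%N; rewrite fxi E => /near[b [[<-]]].
  by rewrite ltr_norml => /andP[? ?]; split=> //; lra.
have /choice[Y HY] := orb.
have Ynext i : Y i.+1 = phi (Y i).
  have [e1 l1 r1] := HY i; have [e2 _ _] := HY i.+1.
  by move: e2; rewrite mulSn iterD e1 h1; [move=> -[]|lra].
have Yinf : has_inf (range Y).
  by split; [exists (Y 0%N), 0%N|exists l => _ [i _ <-]; have [_ /ltW] := HY i].
(* The decreasing orbit would tend to [L] in [[l, x)]; but [phi L < L], so points slightly above [L]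
   are already sent below [L]. *)
pose L := inf (range Y).
have Llb i : L <= Y i by apply: ge_inf; [case: Yinf|exists i].
have lL : l <= L by apply: lb_le_inf => [|_ [i _ <-]]; [exists (Y 0%N), 0%N|have [_ /ltW] := HY i].
have Lx : L < x by apply: le_lt_trans (Llb 0%N) _; have [] := HY 0%N.
have pL := below L lL Lx.
have [|w [/andP[Lw wx] pw]] := h3 L x L lL (ltW Lx) xr.
  by rewrite /betw px; apply/orP; left; lra.
have Lw' : L < w.
  by rewrite lt_neqAle Lw andbT; apply: contraTneq pL => wL; rewrite {1}wL pw ltxx.
have [_ [i _ <-] Yw] := inf_adherent (eps := w - L) (ltac:(lra)) Yinf.
rewrite -/L in Yw; have [_ lYi _] := HY i.
have := inc (Y i) w (ltW lYi) (ltac:(lra)) (le_trans wx xr).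
by rewrite -Ynext pw; have := Llb i.+1; lra.
Qed.

Variables (T N : nat) (u v : R) (K : 'I_N -> R * R).
Hypothesis hs : horseshoe f T u v K.

Definition letter_sign (i : 'I_N) : bool := iter T f (Some (K i).1) == Some u.

(** Orientation of the composed branch, [true] meaning increasing; equality of booleans is the
    product of signs. *)
Fixpoint word_sign (s : seq 'I_N) : bool :=
  if s is i :: s' then letter_sign i == word_sign s' else true.

Lemma word_sign_cat s s' : word_sign (s ++ s') = (word_sign s == word_sign s').
Proof.
elim: s => [|i s IH] /=; first by case: (word_sign s').
by rewrite IH; case: (letter_sign i); case: (word_sign s); case: (word_sign s').
Qed.

Lemma horseshoe_branch (i : 'I_N) (a b : R) : u <= a -> a < b -> b <= v ->
  exists l r phi, [/\ (K i).1 <= l, l < r & r <= (K i).2] /\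
    [/\ mono_on (iter T f) l r phi, forall t, l <= t <= r -> a <= phi t <= b &
     if letter_sign i then phi l = a /\ phi r = b else phi l = b /\ phi r = a].
Proof.
move=> ua ab bv; have [uv [/(_ i)[k1 k12 k2 [phi [M ends]]] _]] := hs.
have [m1 m2 m3] := M; have k12' := ltW k12.
have E1 : iter T f (Some (K i).1) = Some (phi (K i).1) by rewrite m1// lexx.
have into s t : (K i).1 <= s -> t <= (K i).2 -> mono_on (iter T f) s t phi.
  by move=> h1 h2; apply: mono_onS M.
rewrite /letter_sign E1; case: ends => -[e1 e2]; rewrite e1.
- rewrite eqxx.
  have inc s t : (K i).1 <= s -> s < t -> t <= (K i).2 -> phi s < phi t.
    case: m2 => m2; first exact: m2.
    move=> _ _ _; have := m2 _ _ (lexx _) k12 (lexx _); rewrite e1 e2; lra.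
  have ninc s t : (K i).1 <= s -> s <= t -> t <= (K i).2 -> phi s <= phi t.
    by move=> h; rewrite le_eqVlt => /predU1P[->//|lt h']; rewrite ltW// inc.
  have [|l [/andP[l1 l2] le]] := m3 _ _ a (lexx _) k12' (lexx _).
    by rewrite /betw e1 e2; apply/orP; left; lra.
  have [|r [/andP[r1 r2] re]] := m3 _ _ b (lexx _) k12' (lexx _).
    by rewrite /betw e1 e2; apply/orP; left; lra.
  have lr : l < r by rewrite ltNge; apply/negP => rl; have := ninc r l r1 rl l2; lra.
  exists l, r, phi; split=> //; split=> //; first exact: into.
  by move=> t /andP[lt tr]; rewrite -le -re !ninc//; lra.
- rewrite (_ : (Some v == Some u) = false); last by apply/eqP => -[]; lra.
  have dec s t : (K i).1 <= s -> s < t -> t <= (K i).2 -> phi t < phi s.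
    case: m2 => m2; last exact: m2.
    move=> _ _ _; have := m2 _ _ (lexx _) k12 (lexx _); rewrite e1 e2; lra.
  have ndec s t : (K i).1 <= s -> s <= t -> t <= (K i).2 -> phi t <= phi s.
    by move=> h; rewrite le_eqVlt => /predU1P[->//|lt h']; rewrite ltW// dec.
  have [|l [/andP[l1 l2] le]] := m3 _ _ b (lexx _) k12' (lexx _).
    by rewrite /betw e1 e2; apply/orP; right; lra.
  have [|r [/andP[r1 r2] re]] := m3 _ _ a (lexx _) k12' (lexx _).
    by rewrite /betw e1 e2; apply/orP; right; lra.
  have lr : l < r by rewrite ltNge; apply/negP => rl; have := ndec r l r1 rl l2; lra.
  exists l, r, phi; split=> //; split=> //; first exact: into.
  by move=> t /andP[lt tr]; rewrite -le -re !ndec//; lra.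
Qed.

Lemma word_interval (s : seq 'I_N) : exists l r phi,
  [/\ u <= l, l < r, r <= v & s <> [::] -> u < l /\ r < v] /\
  [/\ mono_on (iter (size s * T) f) l r phi,
      if word_sign s then phi l = u /\ phi r = v else phi l = v /\ phi r = u &
      forall t i0 i, l <= t <= r -> (i < size s)%N -> exists w,
        iter (i * T) f (Some t) = Some w /\ (K (nth i0 s i)).1 <= w <= (K (nth i0 s i)).2].
Proof.
have [uv [HK _]] := hs.
elim: s => [|j s [l' [r' [phi' [[ul lr rv _] [M' E' I']]]]]].
  by exists u, v, id; split=> //; split=> //; exact: mono_on_id.
have [l [r [psi [[kl lr' rk] [M into E]]]]] := horseshoe_branch j ul lr rv.
have [k1 k12 k2 _] := HK j.
have [m1 _ _] := M.
exists l, r, (phi' \o psi); split.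
  by split=> // [| |_]; [lra|lra|split; lra].
have comp n : iter (n.+1 * T) f = iter (n * T) f \o iter T f.
  by apply/funext => z; rewrite mulSn addnC iterD.
split.
- rewrite /= comp; exact: mono_on_comp M M' into.
- move: E E'; rewrite /=; case: (letter_sign j); case: (word_sign s) => /= -[-> ->] [-> ->] //.
- move=> t i0 [|i] tI; first by exists t; split=> //=; lra.
  rewrite /= ltnS => is_; have [w [w1 w2]] := I' (psi t) i0 i (into t tI) is_.
  by exists w; rewrite comp /= m1.
Qed.

Hypothesis T_gt0 : (0 < T)%N.

Lemma word_periodic_Julia (s : seq 'I_N) : s <> [::] -> exists x : R,
  [/\ JuliaR p q (Some x), preperiodic f (Some x) &
   forall i0 i, (i < size s)%N -> exists w,
     iter (i * T) f (Some x) = Some w /\ (K (nth i0 s i)).1 <= w <= (K (nth i0 s i)).2].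
Proof.
(* Doubling the word squares its sign, so the branch of [s ++ s] is increasing, as
   [expanding_periodic_Julia] requires. *)
move=> s0; have [l [r [phi [[_ lr _ ne] [M E I]]]]] := word_interval (s ++ s).
have [|ul rv] := ne; first by case: (s) s0.
rewrite word_sign_cat eqxx in E; case: E => el er.
have [x [xI fx xJ]] := expanding_periodic_Julia ul lr rv M el er.
exists x; split=> //.
  exists 0%N, (size (s ++ s) * T)%N; split=> //.
  by rewrite muln_gt0 T_gt0 size_cat addn_gt0 lt0n size_eq0; case: eqP.
move=> i0 i is_; have [|w [w1 w2]] := I x i0 i xI.
  by rewrite size_cat ltn_addr.
by exists w; split=> //; move: w2; rewrite nth_cat is_.
Qed.

Lemma horseshoe_separation : exists d : R, 0 < d /\ forall i j s t, i != j ->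
  (K i).1 <= s <= (K i).2 -> (K j).1 <= t <= (K j).2 -> d < chordR (Some s) (Some t).
Proof.
have [uv [HK dis]] := hs.
suff [eta [eta0 H]] : exists eta : R, 0 < eta /\ forall i j s t, i != j ->
    (K i).1 <= s <= (K i).2 -> (K j).1 <= t <= (K j).2 -> eta <= `|s - t|.
  have [d [d0 Hd]] := chordR_lower u v eta0.
  exists d; split=> // i j s t ij si tj; apply: Hd; last exact: H ij si tj.
    by have [? ? ? _] := HK i; lra.
  by have [? ? ? _] := HK j; lra.
pose gap (ij : 'I_N * 'I_N) : R := Num.max ((K ij.2).1 - (K ij.1).2) ((K ij.1).1 - (K ij.2).2).
pose eta := \big[Num.min/1]_(ij | ij.1 != ij.2) gap ij.
exists eta; split.
  apply: (big_ind (fun x => 0 < x)) => //; first by move=> x y x0 y0; rewrite lt_min x0.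
  by move=> [i j] /= /dis[h|h]; rewrite /gap lt_max !subr_gt0 h ?orbT.
move=> i j s t ij si tj.
have : eta <= gap (i, j) by rewrite /eta; exact: (@bigmin_le_cond _ R _ 1 (i, j) (fun ij => ij.1 != ij.2) gap ij).
move=> /le_trans; apply; rewrite /gap /= ge_max.
by have := ler_norm (s - t); have := ler_norm (t - s); rewrite (distrC t s) => *; apply/andP; split; lra.
Qed.

(** Distinct words differ at some position [i], and at time [i T] their periodic points lie in
    different segments. The gap between segments serves as [d] for every length [r]. *)
Lemma horseshoe_separated (Y : set (rcircle R)) :
  (forall x, JuliaR p q x -> preperiodic f x -> Y x) ->
  exists d : R, 0 < d /\ forall r, (0 < r)%N ->
    exists E, Defs.separated f Y (r * T) d E /\ size E = (N ^ r)%N.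
Proof.
move=> HY; have [d [d0 sep]] := horseshoe_separation.
exists d; split=> // r r0.
have /choice[X HX] : forall w : r.-tuple 'I_N, exists x : R,
    [/\ JuliaR p q (Some x), preperiodic f (Some x) &
     forall i : 'I_r, exists y,
       iter (i * T) f (Some x) = Some y /\ (K (tnth w i)).1 <= y <= (K (tnth w i)).2].
  move=> w; have [|x [xJ xp I]] := @word_periodic_Julia w.
    by move=> w0; move: (size_tuple w) r0; rewrite w0 /= => <-.
  exists x; split=> // i; have [|y [e yI]] := I (tnth w i) i.
    by rewrite size_tuple.
  by exists y; split=> //; rewrite (tnth_nth (tnth w i)).
have dist w w' : w != w' -> exists k : nat, (k < r * T)%N /\
    d < chordR (iter k f (Some (X w))) (iter k f (Some (X w'))).
  move=> ww'; have [i ii] : exists i, tnth w i != tnth w' i.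
    apply: contrapT => /forallNP h; case/eqP: ww'; apply: eq_from_tnth => i.
    by apply/eqP; apply: contrapT => /negP/h.
  exists (i * T)%N; split; first by rewrite ltn_pmul2r.
  have [_ _ /(_ i)[y [-> yI]]] := HX w; have [_ _ /(_ i)[y' [-> y'I]]] := HX w'.
  exact: sep ii yI y'I.
exists [seq Some (X w) | w <- enum {: r.-tuple 'I_N}]; split; last first.
  by rewrite size_map -cardE card_tuple card_ord.
split.
  rewrite map_inj_uniq ?enum_uniq// => w w' [e].
  apply/eqP; apply: contrapT => /negP /dist[k [_]].
  by rewrite e chordRxx; lra.
split.
  by move=> x /mapP[w _ ->]; have [xJ xp _] := HX w; exact: HY.
move=> x y /mapP[w _ ->] /mapP[w' _ ->] ne.
by apply: dist; apply: contra_notN ne => /eqP ->.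
Qed.

Lemma horseshoe_entropy (Y : set (rcircle R)) : (0 < N)%N ->
  (forall x, JuliaR p q x -> preperiodic f x -> Y x) ->
  ((ln N%:R / T%:R)%:E <= top_entropy f Y)%E.
Proof.
move=> N0 /horseshoe_separated[d [d0 H]].
apply: (@le_trans _ _ (limn_esup (fun n => sep_rate f Y n d))); last first.
  by apply: ereal_sup_ubound; exists d.
apply: limn_esup_ge => n; have [E [Esep Esz]] := H n.+1 isT.
exists (n.+1 * T)%N; split; first by rewrite (leq_trans (leqnSn n))// leq_pmulr.
apply: ereal_sup_ubound; exists E => //; congr (_%:E).
have N1 : 1 <= (N ^ n.+1)%:R :> R by rewrite ler1n expn_gt0 N0.
rewrite Esz (max_idPr _)//.
by rewrite natrX lnXn ?ltr0n// natrM -[_ *+ n.+1]mulr_natl -mulf_div divff ?mul1r ?pnatr_eq0.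
Qed.

End HorseshoeEntropy.

(** * Entropy carried by preperiodic points *)

Lemma ln_poly_sublinear (R : realType) (C d : R) (a : nat) : 0 < d ->
  exists n0 : nat, forall n, (n0 <= n)%N -> C + a%:R * ln n.+1%:R <= d * n%:R.
Proof.
(* Used in [ln x <= x / c + ln c]: this [c] makes [a / c] at most [d / 2], and the other half of
   [d n] absorbs the constants. *)
move=> d0; pose c := (a%:R + 1) * 2 / d.
have a0 : 0 <= a%:R :> R by [].
have c0 : 0 < c by rewrite divr_gt0// mulr_gt0//; lra.
pose B := C + a%:R * (c^-1 + ln c).
exists (Num.bound (`|B| * 2 / d)).+1 => n n0n.
have nB : `|B| * 2 / d < n%:R.
  apply: lt_le_trans (archi_boundP _) _; first by rewrite divr_ge0 ?mulr_ge0// ltW.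
  by rewrite ler_nat (leq_trans _ n0n).
have {nB} hB : B <= d / 2 * n%:R.
  move: nB; rewrite ltr_pdivrMr// => nB; have := ler_norm B; lra.
have n1 : 0 < n.+1%:R :> R by [].
have ln1 : ln n.+1%:R <= n.+1%:R / c + ln c.
  have q0 : 0 < n.+1%:R / c by rewrite divr_gt0.
  rewrite -{1}[n.+1%:R](divfK (lt0r_neq0 c0)) lnM ?posrE//.
  by rewrite lerD2r ltW// ln_sublinear.
have h1 : a%:R * ln n.+1%:R <= a%:R * (n.+1%:R / c + ln c) by rewrite ler_wpM2l.
have h2 : a%:R / c <= d / 2.
  by rewrite /c invf_div mulrA ler_pdivrMr; lra.
have h3 : a%:R / c * n%:R <= d / 2 * n%:R by rewrite ler_wpM2r.
have E : a%:R * (n.+1%:R / c + ln c) = a%:R / c * n%:R + a%:R * (c^-1 + ln c).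
  by rewrite -natr1; field; rewrite gt_eqF.
rewrite /B in hB; lra.
Qed.

Section EntropyUpperBound.
Variable R : realType.
Variables p q : {poly R}.
Hypothesis pq_coprime : coprimep p q.
Hypothesis pq_degree : (0 < rdeg p q)%N.

Let f := ratR p q.

Variable lam : R.
Hypothesis lam_gt0 : 0 < lam.
Hypothesis horseshoe_le : forall (T N : nat) (u v : R) (K : 'I_N -> R * R),
  (0 < T)%N -> (0 < N)%N -> horseshoe f T u v K -> ln N%:R / T%:R <= lam.

(** Points with the same initial letter and the same itinerary of length [n %/ k] under [iter k f]
    stay within [e] at all times below [n], so a separated set injects into the words. The constants
    are chosen before [X] and [n]. *)
Lemma separated_size_bound (e : R) : 0 < e -> exists (C : R) (a : nat), 1 <= C /\
  forall (X : set (rcircle R)) n E, Defs.separated f X n e E ->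
    (size E)%:R <= C * (4 * n.+1%:R ^+ 2) ^+ a * expR (lam * n%:R).
Proof.
move=> e0.
(* Large enough for [2 <= rho = exp (lam k)], so that two partial transitions per step of [iter k f]
   stay within the rate [lam]. *)
pose k := (Num.bound (ln 2 / lam)).+1.
have k0 : (0 < k)%N by [].
have klam : ln 2 <= lam * k%:R.
  rewrite mulrC -ler_pdivrMr// ltW//; apply: lt_le_trans (archi_boundP _) _.
    by rewrite divr_ge0 ?ln_ge0 ?ltW//; lra.
  by rewrite ler_nat.
pose rho := expR (lam * k%:R).
have rho2 : 2 <= rho by rewrite -[leLHS]lnK ?posrE// ler_expR.
have rho1 : 1 <= rho by lra.
have [Z HZ] := chordR_net e0.
have [D HD] := iter_mono_partition pq_coprime pq_degree k Z.
have nfull_le (c : letter D) i :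
    (nfull (iter k f) (@rcode R D) c i (cell (@rcode R D) c))%:R <= 3 * rho ^+ i.+1.
  set N := nfull _ _ _ _ _.
  have r1 : 1 <= rho ^+ i.+1 by rewrite exprn_ege1.
  (* A horseshoe exists for [N > 2] and gives [N - 2 <= rho ^ (i + 1)]; the missing 2 is absorbed by
     the factor 3. *)
  have [N2|N2] := leqP N 2.
    have : N%:R <= 2%:R :> R by rewrite ler_nat.
    lra.
  have [u [v [K hs]]] := nfull_horseshoe HD N2.
  have T0 : (0 < k * i.+1)%N by rewrite muln_gt0.
  have N0 : (0 < N - 2)%N by rewrite subn_gt0.
  have := horseshoe_le T0 N0 hs.
  rewrite ler_pdivrMr ?ltr0n// -ler_expR lnK ?posrE ?ltr0n//.
  have -> : expR (lam * (k * i.+1)%:R) = rho ^+ i.+1 by rewrite natrM mulrA expRM_natr.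
  by rewrite natrB ?(ltnW N2)//; lra.
have [a Ha] := nwords_growth (@state_cell R D) (state_step HD) (state_few_partial HD)
  rho2 nfull_le (enum {: letter D}).
exists #|{: letter D}|%:R, a; split.
  by rewrite ler1n; apply/card_gt0P; exists None.
move=> X n E [uE [_ sepE]].
pose M := (n %/ k)%N.
have same x y : rcode D x = rcode D y -> itinerary (iter k f) (rcode D) M x =
    itinerary (iter k f) (rcode D) M y -> forall j, (j < n)%N ->
    chordR (iter j f x) (iter j f y) <= e.
  move=> c0 cM j jn.
  have jM : (j %/ k <= M)%N by rewrite leq_div2r// ltnW.
  set i := (j %/ k)%N in jM; set r := (j %% k)%N.
  (* After [i] steps of [iter k f] both points are in one cell; the remaining [r < k] steps are
     monotone there, with an image that avoids the net [Z]. *)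
  have -> : j = (r + i * k)%N by rewrite addnC -divn_eq.
  rewrite !iterD !iterM.
  have ci : rcode D (iter i (iter k f) x) = rcode D (iter i (iter k f) y).
    case: (i) jM => [|i'] jM //.
    have /(congr1 (fun s => nth None s i')) := cM.
    by rewrite !(nth_map 0%N) ?size_iota// !nth_iota.
  move: ci; set s := iter i _ x; set t := iter i _ y.
  have key (s' t' : R) : s' < t' -> rcode D (Some s') = rcode D (Some t') ->
      chordR (iter r f (Some s')) (iter r f (Some t')) <= e.
    move=> lt ce; have [|phi [[h1 _ _] av]] := HD _ _ (ltW lt) (rcode_avoid lt ce) r.
      by rewrite ltnW// ltn_pmod.
    have lt' := ltW lt; rewrite !h1 ?lexx ?lt'//.
    have [le|/ltW le] := leP (phi s') (phi t').
      apply: HZ le _ => d /av; apply: contra; rewrite /betw => -> //.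
    rewrite chordRC; apply: HZ le _ => d /av; apply: contra; rewrite /betw => ->.
    by rewrite orbT.
  case: s t => [s|] [t|] //; last by rewrite chordRxx ltW.
  have [lt|lt|->] := ltgtP s t; last by rewrite chordRxx ltW.
    exact: key.
  by move=> ce; rewrite chordRC; apply: key.
have inj x y : x \in E -> y \in E -> rcode D x = rcode D y ->
    itinerary (iter k f) (rcode D) M x = itinerary (iter k f) (rcode D) M y -> x = y.
  move=> xE yE c1 c2; apply: contrapT => ne; have [j [jn lt]] := sepE x y xE yE ne.
  by have := same x y c1 c2 j jn; rewrite leNgt lt.
have sz : (size E <= \sum_(b : letter D)
    nwords (iter k f) (rcode D) (enum {: letter D}) M (cell (rcode D) b))%N.
  have -> : size E = (\sum_(b : letter D) count (fun x => rcode D x == b) E)%N.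
    elim: (E) => [|x E' IHE] /=; first by rewrite big1.
    rewrite big_split /= -IHE -add1n; congr (_ + _)%N.
    by rewrite (bigD1 (rcode D x)) //= eqxx big1 // => b; rewrite eq_sym => /negPf ->.
  apply: leq_sum => b _; rewrite -size_filter; apply: size_le_nwords.
    by move=> x; rewrite mem_filter => /andP[/eqP].
  rewrite map_inj_in_uniq ?filter_uniq// => x y.
  rewrite !mem_filter => /andP[/eqP xb xE] /andP[/eqP yb yE] e1.
  by apply: inj => //; rewrite xb.
have Mn : (M <= n)%N by rewrite leq_div.
have rM : rho ^+ M <= expR (lam * n%:R).
  rewrite /rho -expRM_natr ler_expR -mulrA -natrM.
  apply: ler_wpM2l; first exact: ltW.
  by rewrite ler_nat mulnC leq_divM.
move: sz; rewrite -(ler_nat R) natr_sum => /le_trans; apply.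
apply: le_trans (_ : \sum_(b : letter D) ((4 * n.+1%:R ^+ 2) ^+ a * expR (lam * n%:R)) <= _).
  apply: ler_sum => b _; apply: le_trans (Ha n M _ Mn (state_cell b)) _.
  by apply: ler_wpM2l => //; rewrite exprn_ge0// mulr_ge0// exprn_ge0.
by rewrite sumr_const -[_ *+ _]mulr_natl mulrA.
Qed.

Lemma top_entropy_le (X : set (rcircle R)) : (top_entropy f X <= lam%:E)%E.
Proof.
apply: ge_ereal_sup => _ [e e0 <-]; apply/lee_addgt0Pr => d d0.
have [C [a [C1 HC]]] := separated_size_bound e0.
have [n0 Hn0] := ln_poly_sublinear (ln C + a%:R * ln 4) (2 * a)%N d0.
rewrite -EFinD; apply: (@limn_esup_le _ _ _ (maxn n0 1)) => n.
rewrite geq_max => /andP[n0n n1].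
apply: ge_ereal_sup => _ [E /HC sz <-]; rewrite lee_fin.
have nR : 0 < n%:R :> R by rewrite ltr0n.
rewrite ler_pdivrMr//.
have n14 : 1 <= 4 * n.+1%:R ^+ 2 :> R.
  have : 1 <= n.+1%:R ^+ 2 :> R by rewrite exprn_ege1// ler1n.
  lra.
have B1 : 1 <= C * (4 * n.+1%:R ^+ 2) ^+ a by rewrite mulr_ege1// exprn_ege1.
have eE : 1 <= expR (lam * n%:R) by rewrite -expR0 ler_expR mulr_ge0// ltW.
have C0 : 0 < C by lra.
have P0 : 0 < 4 * n.+1%:R ^+ 2 :> R by lra.
apply: le_trans (_ : ln (C * (4 * n.+1%:R ^+ 2) ^+ a * expR (lam * n%:R)) <= _).
  rewrite ler_ln ?posrE ?lt_max ?ltr01//; last by rewrite mulr_gt0 ?expR_gt0//; lra.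
  by rewrite ge_max sz andbT mulr_ege1.
rewrite lnM ?posrE ?expR_gt0//; last lra.
rewrite expRK lnM ?posrE ?exprn_gt0// lnXn// lnM ?posrE ?exprn_gt0// lnXn//.
set L := ln n.+1%:R.
have -> : (ln 4 + L *+ 2) *+ a = a%:R * ln 4 + (2 * a)%:R * L.
  by rewrite natrM -[_ *+ a]mulr_natl -[L *+ 2]mulr_natl mulrDr mulrA [a%:R * 2]mulrC.
have small : ln C + a%:R * ln 4 + (2 * a)%:R * L <= d * n%:R := Hn0 n n0n.
by rewrite mulrDl [leLHS]addrC lerD2l addrA.
Qed.

End EntropyUpperBound.

Lemma top_entropy_mono (R : realType) (g : rcircle R -> rcircle R) (Y X : set (rcircle R)) :
  Y `<=` X -> (top_entropy g Y <= top_entropy g X)%E.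
Proof.
move=> YX; apply: ge_ereal_sup => _ [e e0 <-].
apply: (@le_trans _ _ (limn_esup (fun n => sep_rate g X n e))); last first.
  by apply: ereal_sup_ubound; exists e.
have rate n : (sep_rate g Y n e <= sep_rate g X n e)%E.
  apply: ereal_sup_le => _ [E [u [EY s]] <-]; exists E => //.
  by split=> //; split=> // x /EY /YX.
rewrite !limn_esup_lim; apply: lee_lim; [exact: is_cvg_esups..|].
apply: nearW => n; apply: ge_ereal_sup => _ [m nm <-].
by apply: le_trans (rate m) _; apply: ereal_sup_ubound; exists m.
Qed.

Lemma top_entropy_ge0 (R : realType) (g : rcircle R -> rcircle R) (Y : set (rcircle R)) :
  (0 <= top_entropy g Y)%E.
Proof.
apply: (@le_trans _ _ (limn_esup (fun n => sep_rate g Y n 1))); last first.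
  by apply: ereal_sup_ubound; exists 1 => //=; exact: ltr01.
apply: limn_esup_ge => n; exists n; split=> //.
apply: ereal_sup_ubound; exists [::]; first by split.
by rewrite /= max_l ?ler01// ln1 mul0r.
Qed.

Section PreperiodicSubsystem.
Variable R : realType.
Variables p q : {poly R}.
Hypothesis pq_coprime : coprimep p q.
Hypothesis pq_degree : (0 < rdeg p q)%N.

Let f := ratR p q.
Let Y := closureR (JuliaR p q `&` preperiodic f).

Lemma preperiodic_subset_closure : JuliaR p q `&` preperiodic f `<=` Y.
Proof. by move=> x Px e e0; exists x; rewrite chordRxx. Qed.

Lemma closedR_closureR (S : set (rcircle R)) : closedR (closureR S).
Proof.
move=> x h e e0; have e2 : 0 < e / 2 by lra.
have [y [hy xy]] := h _ e2; have [z [Sz yz]] := hy _ e2.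
exists z; split=> //; have := chordR_triangle y x z; lra.
Qed.

Lemma preperiodic_subsystem : subsystem (JuliaR p q) f Y.
Proof.
split.
  move=> x xY; apply: (@closedR_JuliaR _ p q x) => e e0.
  by have [y [[yJ _] xy]] := xY e e0; exists y.
move=> y yY e e0; have [d [d0 h]] := rcont_ratR pq_coprime pq_degree y e0.
have [z [[zJ [m [n [n0 mn]]]] yz]] := yY d d0.
exists (f z); split; last exact: h.
split; first exact: JuliaR_forward.
exists m, n; split=> //.
by rewrite -!iterSr !iterS mn.
Qed.

(** A finite entropy [h] of [Y] bounds the growth of every horseshoe, so [top_entropy_le] applies
    with [lam = h + d] for each [d > 0]. *)
Lemma preperiodic_entropy : top_entropy f Y = top_entropy f (JuliaR p q).
Proof.
apply/eqP; rewrite eq_le top_entropy_mono /=; last by case: preperiodic_subsystem.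
have := top_entropy_ge0 f Y.
case E : (top_entropy f Y) => [h| |] // h0; last by rewrite leey.
apply/lee_addgt0Pr => d d0; rewrite -EFinD; apply: top_entropy_le => //.
  by rewrite lee_fin in h0; lra.
move=> T N u v K T0 N0 hs.
have := horseshoe_entropy pq_coprime pq_degree hs T0 (Y := Y) N0.
rewrite -/f E lee_fin => H; apply: le_trans (H _) _; last lra.
by move=> x xJ xp; apply: preperiodic_subset_closure.
Qed.

Theorem preperiodic_full_entropy : exists Y : set (rcircle R),
  closedR Y /\ subsystem (JuliaR p q) f Y /\
  top_entropy f Y = top_entropy f (JuliaR p q) /\
  Y `<=` closureR (Y `&` preperiodic f).
Proof.
exists Y; split; first exact: closedR_closureR.
split; first exact: preperiodic_subsystem.
split; first exact: preperiodic_entropy.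
move=> y yY e /yY[z [Pz yz]]; exists z; split=> //.
by split; [exact: preperiodic_subset_closure|case: Pz].
Qed.

End PreperiodicSubsystem.

(** * Connected subsets of the circle *)

Section CircleConnectedness.
Variable R : realType.
Implicit Types (S C U V : set (rcircle R)) (x y z : rcircle R) (a b s t : R).

Lemma openR_preimage g U : rcont g -> openR U -> openR (g @^-1` U).
Proof.
move=> gc Uo x /Uo[e [e0 h]]; have [d [d0 hd]] := gc x e e0.
by exists d; split=> // y /hd /h.
Qed.

Lemma connectedR_image g S : rcont g -> connectedR S -> connectedR (g @` S).
Proof.
move=> gc Sc U V Uo Vo cov dis.
have [||||h|h] := Sc (g @^-1` U) (g @^-1` V).
- exact: openR_preimage.
- exact: openR_preimage.
- by move=> x Sx; apply: cov; exists x.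
- apply/seteqP; split=> // x [[Sx Ux] Vx].
  by have : set0 (g x) by rewrite -dis; split=> //; split=> //; exists x.
- left; apply/seteqP; split=> // _ [[x Sx <-] Ux].
  by have : set0 x by rewrite -h.
- right; apply/seteqP; split=> // _ [[x Sx <-] Ux].
  by have : set0 x by rewrite -h.
Qed.

Lemma connectedR_bigcup (F : set (set (rcircle R))) x :
  (forall C, F C -> connectedR C /\ C x) -> connectedR (\bigcup_(C in F) C).
Proof.
move=> HF U V Uo Vo cov dis.
have part C : F C -> C `&` U = set0 \/ C `&` V = set0.
  move=> FC; have [Cc _] := HF C FC; apply: Cc => //.
    by move=> y Cy; apply: cov; exists C.
  apply/seteqP; split=> // y [[Cy Uy] Vy].
  by rewrite -dis; split=> //; split=> //; exists C.
have [[C0 FC0]|nF] := pselect (exists C, F C); last first.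
  by left; apply/seteqP; split=> // y [[C FC]]; case: nF; exists C.
have [_ C0x] := HF _ FC0.
have [Ux|Vx] := cov x (ex_intro2 _ _ C0 FC0 C0x); [right|left].
  apply/seteqP; split=> // y [[C FC Cy] Vy]; have [_ Cx] := HF C FC.
  by case: (part C FC) => e; [have : set0 x by rewrite -e|rewrite -e].
apply/seteqP; split=> // y [[C FC Cy] Uy]; have [_ Cx] := HF C FC.
by case: (part C FC) => e; [rewrite -e|have : set0 x by rewrite -e].
Qed.

Lemma connectedR_closure S : connectedR S -> connectedR (closureR S).
Proof.
move=> Sc U V Uo Vo cov dis.
have sub : S `<=` closureR S by move=> x Sx e e0; exists x; rewrite chordRxx.
have clos (W : set (rcircle R)) : openR W -> S `&` W = set0 -> closureR S `&` W = set0.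
  move=> Wo h; apply/seteqP; split=> // x [xS /Wo[e [e0 He]]].
  have [y [Sy /He Wy]] := xS e e0.
  by have : set0 y by rewrite -h.
have [||h|h] := Sc U V Uo Vo.
- by move=> x /sub /cov.
- by apply/seteqP; split=> // x [[/sub xS xU] xV]; rewrite -dis.
- by left; exact: clos.
- by right; exact: clos.
Qed.

Lemma connectedR_set1 x : connectedR [set x].
Proof.
move=> U V _ _ cov dis; have [Ux|Vx] := cov x erefl; [right|left].
  by apply/seteqP; split=> // y [yx h]; rewrite -dis; split=> //; rewrite yx.
by apply/seteqP; split=> // y [yx h]; rewrite -dis; split=> //; rewrite yx.
Qed.

Lemma openR_ray_lt a : openR [set x | exists2 t, x = Some t & t < a].
Proof.
move=> _ [t -> ta]; have d0 : 0 < a - t by lra.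
have [r [r0 h]] := chordR_near_Some t d0; exists r; split=> // y /h[b [-> hb]].
by exists b => //; move: hb; rewrite ltr_norml; lra.
Qed.

Lemma openR_ray_gt a : openR [set x | exists2 t, x = Some t & a < t].
Proof.
move=> _ [t -> ta]; have d0 : 0 < t - a by lra.
have [r [r0 h]] := chordR_near_Some t d0; exists r; split=> // y /h[b [-> hb]].
by exists b => //; move: hb; rewrite ltr_norml; lra.
Qed.

Lemma openRI U V : openR U -> openR V -> openR (U `&` V).
Proof.
move=> Uo Vo x [/Uo[d [d0 hd]] /Vo[e [e0 he]]].
exists (Num.min d e); split; first by rewrite lt_min d0.
by move=> y; rewrite lt_min => /andP[/hd ? /he].
Qed.

Lemma openR_segmentC a b : openR [set x | forall t, x = Some t -> t < a \/ b < t].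
Proof.
case=> [t|] /= h.
  case: (h t erefl) => ht.
    have [e [e0 he]] := @openR_ray_lt a (Some t) (ex_intro2 _ _ t erefl ht).
    by exists e; split=> // y /he[s -> sa] _ [<-]; left.
  have [e [e0 he]] := @openR_ray_gt b (Some t) (ex_intro2 _ _ t erefl ht).
  by exists e; split=> // y /he[s -> sa] _ [<-]; right.
have [r [r0 hr]] := chordR_near_None (Num.max `|a| `|b|).
exists r; split=> // y yr t yt; rewrite yt in yr; move: (hr t yr).
rewrite gt_max => /andP[h1 h2]; have [t0|t0] := leP 0 t.
  by right; rewrite (ger0_norm t0) in h2; have := ler_norm b; lra.
by left; rewrite (ltr0_norm t0) in h1; have := ler_norm (- a); rewrite normrN; lra.
Qed.

Lemma connectedR_circle_interval S : connectedR S -> circle_interval S.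
Proof.
move=> Sc; case: (pselect (S None)) => SN; [right|left]; split=> // x y z xy yz Sx Sz.
- move=> Sy.
  have xy' : x < y by rewrite lt_neqAle xy andbT; apply/eqP => e; apply: Sx; rewrite e.
  have yz' : y < z by rewrite lt_neqAle yz andbT; apply/eqP => e; apply: Sz; rewrite -e.
  (* The open segment between the two missing points separates [y] from infinity. *)
  pose U := [set w | exists2 t, w = Some t & x < t] `&` [set w | exists2 t, w = Some t & t < z].
  have [||||h|h] := Sc U [set w | forall t, w = Some t -> t < x \/ z < t].
  + by apply: openRI; [exact: openR_ray_gt|exact: openR_ray_lt].
  + exact: openR_segmentC.
  + case=> [t|] St; last by right.
    have [tx|xt|e] := ltgtP t x; last by case: Sx; rewrite /= -e.
      by right=> _ [<-]; left.
    have [tz|zt|e] := ltgtP t z; last by case: Sz; rewrite /= -e.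
      by left; split; exists t.
    by right=> _ [<-]; right.
  + apply/seteqP; split=> // w [[_ [[t -> xt] [_ [<-] tz]]] /(_ t erefl)]; lra.
  + suff : set0 (Some y) by [].
    by rewrite -h; split=> //; split; exists y.
  + suff : set0 (None : rcircle R) by [].
    by rewrite -h; split.
- apply: contrapT => Sy.
  have xy' : x < y by rewrite lt_neqAle xy andbT; apply/eqP => e; apply: Sy; rewrite -e.
  have yz' : y < z by rewrite lt_neqAle yz andbT; apply/eqP => e; apply: Sy; rewrite e.
  have [||||h|h] := Sc [set w | exists2 t, w = Some t & t < y] [set w | exists2 t, w = Some t & y < t].
  + exact: openR_ray_lt.
  + exact: openR_ray_gt.
  + case=> [t|] St //.
    have [ty|yt|e] := ltgtP t y; last by case: Sy; rewrite /= -e.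
      by left; exists t.
    by right; exists t.
  + by apply/seteqP; split=> // w [[_ [t -> ty]] [_ [<-]]]; lra.
  + suff : set0 (Some x) by [].
    by rewrite -h; split=> //; exists x.
  + suff : set0 (Some z) by [].
    by rewrite -h; split=> //; exists z.
Qed.

Definition rarc a b : set (rcircle R) := [set x | exists2 t, x = Some t & a < t < b].

Lemma circle_interval_arc S x y : circle_interval S -> x <> y -> S x -> S y ->
  exists a b, a < b /\ rarc a b `<=` S.
Proof.
move=> [[SN Sv]|[SN Sv]] xy Sx Sy.
  have key s t : s < t -> S (Some s) -> S (Some t) -> exists a b, a < b /\ rarc a b `<=` S.
    move=> st Ss St; exists s, t; split=> // _ [w -> /andP[sw wt]].
    exact: Sv (ltW sw) (ltW wt) Ss St.
  case: x y Sx Sy xy => [s|] [t|] // Ss St st.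
  have [lt|lt|e] := ltgtP s t; last by case: st; rewrite e.
    exact: key lt Ss St.
  exact: key lt St Ss.
have [t St] : exists t, S (Some t) by case: x y Sx Sy xy => [s|] [t|] //; [exists s|exists s|exists t].
(* The missing reals form an interval without [t], so they all lie on one side of [t], and [S]
   contains the other side. *)
have [[w [wt Sw]]|h] := pselect (exists w, w < t /\ ~ S (Some w)).
  exists t, (t + 1); split; first lra.
  move=> _ [s -> /andP[ts _]]; apply: contrapT => Ss.
  exact: (Sv w t s (ltW wt) (ltW ts) Sw Ss).
exists (t - 1), t; split; first lra.
move=> _ [s -> /andP[_ st]]; apply: contrapT => Ss; apply: h; by exists s.
Qed.

Lemma connectedR_segment a b : connectedR [set x | exists2 t, x = Some t & a <= t <= b].
Proof.
move=> U V Uo Vo cov dis.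
have op (W : set (rcircle R)) : openR W -> open (Some @^-1` W : set R).
  move=> Wo; rewrite openE => t /Wo[e [e0 he]].
  apply/nbhs_ballP; exists (e / 2) => /=; first by rewrite divr_gt0.
  move=> s; rewrite /ball /= => ts; apply: he; apply: le_lt_trans (chordR_le _ _) _; lra.
have [[t0 [t0I Ut0]]|nU] := pselect (exists t, a <= t <= b /\ U (Some t)); last first.
  by left; apply/seteqP; split=> // _ [[t -> tI] Ut]; case: nU; exists t.
right; apply/seteqP; split=> // _ [[t -> tI] Vt].
have /(_ (`[a, b] `&` Some @^-1` U)) E := @segment_connected R a b.
have : (`[a, b] `&` Some @^-1` U) t.
  rewrite E.
  - by rewrite /= in_itv.
  - by exists t0; split=> //=; rewrite in_itv.
  - by exists (Some @^-1` U) => //; exact: op.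
  - exists (~` (Some @^-1` V)); first by rewrite closedC; exact: op.
    apply/seteqP; split=> s [sI h]; split=> //; rewrite /= in_itv /= in sI.
      by move=> Vs; have : set0 (Some s) by rewrite -dis; split=> //; split=> //; exists s.
    by have : (U `|` V) (Some s) by [apply: cov; exists s]; case.
move=> [_ Ut]; rewrite -dis; split=> //; split=> //; by exists t.
Qed.

End CircleConnectedness.

(** * Arcs of periodic points *)

Lemma interval_avoid (R : realType) (Z : seq R) (a b : R) : a < b ->
  exists a' b', [/\ a <= a', a' < b', b' <= b & forall t, a' < t < b' -> t \notin Z].
Proof.
move=> ab; elim: Z => [|z Z [a' [b' [aa a'b' bb h]]]]; first by exists a, b.
have [/andP[az zb]|nz] := boolP (a' < z < b').
  exists a', z; split=> //; first lra.
  move=> t /andP[at' tz]; rewrite inE negb_or (lt_eqF tz) /=; apply: h.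
  by rewrite at' (lt_trans tz).
exists a', b'; split=> // t tI; rewrite inE negb_or h// andbT.
by apply: contraNneq nz => <-.
Qed.

Lemma infinitely_often_residue (m : nat -> nat) (N : nat) : (0 < N)%N ->
  exists r, forall K, exists k, (K <= k)%N /\ (m k %% N)%N = r.
Proof.
move=> N0; apply: contrapT => /forallNP h.
have /choice[K HK] : forall r, exists K, forall k, (K <= k)%N -> (m k %% N)%N <> r.
  move=> r; have /existsNP[K HK] := h r; exists K => k Kk e.
  by apply: HK; exists k.
pose k := (\max_(r < N) K r)%N.
have := HK (m k %% N)%N k; apply=> //.
exact: (@leq_bigmax 'I_N (fun r => K r) (Ordinal (ltn_pmod (m k) N0))).
Qed.

Section PeriodicArc.
Variable R : realType.
Variables p q : {poly R}.

Let f := ratR p q.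
Let d := rdeg p q.

(* Numerators and denominators of the iterates, by homogeneous substitution. *)
Definition hsubst (s A B : {poly R}) : {poly R} :=
  \sum_(i < d.+1) s`_i *: (A ^+ i * B ^+ (d - i)).

Fixpoint numden (n : nat) : {poly R} * {poly R} :=
  if n is n'.+1 then
    (hsubst p (numden n').1 (numden n').2, hsubst q (numden n').1 (numden n').2)
  else ('X, 1).

Let C := map_poly (real_complex R).

Lemma hsubst_horner (s A B : {poly R}) (z : R[i]) : (size s <= d.+1)%N -> (C B).[z] != 0 ->
  (C (hsubst s A B)).[z] = (C B).[z] ^+ d * (C s).[(C A).[z] / (C B).[z]].
Proof.
move=> ss Bz; have sC : (size (C s) <= d.+1)%N by rewrite size_map_poly.
rewrite (horner_coef_wide _ sC) mulr_sumr /C /hsubst rmorph_sum /= horner_sum.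
apply: eq_bigr => i _; rewrite map_polyZ rmorphM !rmorphXn /= !hornerE coef_map /=.
have id : (i <= d)%N by rewrite -ltnS.
rewrite exprMn exprVn; set b := (_ B).[z] in Bz *; set a := (_ A).[z].
have -> : b ^+ d = b ^+ i * b ^+ (d - i) by rewrite -exprD subnKC.
by field; rewrite expf_neq0.
Qed.

Lemma iter_ratC_numden n (z : R[i]) :
  (forall i, (i <= n)%N -> (C (numden i).2).[z] != 0) ->
  iter n (ratC p q) (Some z) = Some ((C (numden n).1).[z] / (C (numden n).2).[z]).
Proof.
have [sp sq] := size_le_rdeg p q.
elim: n => [|n IH] h.
  by rewrite /= /C map_polyX rmorph1 !hornerE divr1.
rewrite iterS IH; last by move=> i ile; apply: h; exact: leqW.
have hn := h n (leqnSn n); have := h n.+1 (leqnn _).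
rewrite /= -/C !hsubst_horner// mulf_eq0 negb_or => /andP[bd qz].
by rewrite (negPf qz) -mulf_div divff// mul1r.
Qed.

(** Each new denominator is a power of the old one times [q] at the current orbit point, and [q]
    vanishes there only if the next point is infinity. *)
Lemma numden_real n (s : R) : (forall i, (i <= n)%N -> iter i f (Some s) <> None) ->
  forall i, (i <= n)%N -> (C (numden i).2).[(s%:C)%C] != 0.
Proof.
have [sp sq] := size_le_rdeg p q.
move=> h i; elim/ltn_ind: i => -[|i] IH ile.
  by rewrite /= /C rmorph1 hornerE oner_eq0.
have hi := IH i (ltnSn i) (ltnW ile).
rewrite /= hsubst_horner// mulf_neq0 ?expf_neq0//.
have := iter_ratC_embR p q i.+1 (Some s).
rewrite iterS iter_ratC_numden; last first.
  by move=> j ji; apply: IH; [rewrite ltnS|exact: leq_trans ji (ltnW ile)].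
apply: contra_eqN => /eqP e; rewrite /= -/C e eqxx.
by have := h i.+1 ile; rewrite /f /=; case: ratR.
Qed.

(** A polynomial identity that holds on an arc holds identically, so iterate [N] is the identity on
    a complex disc around [t]. There an iterate depends only on its index modulo [N], and a
    subsequence in one residue class is constant. *)
Lemma periodic_arc_not_Julia (N : nat) (a b : R) : (0 < N)%N -> a < b ->
  (forall t, a < t < b -> JuliaR p q (Some t)) ->
  (forall t i, a < t < b -> iter i f (Some t) <> None) ->
  (forall t, a < t < b -> iter N f (Some t) = Some t) -> False.
Proof.
move=> N0 ab Jab fin fix_.
have den t i : a < t < b -> (C (numden i).2).[(t%:C)%C] != 0.
  by move=> tI; apply: (@numden_real i) => // j _; exact: fin.
have E : (numden N).1 = 'X * (numden N).2.
  apply/eqP; rewrite -subr_eq0; apply/negP => /negP /finite_roots[Z HZ].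
  have [a' [b' [aa a'b' bb av]]] := interval_avoid Z ab.
  pose t := (a' + b') / 2; have tI' : a' < t < b' by apply/andP; split; rewrite /t; lra.
  have tI : a < t < b by lra.
  move: (av t tI'); rewrite HZ// !hornerE.
  have := iter_ratC_embR p q N (Some t); rewrite -/f fix_//= iter_ratC_numden//; last first.
    by move=> i _; exact: den.
  move=> -[/(canRL (divfK (den t N tI)))].
  by rewrite /C !horner_map -rmorphM /= => /complexI ->; rewrite subrr.
pose t := (a + b) / 2; have tI : a < t < b by apply/andP; split; rewrite /t; lra.
apply: (Jab t tI).
have [r [r0 near]] : exists r : R, 0 < r /\ forall z : R[i], cabs (z - (t%:C)%C) < r ->
    forall i, (i <= N)%N -> (C (numden i).2).[z] != 0.
  elim: N {N0 fix_ E} => [|n [r [r0 h]]].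
    exists 1; split=> // z _ i; rewrite leqn0 => /eqP ->.
    by rewrite /= /C rmorph1 hornerE oner_eq0.
  have c0 := cabs_gt0 (den t n.+1 tI).
  have [r' [r'0 h']] := horner_cabs_continuous (C (numden n.+1).2) (t%:C)%C c0.
  exists (Num.min r r'); split; first by rewrite lt_min r0.
  move=> z; rewrite lt_min => /andP[zr zr'] i; rewrite leq_eqVlt => /predU1P[->|]; last first.
    by rewrite ltnS; exact: h.
  have := h' z zr'; apply: contraTneq => ->.
  by rewrite sub0r cabsN -leNgt.
have fixC z : cabs (z - (t%:C)%C) < r -> iter N (ratC p q) (Some z) = Some z.
  move=> /near h; rewrite iter_ratC_numden//; congr Some.
  by rewrite E /C rmorphM /= map_polyX hornerM hornerX mulfK// h.
have [e [e0 he]] := chordal_near_Some (t%:C)%C r0.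
exists e; split=> // m.
have [res io] := infinitely_often_residue m N0.
have [phi [phiS Hphi]] := subseq_of_infinitely_often io.
exists phi, (iter res (ratC p q)); split=> // w _; exists 1; split=> // eps eps0.
exists 0%N => k _ v /he[z [-> zr]] _.
have fixk j : iter (j * N) (ratC p q) (Some z) = Some z.
  by elim: j => // j IH; rewrite mulSn iterD IH fixC.
by rewrite (divn_eq (m (phi k)) N) Hphi addnC iterD fixk chordalxx.
Qed.

End PeriodicArc.

(** * Components of the nonwandering set *)

Section NonwanderingSet.
Variable R : realType.
Variables p q : {poly R}.
Hypothesis pq_coprime : coprimep p q.
Hypothesis pq_degree : (0 < rdeg p q)%N.

Let f := ratR p q.
Let X := JuliaR p q.
Let Om := nonwandering X f.
Implicit Types (x y z c : rcircle R) (C : set (rcircle R)).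

Let f_cont : rcont f := rcont_ratR pq_coprime pq_degree.

Lemma nonwandering_closed : closedR Om.
Proof.
move=> x xO; split.
  apply: (@closedR_JuliaR _ p q x) => e e0; have [y [[yX _] xy]] := xO e e0.
  by exists y.
move=> e e0; have e2 : 0 < e / 2 by lra.
have [y [[_ /(_ _ e2)[n [n0 [z [zX [yz yn]]]]]] xy]] := xO _ e2.
exists n; split=> //; exists z; split=> //.
by have := chordR_triangle y x z; have := chordR_triangle y x (iter n f z); lra.
Qed.

Lemma nonwandering_forward x : Om x -> Om (f x).
Proof.
move=> [xX h]; split; first exact: JuliaR_forward.
move=> e e0; have [d [d0 hd]] := f_cont x e0.
have [n [n0 [z [zX [xz xn]]]]] := h d d0.
exists n; split=> //; exists (f z); split; first exact: JuliaR_forward.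
by split; [exact: hd|rewrite -iterSr iterS; exact: hd].
Qed.

Lemma nonwandering_iter n x : Om x -> Om (iter n f x).
Proof. by move=> Ox; elim: n => // n; exact: nonwandering_forward. Qed.

(** Empty for [x] outside [Om], since each [C] in the union lies in [Om] and contains [x]. *)
Definition ccomp x : set (rcircle R) :=
  \bigcup_(C in [set C | [/\ connectedR C, C `<=` Om & C x]]) C.

Definition nondeg_set C := exists y z, [/\ y <> z, C y & C z].

Lemma ccomp_connected x : connectedR (ccomp x).
Proof. by apply: (@connectedR_bigcup _ _ x) => C []. Qed.

Lemma ccomp_sub x : ccomp x `<=` Om.
Proof. by move=> y [C [_ h _] /h]. Qed.

Lemma ccomp_refl x : Om x -> ccomp x x.
Proof.
move=> Ox; exists [set x] => //; split=> //; first exact: connectedR_set1.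
by move=> _ ->.
Qed.

Lemma ccomp_max x y C : connectedR C -> C `<=` Om -> C y -> ccomp x y -> C `<=` ccomp x.
Proof.
move=> Cc CO Cy xy z Cz; have [C' [C'c C'O C'x] C'y] := xy.
exists (C `|` C'); last by left.
split; [|by move=> w [/CO|/C'O]|by right].
have -> : C `|` C' = \bigcup_(D in [set D | D = C \/ D = C']) D.
  apply/seteqP; split=> [w [Cw|Cw]|w [D [->|->] Dw]]; [exists C|exists C'|left|right] => //.
  - by left.
  - by right.
by apply: (@connectedR_bigcup _ _ y) => D [->|->].
Qed.

Lemma ccomp_eq x y : ccomp x y -> ccomp y = ccomp x.
Proof.
move=> xy; have Oy := ccomp_sub xy; have [C [Cc CO Cx] Cy] := xy.
apply/seteqP; split.
  exact: ccomp_max (@ccomp_connected y) (@ccomp_sub y) (ccomp_refl Oy) xy.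
apply: ccomp_max (@ccomp_connected x) (@ccomp_sub x) xy (ccomp_refl Oy).
Qed.

Lemma ccomp_image n x : iter n f @` ccomp x `<=` ccomp (iter n f x).
Proof.
move=> _ [y xy <-]; have [C [Cc CO Cx] Cy] := xy.
exists (iter n f @` C); last by exists y.
split; last by exists x.
  by apply: connectedR_image => //; exact: rcont_iter.
by move=> _ [z /CO Oz <-]; exact: nonwandering_iter.
Qed.

Lemma ccomp_iter_eq n x y : ccomp x y -> ccomp (iter n f y) = ccomp (iter n f x).
Proof. by move=> xy; apply: ccomp_eq; apply: ccomp_image; exists y. Qed.

Lemma ccomp_closed x : Om x -> closedR (ccomp x).
Proof.
move=> Ox y yC.
have sub : ccomp x `<=` closureR (ccomp x) by move=> z Cz e e0; exists z; rewrite chordRxx.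
exists (closureR (ccomp x)) => //; split; last exact/sub/ccomp_refl.
  exact: connectedR_closure (@ccomp_connected x).
move=> z zC; apply: nonwandering_closed => e /zC[w [/ccomp_sub Ow zw]].
by exists w.
Qed.

Lemma ccomp_arc x : nondeg_set (ccomp x) -> exists a b, a < b /\ rarc a b `<=` ccomp x.
Proof.
move=> [y [z [yz Cy Cz]]].
exact: circle_interval_arc (connectedR_circle_interval (@ccomp_connected x)) yz Cy Cz.
Qed.

Lemma arc_comp_nondegenerate (a b t : R) : rarc a b `<=` Om -> a < t < b ->
  nondeg_set (ccomp (Some t)).
Proof.
move=> h /andP[at' tb].
have sub : [set x | exists2 s, x = Some s & (a + t) / 2 <= s <= t] `<=` ccomp (Some t).
  have Ot : Om (Some t) by apply: h; exists t => //; rewrite at'.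
  apply: ccomp_max (ccomp_refl Ot); first exact: connectedR_segment.
    by move=> _ [s -> sI]; apply: h; exists s => //; lra.
  by exists t => //; lra.
exists (Some ((a + t) / 2)), (Some t); split; first by case; lra.
  by apply: sub; eexists => //; lra.
by apply: sub; eexists => //; lra.
Qed.

(* [f] is finite-to-one, so it cannot collapse an arc to a point. *)
Lemma nondegenerate_image C : connectedR C -> nondeg_set C -> nondeg_set (f @` C).
Proof.
move=> Cc [y [z [yz Cy Cz]]].
have [a [b [ab abC]]] := circle_interval_arc (connectedR_circle_interval Cc) yz Cy Cz.
have [Z HZ] := ratR_mono_on pq_coprime pq_degree.
have [a' [b' [aa a'b' bb av]]] := interval_avoid Z ab.
pose s := (2 * a' + b') / 3; pose t := (a' + 2 * b') / 3.
have as' : a' < s by rewrite /s; lra.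
have st : s < t by rewrite /s /t; lra.
have tb : t < b' by rewrite /t; lra.
have [|m1 m2 _] := HZ s t.
  move=> d dZ; apply: contraL (dZ) => /andP[sd dt]; apply: av; lra.
exists (f (Some s)), (f (Some t)); split.
- have st' := ltW st; rewrite /f !m1 ?lexx ?st'// => -[].
  by case: m2 => /(_ s t (lexx s) st (lexx t)); lra.
- by exists (Some s) => //; apply: abC; exists s => //; lra.
- by exists (Some t) => //; apply: abC; exists t => //; lra.
Qed.

Lemma nondegenerateS C C' : C `<=` C' -> nondeg_set C -> nondeg_set C'.
Proof. by move=> CC [y [z [yz /CC Cy /CC Cz]]]; exists y, z. Qed.

Lemma ccomp_iter_nondegenerate n x : nondeg_set (ccomp x) -> nondeg_set (ccomp (iter n f x)).
Proof.
elim: n => // n IH /IH nd.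
apply: nondegenerateS (nondegenerate_image (@ccomp_connected _) nd).
exact: (@ccomp_image 1).
Qed.

Lemma arc_return (a b : R) : a < b -> rarc a b `<=` Om ->
  exists n t, [/\ (0 < n)%N, a < t < b & rarc a b (iter n f (Some t))].
Proof.
move=> ab h; pose t := (a + b) / 2.
have tI : a < t < b by apply/andP; split; rewrite /t; lra.
have d0 : 0 < (b - a) / 2 by lra.
have [r [r0 near]] := chordR_near_Some t d0.
have [_ /(_ r r0)[n [n0 [y [_ [/near[s [ys st]] /near[w [yw wt]]]]]]]] : Om (Some t).
  by apply: h; exists t.
exists n, s; split=> //.
  by move: st; rewrite ltr_norml /t; lra.
by rewrite -ys yw; exists w => //; move: wt; rewrite ltr_norml /t; lra.
Qed.

(** Around a returning point [t], a subarc is chosen so small that iterate [n] keeps it inside the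
    arc. The visits to the subarc given by induction, followed by [n] further steps from the last
    one, provide one visit more. *)
Lemma arc_returns k (a b : R) : a < b -> rarc a b `<=` Om ->
  exists y (s : nat -> nat), (forall i, (i < k)%N -> (s i < s i.+1)%N) /\
    forall i, (i <= k)%N -> rarc a b (iter (s i) f y).
Proof.
elim: k a b => [|k IH] a b ab h.
  exists (Some ((a + b) / 2)), (fun=> 0%N); split=> // i _.
  by exists ((a + b) / 2) => //; apply/andP; split; lra.
have [n [t [n0 tI [t' e t'I]]]] := arc_return ab h.
have e0 : 0 < Num.min (t' - a) (b - t') by rewrite lt_min; apply/andP; split; lra.
have [r [r0 near]] := chordR_near_Some t' e0.
have [d [d0 hd]] := rcont_iter n f_cont (Some t) r0.
pose a' := Num.max a (t - d / 4); pose b' := Num.min b (t + d / 4).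
have a1 : a <= a' by rewrite le_max lexx.
have b1 : b' <= b by rewrite ge_min lexx.
have a2 : t - d / 4 <= a' by rewrite le_max lexx orbT.
have b2 : b' <= t + d / 4 by rewrite ge_min lexx orbT.
have at' : a' < t by rewrite gt_max; apply/andP; split; lra.
have tb' : t < b' by rewrite lt_min; apply/andP; split; lra.
have [|y [s [s1 s2]]] := IH a' b' (lt_trans at' tb').
  by move=> _ [w -> wI]; apply: h; exists w => //; lra.
exists y, (fun i => if (i <= k)%N then s i else s k + n)%N; split=> i ik.
  have [ik'|ki] := ltnP i k; first by rewrite (ltnW ik') s1.
  have -> : i = k by apply/eqP; rewrite eqn_leq ki -ltnS ik.
  by rewrite leqnn -[X in (X < _)%N]addn0 ltn_add2l.
case: ifP => [|_].
  by move=> /s2[w -> wI]; exists w => //; lra.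
have [w ew wI] := s2 k (leqnn k).
rewrite addnC iterD ew.
have /hd : chordR (Some t) (Some w) < d.
  apply: le_lt_trans (chordR_le _ _) _.
  suff : `|t - w| <= d / 4 by lra.
  by rewrite ler_norml; lra.
rewrite e => /near[w' [-> ]]; rewrite lt_min !ltr_norml => /andP[? ?].
by exists w' => //; lra.
Qed.

(** Among [N + 1] visit times two agree modulo [N]; from the earlier visit, the return time to the
    later one is a multiple of [N]. *)
Lemma arc_return_dvd (N : nat) (a b : R) : (0 < N)%N -> a < b -> rarc a b `<=` Om ->
  exists n t, [/\ (0 < n)%N, a < t < b & rarc a b (iter (n * N) f (Some t))].
Proof.
move=> N0 ab h; have [y [s [s1 s2]]] := arc_returns N ab h.
have [i [j [ij jN e]]] : exists i j, [/\ (i < j)%N, (j <= N)%N & (s i %% N = s j %% N)%N].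
  have : ~ injective (fun i : 'I_N.+1 => Ordinal (ltn_pmod (s i) N0)).
    by move=> /leq_card; rewrite !card_ord ltnn.
  move=> ninj; apply: contrapT => no; apply: ninj => i j /(congr1 val) /= e.
  case: (ltngtP i j) => [ij|ji|/val_inj //]; case: no.
    by exists i, j; split=> //; rewrite -ltnS.
  by exists j, i; split=> //; rewrite -ltnS.
have smono m n : (m < n)%N -> (n <= N)%N -> (s m < s n)%N.
  elim: n => // n IHn; rewrite ltnS leq_eqVlt => /predU1P[->|mn] nN; first exact: s1.
  exact: ltn_trans (IHn mn (ltnW nN)) (s1 n nN).
have lt := smono i j ij jN.
have [t et tI] := s2 i (leq_trans (ltnW ij) jN).
exists ((s j - s i) %/ N)%N, t.
have E : ((s j - s i) %/ N * N = s j - s i)%N.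
  by apply/eqP; rewrite -dvdn_eq -eqn_mod_dvd ?(ltnW lt)//; apply/eqP.
split=> //.
  by rewrite -(ltn_pmul2r N0) mul0n E subn_gt0.
rewrite E -et -iterD subnK; last exact: ltnW.
exact: s2.
Qed.

(** Some point of an arc of the component returns to that arc, so the component of the image meets
    the original one, and components that meet coincide. *)
Lemma ccomp_periodic x : nondeg_set (ccomp x) -> exists n, (0 < n)%N /\ ccomp (iter n f x) = ccomp x.
Proof.
move=> /ccomp_arc[a [b [ab h]]].
have [n [t [n0 tI r]]] := arc_return ab (subset_trans h (@ccomp_sub x)).
exists n; split=> //.
have Ct : ccomp x (Some t) by apply: h; exists t.
have C't : ccomp (iter n f x) (iter n f (Some t)) by apply: ccomp_image; exists (Some t).
by rewrite -(ccomp_eq C't); apply: ccomp_eq; exact: h.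
Qed.

Lemma ccomp_iter_mul n k x : ccomp (iter n f x) = ccomp x -> Om x ->
  ccomp (iter (k * n) f x) = ccomp x.
Proof.
move=> e Ox; elim: k => // k IH.
have Cx : ccomp x (iter (k * n) f x).
  by rewrite -IH; apply: ccomp_refl; exact: nonwandering_iter.
by rewrite mulSn iterD (ccomp_iter_eq n Cx).
Qed.

End NonwanderingSet.

(** * Finiteness of the nondegenerate components *)

Lemma common_radius (R : realType) (P : nat -> R -> Prop) :
  (forall i e e', e' <= e -> P i e -> P i e') ->
  (forall i, exists2 e : R, 0 < e & P i e) ->
  forall k, exists2 e : R, 0 < e & forall i, (i < k)%N -> P i e.
Proof.
move=> anti H; elim=> [|k [e e0 IH]]; first by exists 1.
have [e' e'0 h] := H k; exists (Num.min e e'); first by rewrite lt_min e0.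
move=> i; rewrite ltnS leq_eqVlt => /predU1P[->|ik].
  by apply: anti h; rewrite ge_min lexx orbT.
by apply: anti (IH i ik); rewrite ge_min lexx.
Qed.

Section NonwanderingDecomposition.
Variable R : realType.
Variables p q : {poly R}.
Hypothesis pq_coprime : coprimep p q.
Hypothesis pq_degree : (0 < rdeg p q)%N.

Let f := ratR p q.
Let X := JuliaR p q.
Let Om := nonwandering X f.
Local Notation ccomp := (ccomp p q).

Let f_cont : rcont f := rcont_ratR pq_coprime pq_degree.

Lemma nonempty_comp x y : ccomp x y -> Om x.
Proof. by move=> [C [_ CO Cx] _]; exact: CO. Qed.

Lemma nondegenerate_Om x : nondeg_set (ccomp x) -> Om x.
Proof. by move=> [y [_ [_ xy _]]]; exact: nonempty_comp xy. Qed.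

Lemma ccomp_iter_mod n j x : ccomp (iter n f x) = ccomp x -> Om x ->
  ccomp (iter j f x) = ccomp (iter (j %% n) f x).
Proof.
move=> e Ox; rewrite {1}(divn_eq j n) addnC iterD.
apply: ccomp_iter_eq => //.
rewrite -(ccomp_iter_mul pq_coprime pq_degree (j %/ n) e Ox).
exact/ccomp_refl/nonwandering_iter.
Qed.

Section UnmarkedCycle.
Variables (x : rcircle R) (n : nat) (Z : seq R).
Hypothesis Z_mono : forall s t : R, (forall d, d \in Z -> ~~ (s <= d <= t)) ->
  mono_on f s t (fun t => p.[t] / q.[t]).
Hypothesis n_gt0 : (0 < n)%N.
Hypothesis x_periodic : ccomp (iter n f x) = ccomp x.
Hypothesis x_nondegenerate : nondeg_set (ccomp x).
Hypothesis unmarked_None : forall j, ~ ccomp (iter j f x) None.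
Hypothesis unmarked_Some : forall j t, t \in Z -> ~ ccomp (iter j f x) (Some t).

Let C := ccomp x.

Lemma ccomp_iter_real j s t w : ccomp (iter j f x) (Some s) -> ccomp (iter j f x) (Some t) ->
  s <= w <= t -> ccomp (iter j f x) (Some w).
Proof.
move=> Cs Ct /andP[sw wt].
have [[_ h]|[h _]] := connectedR_circle_interval (@ccomp_connected _ p q (iter j f x)).
  exact: h sw wt Cs Ct.
by case: (unmarked_None h).
Qed.

Lemma cycle_mono j s t : s < t -> C (Some s) -> C (Some t) ->
  exists phi, mono_on (iter j f) s t phi.
Proof.
move=> st Cs Ct; elim: j => [|j [phi M]]; first by exists id; exact: mono_on_id.
have [m1 m2 m3] := M; have st' := ltW st.
have Cj u : s <= u <= t -> ccomp (iter j f x) (Some (phi u)).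
  move=> uI; rewrite -m1//; apply: ccomp_image => //.
  by exists (Some u) => //; exact: (@ccomp_iter_real 0 s t).
have Cjs : ccomp (iter j f x) (Some (phi s)) by apply: Cj; rewrite lexx.
have Cjt : ccomp (iter j f x) (Some (phi t)) by apply: Cj; rewrite lexx st'.
have M' : mono_on f (Num.min (phi s) (phi t)) (Num.max (phi s) (phi t)) (fun t => p.[t] / q.[t]).
  apply: Z_mono => d dZ; apply/negP => dI; apply: (unmarked_Some (j := j) dZ).
  by move: dI; case: (leP (phi s) (phi t)) => _ dI; exact: ccomp_iter_real dI.
exists ((fun t => p.[t] / q.[t]) \o phi).
have -> : iter j.+1 f = f \o iter j f by apply/funext => z.
by apply: (mono_on_comp M M') => u; exact: (mono_on_range M).
Qed.

Lemma cycle_return j : iter (j * n) f @` C `<=` C.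
Proof.
move=> y Cy; rewrite /C -(ccomp_iter_mul pq_coprime pq_degree j x_periodic (nondegenerate_Om x_nondegenerate)).
exact: ccomp_image Cy.
Qed.

Lemma cycle_double_increasing s t s' t' : s < t -> C (Some s) -> C (Some t) ->
  iter (2 * n) f (Some s) = Some s' -> iter (2 * n) f (Some t) = Some t' -> s' < t'.
Proof.
move=> st Cs Ct; rewrite mul2n -addnn !iterD.
have real z : C z -> exists w, z = Some w.
  by case: z => [w|]; [exists w|move=> /(unmarked_None (j := 0))].
have ret z : C z -> C (iter n f z) by move=> Cz; apply: (@cycle_return 1); rewrite mul1n; exists z.
have [s1 e1] := real _ (ret _ Cs); have [t1 e2] := real _ (ret _ Ct).
have Cs1 : C (Some s1) by rewrite -e1; exact: ret.
have Ct1 : C (Some t1) by rewrite -e2; exact: ret.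
rewrite e1 e2.
have minC u v : C (Some u) -> C (Some v) -> C (Some (Num.min u v)) by case: leP.
have maxC u v : C (Some u) -> C (Some v) -> C (Some (Num.max u v)) by case: leP.
(* One segment containing [s], [t] and their images [s1], [t1]: iterate [n] then has the same
   orientation in both applications, and its square is increasing. *)
pose m := Num.min s (Num.min s1 t1); pose M := Num.max t (Num.max s1 t1).
have Cm : C (Some m) by apply/minC/minC.
have CM : C (Some M) by apply/maxC/maxC.
have ms : m <= s by rewrite ge_min lexx.
have tM : t <= M by rewrite le_max lexx.
have ms1 : m <= s1 by rewrite !ge_min lexx !orbT.
have mt1 : m <= t1 by rewrite !ge_min lexx !orbT.
have s1M : s1 <= M by rewrite !le_max lexx !orbT.
have t1M : t1 <= M by rewrite !le_max lexx !orbT.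
have mM : m < M by lra.
have [phi [h1 h2 _]] := cycle_mono n mM Cm CM.
rewrite !h1 ?ms1 ?mt1//.
move: e1 e2; rewrite !h1; [|lra|lra] => -[e1] [e2] [<-] [<-].
case: h2 => h2.
  by have lt := h2 s t ms st tM; rewrite e1 e2 in lt; exact: h2.
by have lt := h2 s t ms st tM; rewrite e1 e2 in lt; exact: h2.
Qed.

(** If [s] were moved, nearby points would move the same way by at least half as much up to the
    choice of [eta], and monotonicity would keep their orbits under iterate [2 n] from coming back
    near [s]. Returns at multiples of [2 n] exclude this. *)
Lemma cycle_double_id a b s : rarc a b `<=` C -> a < s < b ->
  iter (2 * n) f (Some s) = Some s.
Proof.
move=> abC /andP[as_ sb].
have Cs : C (Some s) by apply: abC; exists s => //; rewrite as_.
set N := (2 * n)%N.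
have ret i z : C z -> C (iter (i * N) f z).
  by move=> Cz; apply: (@cycle_return (i * 2)); rewrite -mulnA; exists z.
have real z : C z -> exists w, z = Some w.
  by case: z => [w|]; [exists w|move=> /(unmarked_None (j := 0))].
have [s' e] : exists s', iter N f (Some s) = Some s' by apply: real; have := ret 1%N _ Cs; rewrite mul1n.
rewrite e; congr Some; apply/eqP; apply: contrapT => /negP ne.
have g0 : 0 < `|s' - s| / 2 by rewrite divr_gt0// normr_gt0 subr_eq0.
have [r [r0 near]] := chordR_near_Some s' g0.
have [d [d0 hd]] := rcont_iter N f_cont (Some s) r0.
pose eta := Num.min (d / 4) (`|s' - s| / 2).
have eta0 : 0 < eta by rewrite lt_min g0 andbT divr_gt0.
have eta1 : eta <= d / 4 by rewrite ge_min lexx.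
have eta2 : eta <= `|s' - s| / 2 by rewrite ge_min lexx orbT.
pose a' := Num.max a (s - eta); pose b' := Num.min b (s + eta).
have a1 : a <= a' by rewrite le_max lexx.
have b1 : b' <= b by rewrite ge_min lexx.
have a2 : s - eta <= a' by rewrite le_max lexx orbT.
have b2 : b' <= s + eta by rewrite ge_min lexx orbT.
have a's : a' < s by rewrite gt_max as_ /=; lra.
have sb' : s < b' by rewrite lt_min sb /=; lra.
have abO : rarc a' b' `<=` Om.
  by move=> _ [w -> wI]; apply: (ccomp_sub (x := x)); apply: abC; exists w => //; lra.
have N0 : (0 < N)%N by rewrite muln_gt0.
have [k [t [k0 /andP[a't tb'] [w ew /andP[a'w wb']]]]] :=
  arc_return_dvd pq_coprime pq_degree N0 (lt_trans a's sb') abO.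
have Ct : C (Some t) by apply: abC; exists t => //; lra.
have /choice[y Hy] : forall i, exists y, iter (i * N) f (Some t) = Some y.
  by move=> i; apply: real; exact: ret.
have Cy i : C (Some (y i)) by rewrite -Hy; exact: ret.
have y0 : y 0%N = t by have := Hy 0%N; rewrite mul0n /= => -[].
have ynext i : iter N f (Some (y i)) = Some (y i.+1) by rewrite -Hy -iterD -mulSn Hy.
have yk : y k = w by have := Hy k; rewrite ew => -[].
have y1 : `|y 1%N - s'| < `|s' - s| / 2.
  have /hd : chordR (Some s) (Some t) < d.
    apply: le_lt_trans (chordR_le _ _) _.
    suff : `|s - t| <= d / 4 by lra.
    by rewrite ler_norml; lra.
  by rewrite e -y0 ynext => /near[_ [[<-]]].
have [lt|gt] := ltP s s'.
  have E : `|s' - s| = s' - s by rewrite ger0_norm; lra.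
  rewrite E in y1 eta2; move: y1; rewrite ltr_norml => /andP[l1 l2].
  have inc i : y i < y i.+1.
    elim: i => [|i IH]; first by rewrite y0; lra.
    exact: cycle_double_increasing IH (Cy _) (Cy _) (ynext _) (ynext _).
  have ge1 i : y 1%N <= y i.+1.
    by elim: i => // i IH; apply: le_trans IH (ltW (inc _)).
  by case: k k0 yk {ew} => // k _ yk; have := ge1 k; rewrite yk; lra.
have E : `|s' - s| = s - s' by rewrite distrC ger0_norm; lra.
rewrite E in y1 eta2; move: y1; rewrite ltr_norml => /andP[l1 l2].
have dec i : y i.+1 < y i.
  elim: i => [|i IH]; first by rewrite y0; lra.
  exact: cycle_double_increasing IH (Cy _) (Cy _) (ynext _) (ynext _).
have le1 i : y i.+1 <= y 1%N.
  by elim: i => // i IH; apply: le_trans (ltW (dec _)) IH.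
by case: k k0 yk {ew} => // k _ yk; have := le1 k; rewrite yk; lra.
Qed.

Lemma unmarked_cycle_absurd : False.
Proof.
have [a [b [ab abC]]] := ccomp_arc x_nondegenerate.
apply: (@periodic_arc_not_Julia _ p q (2 * n) a b) => //.
- by rewrite muln_gt0.
- move=> t tI; have [] : Om (Some t) by apply: (ccomp_sub (x := x)); apply: abC; exists t.
  by [].
- move=> t i tI e; apply: (@unmarked_None i); rewrite -e.
  by apply: ccomp_image => //; exists (Some t) => //; apply: abC; exists t.
- by move=> t tI; apply: cycle_double_id abC tI.
Qed.

End UnmarkedCycle.

Lemma cycle_marked : exists D : seq (rcircle R), forall x n, (0 < n)%N ->
  ccomp (iter n f x) = ccomp x -> nondeg_set (ccomp x) ->
  exists j c, [/\ (j < n)%N, c \in D & ccomp (iter j f x) c].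
Proof.
have [Z HZ] := ratR_mono_on pq_coprime pq_degree.
exists (None :: map Some Z) => x n n0 e nd; apply: contrapT => no.
have Ox := nondegenerate_Om nd.
have un j c : c \in None :: map Some Z -> ~ ccomp (iter j f x) c.
  move=> cD; rewrite (ccomp_iter_mod j e Ox) => h; apply: no.
  by exists (j %% n)%N, c; split=> //; rewrite ltn_pmod.
apply: (@unmarked_cycle_absurd x n Z) => //.
- by move=> j; apply: un; rewrite mem_head.
- by move=> j t tZ; apply: un; rewrite inE map_f ?orbT.
Qed.

(** Each cycle contains a component with a marked point [c], and following [c] for less than its
    period reaches every component of the cycle. Both the marked points and their periods are
    bounded in number and size. *)
Lemma finitely_many_components : exists L : seq (rcircle R),
  (forall x, x \in L -> nondeg_set (ccomp x)) /\
  forall x, nondeg_set (ccomp x) -> exists2 y, y \in L & ccomp x = ccomp y.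
Proof.
have [D HD] := cycle_marked.
have /choice[per Hper] : forall c, exists n, nondeg_set (ccomp c) ->
    (0 < n)%N /\ ccomp (iter n f c) = ccomp c.
  move=> c; have [nd|nd] := pselect (nondeg_set (ccomp c)); last by exists 0%N.
  by have [n h] := ccomp_periodic pq_coprime pq_degree nd; exists n.
pose M := (\max_(c <- D) per c)%N.
exists [seq x <- [seq iter i f c | c <- D, i <- iota 0 M] | `[< nondeg_set (ccomp x) >]].
split; first by move=> x; rewrite mem_filter => /andP[/asboolP].
move=> x nd; have [n [n0 e]] := ccomp_periodic pq_coprime pq_degree nd.
have [j [c [jn cD jc]]] := HD x n n0 e nd.
have ec : ccomp c = ccomp (iter j f x) := ccomp_eq jc.
have ndc : nondeg_set (ccomp c) by rewrite ec; exact: ccomp_iter_nondegenerate.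
have [per0 perc] := Hper c ndc.
have E : ccomp x = ccomp (iter ((n - j) %% per c) f c).
  rewrite -(ccomp_iter_mod (n - j) perc (nondegenerate_Om ndc)).
  have -> : ccomp (iter (n - j) f c) = ccomp (iter (n - j) f (iter j f x)).
    exact: ccomp_iter_eq.
  by rewrite -iterD subnK ?e// ltnW.
exists (iter ((n - j) %% per c) f c) => //.
rewrite mem_filter; apply/andP; split; first by apply/asboolP; rewrite -E.
apply: allpairs_f => //; rewrite mem_iota /= add0n.
apply: leq_trans (ltn_pmod _ per0) _.
exact: leq_bigmax_seq.
Qed.

(** Interior points other than infinity. A connected set with two points contains a real arc, so a
    subset of [Om] that avoids these points is already totally disconnected. *)
Definition real_interior : set (rcircle R) :=
  [set z | exists t a b, [/\ z = Some t, a < t < b & rarc a b `<=` Om]].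

(* If [x] reaches the interior of a nondegenerate component then it is trapped
   in a finite cycle of closed components, and can only be nonwandering if it
   belongs to one of them. *)
Lemma trapped_nondegenerate x n : Om x -> real_interior (iter n f x) ->
  nondeg_set (ccomp x).
Proof.
move=> Ox [t [a [b [ext tI abO]]]]; apply: contrapT => deg.
have ndz : nondeg_set (ccomp (iter n f x)) by rewrite ext; exact: arc_comp_nondegenerate tI.
set z := iter n f x in ext ndz.
have Oz : Om z by exact: nondegenerate_Om ndz.
have notin i : ~ ccomp (iter i f z) x.
  move=> h; apply: deg; rewrite (ccomp_eq h).
  exact: ccomp_iter_nondegenerate.
have [N [N0 eN]] := ccomp_periodic pq_coprime pq_degree ndz.
have /andP[at_ tb] := tI.
have seg : [set y | exists2 s, y = Some s & (a + t) / 2 <= s <= (t + b) / 2] `<=` ccomp z.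
  apply: (ccomp_max (y := Some t)); first exact: connectedR_segment.
  - by move=> _ [s -> sI]; apply: abO; exists s => //; lra.
  - by exists t => //; apply/andP; split; lra.
  - by rewrite -ext; exact: ccomp_refl.
have g0 : 0 < Num.min ((t - a) / 2) ((b - t) / 2) by rewrite lt_min; apply/andP; split; lra.
have [r [r0 near]] := chordR_near_Some t g0.
have [d [d0 hd]] := rcont_iter n f_cont x r0.
have into y : chordR x y < d -> ccomp z (iter n f y).
  move=> /hd; rewrite -/z ext => /near[w [-> ]].
  rewrite lt_min !ltr_norml => /andP[? ?]; rewrite -ext; apply: seg; exists w => //.
  by apply/andP; split; lra.
(* Distance from [x] to the cycle of [z]: finitely many closed components, none containing [x]. *)
have [e1 e10 far] : exists2 e : R, 0 < e & forall i, (i < N)%N ->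
    forall y, ccomp (iter i f z) y -> e <= chordR x y.
  apply: (common_radius (P := fun i e => forall y, ccomp (iter i f z) y -> e <= chordR x y)).
    by move=> i e e' ee h y /h; exact: le_trans.
  move=> i; apply: contrapT => no; apply: (notin i).
  apply: (ccomp_closed (x := iter i f z)).
    exact: nonwandering_iter.
  move=> e e0; apply: contrapT => no'; apply: no; exists e => // y yC.
  by rewrite leNgt; apply/negP => lt; apply: no'; exists y.
(* Returns before the capture at time [n] are excluded separately: [x] is not periodic, so it keeps
   a distance from its first iterates. *)
have [e2 e20 noret] : exists2 e : R, 0 < e & forall m, (m < n)%N -> (0 < m)%N ->
    forall y, chordR x y < e -> e <= chordR x (iter m f y).
  apply: (common_radius (P := fun m e => (0 < m)%N ->
    forall y, chordR x y < e -> e <= chordR x (iter m f y))).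
    by move=> m e e' ee h m0 y xy; apply: (le_trans ee); apply: h => //; exact: (lt_le_trans xy ee).
  move=> m; have [->|m0] := posnP m; first by exists 1.
  have ne : x <> iter m f x.
    move=> ex; have xm k : iter (k * m) f x = x.
      by elim: k => // k IH; rewrite mulSn iterD IH -ex.
    (* A periodic [x] is reached again from [z] after [n m - n] steps and would belong to the
       cycle. *)
    apply: (notin (n * m - n)%N); rewrite /z -iterD subnK; last by rewrite leq_pmulr.
    by rewrite xm; exact: ccomp_refl.
  have c0 := chordR_gt0 ne; have c2 : 0 < chordR x (iter m f x) / 2 by lra.
  have [d' [d'0 hd']] := rcont_iter m f_cont x c2.
  exists (Num.min d' (chordR x (iter m f x) / 2)); first by rewrite lt_min d'0.
  move=> _ y; rewrite lt_min => /andP[/hd' h _].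
  have := chordR_triangle (iter m f y) x (iter m f x); rewrite (chordRC (iter m f y)).
  by rewrite ge_min => ?; apply/orP; right; lra.
have e0 : 0 < Num.min d (Num.min e1 e2) by rewrite !lt_min d0 e10.
have [_ /(_ _ e0)[m [m0 [y [_ [xy xm]]]]]] := Ox.
move: xy xm; rewrite !lt_min => /and3P[xd _ x2] /and3P[_ xm1 xm2].
have [mn|nm] := ltnP m n.
  by have := noret m mn m0 y x2; lra.
have Cm : ccomp (iter (m - n) f z) (iter m f y).
  rewrite -{2}(subnK nm) iterD; apply: ccomp_image => //.
  by exists (iter n f y) => //; exact: into.
rewrite (ccomp_iter_mod _ eN Oz) in Cm.
by have := far _ (ltn_pmod _ N0) _ Cm; lra.
Qed.

(** The set [K] is cut out by a condition on whole orbits, which makes it forward invariant. For the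
    complement of the intervals this is not clear, since a point could land on the boundary of an
    interval; accordingly [K] may share boundary points with the intervals. *)
Theorem nonwandering_decomposition :
  exists (k : nat) (Is : nat -> set (rcircle R)) (K : set (rcircle R)),
    (forall i, (i < k)%N -> nd_interval (Is i)) /\
    subsystem X f K /\ totally_disconnectedR K /\
    Om = (\bigcup_(i in [set i : nat | (i < k)%N]) Is i) `|` K.
Proof.
have [L [L1 L2]] := finitely_many_components.
pose K : set (rcircle R) := [set x | Om x /\ forall n, ~ real_interior (iter n f x)].
exists (size L), (fun i => ccomp (nth None L i)), K; split.
  move=> i iL; have nd := L1 _ (mem_nth None iL); split.
    exact: connectedR_circle_interval (@ccomp_connected _ p q _).
  by have [y [z [yz Cy Cz]]] := nd; exists y, z.
split.
  split; first by move=> x [[]].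
  move=> x [Ox h]; split; first exact: nonwandering_forward.
  by move=> n; rewrite -iterSr; exact: h.
split.
  move=> C CK Cc x y Cx Cy; apply: contrapT => xy.
  have [a [b [ab abC]]] := circle_interval_arc (connectedR_circle_interval Cc) xy Cx Cy.
  have mid : a < (a + b) / 2 < b by apply/andP; split; lra.
  have in_arc : rarc a b (Some ((a + b) / 2)) by exists ((a + b) / 2).
  have [_ /(_ 0%N)] := CK _ (abC _ in_arc); apply.
  by exists ((a + b) / 2), a, b; split=> // z /abC /CK[].
apply/seteqP; split=> [x Ox|x [[i _ /ccomp_sub]|[]]] //.
have [nd|deg] := pselect (nondeg_set (ccomp x)).
  have [y yL e] := L2 x nd; left; exists (index y L); first by rewrite /= index_mem.
  by rewrite /= nth_index// -e; exact: ccomp_refl.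
right; split=> // n h; apply: deg; exact: trapped_nondegenerate h.
Qed.

End NonwanderingDecomposition.

Theorem theoremA1 (R : realType) (p q : {poly R}) :
  coprimep p q -> (2 <= rdeg p q)%N ->
  ( nonwandering (JuliaR p q) (ratR p q) = setT \/
    exists (k : nat) (Is : nat -> set (rcircle R)) (K : set (rcircle R)),
      (forall i, (i < k)%N -> nd_interval (Is i)) /\
      subsystem (JuliaR p q) (ratR p q) K /\
      totally_disconnectedR K /\
      nonwandering (JuliaR p q) (ratR p q) =
        (\bigcup_(i in [set i : nat | (i < k)%N]) Is i) `|` K ) /\
  exists Y : set (rcircle R),
    closedR Y /\
    subsystem (JuliaR p q) (ratR p q) Y /\
    top_entropy (ratR p q) Y = top_entropy (ratR p q) (JuliaR p q) /\
    Y `<=` closureR (Y `&` preperiodic (ratR p q)).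
Proof.
move=> pq_coprime pq_degree; have d0 := ltnW pq_degree.
(* The second alternative includes the case of the whole circle, which satisfies [circle_interval]
   with no real missing. *)
by split; [right; exact: nonwandering_decomposition|exact: preperiodic_full_entropy].
Qed.
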